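(* Let $k$ be a field, $R$ a $k$-algebra, and $Q$ a small $k$-preadditive category satisfying conditions (Fin), (Rad) and (SelfInj). Let $\mathscr{M}={}_R\mathrm{Mod}$ be the category of left $R$-modules and $\mathscr{X}={}_{Q,R}\mathrm{Mod}$ the category of $k$-linear functors $Q\to{}_R\mathrm{Mod}$. If $(\mathscr{A},\mathscr{B})$ is a hereditary cotorsion pair in $\mathscr{M}$, then there are hereditary, compatible cotorsion pairs $\big(\Phi(\mathscr{A}),\Phi(\mathscr{A})^{\perp}\big)$ and $\big({}^{\perp}\Psi(\mathscr{B}),\Psi(\mathscr{B})\big)$ in $\mathscr{X}$, where $$\Phi(\mathscr{A})=\{X\in\mathscr{X}\mid \text{if } q\in Q \text{ then } C_q(X)\in\mathscr{A} \text{ and } L_1C_q(X)=0\},$$ $$\Psi(\mathscr{B})=\{X\in\mathscr{X}\mid \text{if } q\in Q \text{ then } K_q(X)\in\mathscr{B} \text{ and } R^1K_q(X)=0\}.$$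
   Context: Cotorsion pairs. Let $\mathscr{Y}$ be an abelian category. For classes of objects $\Gamma,\Delta$ put $\Gamma^{\perp}=\{Y\mid \operatorname{Ext}^1_{\mathscr{Y}}(C,Y)=0 \text{ for all } C\in\Gamma\}$ and ${}^{\perp}\Delta=\{Y\mid \operatorname{Ext}^1_{\mathscr{Y}}(Y,D)=0 \text{ for all } D\in\Delta\}$. A cotorsion pair is a pair $(\Gamma,\Delta)$ with $\Gamma={}^{\perp}\Delta$ and $\Gamma^{\perp}=\Delta$. It is hereditary if $\Gamma$ is closed under kernels of epimorphisms and $\Delta$ is closed under cokernels of monomorphisms. Cotorsion pairs $(\Phi,\Phi^{\perp})$ and $({}^{\perp}\Psi,\Psi)$ (in this order) are compatible if $\operatorname{Ext}^1_{\mathscr{Y}}(F,P)=0$ for all $F\in\Phi$, $P\in\Psi$, and $\Phi\cap\Phi^{\perp}={}^{\perp}\Psi\cap\Psi$. Conditions on $Q$. A small $k$-preadditive category is a small category whose Hom spaces $Q(p,q)$ are $k$-vector spaces with $k$-bilinear composition; $\operatorname{rad}_Q$ denotes its radical ($f\in\operatorname{rad}_Q(p,q)$ iff $1_p-gf$ is invertible for each $g\in Q(q,p)$). The conditions are: (Fin) each Hom space of $Q$ is finite dimensional over $k$; for fixed $q\in Q$ one has $Q(p,q)=Q(q,p)=0$ except for finitely many $p\in Q$; there is an integer $N$ with $\operatorname{rad}_Q^N=0$. (Rad) if $q\in Q$ then $Q(q,q)$ is a local $k$-algebra and the canonical map $k\to Q(q,q)/\operatorname{rad}Q(q,q)$ is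 an isomorphism of $k$-algebras; if $p\neq q$ are in $Q$ then $Q(p,q)=\operatorname{rad}_Q(p,q)$. (SelfInj) $Q$ has a Serre functor: a $k$-linear autoequivalence $W:Q\to Q$ with natural isomorphisms $Q(p,q)\cong\mathrm{D}Q(q,Wp)$, where $\mathrm{D}(-)=\operatorname{Hom}_k(-,k)$. Functors. $q\in Q$ means $q$ is an object of $Q$. ${}_Q\mathrm{Mod}$ (resp. $\mathrm{Mod}_Q$) is the category of $k$-linear functors $Q\to{}_k\mathrm{Mod}$ (resp. $Q^{\mathrm{op}}\to{}_k\mathrm{Mod}$). For $q\in Q$, $S\langle q\rangle=Q(q,-)/\operatorname{rad}_Q(q,-)$ is the simple object of ${}_Q\mathrm{Mod}$ with $S\langle q\rangle(q)\cong k$ and $S\langle q\rangle(p)=0$ for $p\ne q$; its dual $\mathrm{D}S\langle q\rangle$ is a simple object of $\mathrm{Mod}_Q$. Define $S_q:\mathscr{M}\to\mathscr{X}$ and $C_q,K_q:\mathscr{X}\to\mathscr{M}$ by $C_q(-)=\mathrm{D}S\langle q\rangle\otimes_Q-$, $S_q(-)=S\langle q\rangle\otimes_k-$ (computed objectwise), $K_q(-)=\operatorname{Hom}_Q(S\langle q\rangle,-)$, where $\otimes_Q$ is the tensor product of functors $\mathrm{Mod}_Q\times{}_{Q,R}\mathrm{Mod}\to{}_R\mathrm{Mod}$ and $\operatorname{Hom}_Q$ is the space of $k$-linear natural transformations with induced $R$-module structure. $C_q$ is left adjoint and $K_q$ is right adjoint to $S_q$. $L_iC_q$ and $R^iK_q$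 are the left, respectively right, derived functors ($\mathscr{X}$ has enough projectives and enough injectives). *)

(* Defs.v *)
From HB Require Import structures.
From mathcomp Require Import all_boot all_order all_algebra.
From mathcomp Require Import boolp classical_sets functions cardinality.

Set Implicit Arguments.
Unset Strict Implicit.
Unset Printing Implicit Defensive.

Import GRing.Theory.

Local Open Scope ring_scope.
Local Open Scope quotient_scope.

Declare Scope cat_scope.
Delimit Scope cat_scope with cat.
Reserved Notation "g \oc f" (at level 50, left associativity).
Reserved Notation "g \ol f" (at level 40, left associativity).

(* -------------------------------------------------------------------------- *)
(* Categories with zero morphisms. Only the universal properties of kernels   *)
(* and cokernels enter below; the two categories to which the notions are     *)
(* applied, RMod R and QRMod Q R, are abelian, and there they have their      *)
(* usual meaning.                                                             *)

Record zcat := ZCat {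
  ob :> Type;
  hom : ob -> ob -> Type;
  idc : forall X, hom X X;
  compc : forall X Y Z, hom Y Z -> hom X Y -> hom X Z;
  zeroc : forall X Y, hom X Y;
  compcA : forall X Y Z T (h : hom Z T) (g : hom Y Z) (f : hom X Y),
    compc h (compc g f) = compc (compc h g) f;
  comp1c : forall X Y (f : hom X Y), compc (idc Y) f = f;
  compc1 : forall X Y (f : hom X Y), compc f (idc X) = f;
  comp0c : forall X Y Z (f : hom X Y), compc (zeroc Y Z) f = zeroc X Z;
  compc0 : forall X Y Z (g : hom Y Z), compc g (zeroc X Y) = zeroc X Z }.

Arguments idc {z} X.
Arguments compc {z X Y Z} g f.
Arguments zeroc {z} X Y.
Notation "g \oc f" := (compc g f) : cat_scope.
Local Open Scope cat_scope.

Section ZCatNotions.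
Variable C : zcat.

Definition is_zero (X : C) : Prop := idc X = zeroc X X.

Definition is_iso (X Y : C) (f : hom X Y) : Prop :=
  exists g : hom Y X, g \oc f = idc X /\ f \oc g = idc Y.

Definition is_mono (X Y : C) (f : hom X Y) : Prop :=
  forall T (u v : hom T X), f \oc u = f \oc v -> u = v.

Definition is_epi (X Y : C) (f : hom X Y) : Prop :=
  forall T (u v : hom Y T), u \oc f = v \oc f -> u = v.

Definition is_kernel (K X Y : C) (i : hom K X) (f : hom X Y) : Prop :=
  f \oc i = zeroc K Y /\
  forall T (t : hom T X), f \oc t = zeroc T Y ->
    exists! u : hom T K, i \oc u = t.

Definition is_cokernel (X Y L : C) (p : hom Y L) (f : hom X Y) : Prop :=
  p \oc f = zeroc X L /\
  forall T (t : hom Y T), t \oc f = zeroc X T ->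
    exists! u : hom L T, u \oc p = t.

(* H is the homology at Y of the complex X --f--> Y --g--> Z: the cokernel of *)
(* the morphism X -> Ker g induced by f.                                      *)
Definition is_homology (X Y Z : C) (f : hom X Y) (g : hom Y Z) (H : C) : Prop :=
  exists (K : C) (i : hom K Y) (e : hom X K) (c : hom K H),
    [/\ is_kernel i g, i \oc e = f & is_cokernel c e].

Definition exact_at (X Y Z : C) (f : hom X Y) (g : hom Y Z) : Prop :=
  g \oc f = zeroc X Z /\ exists2 H : C, is_homology f g H & is_zero H.

Definition short_exact (X Y Z : C) (i : hom X Y) (p : hom Y Z) : Prop :=
  is_kernel i p /\ is_cokernel p i.

Definition is_projective (P : C) : Prop :=
  forall (X Y : C) (e : hom X Y) (f : hom P Y), is_epi e ->
    exists g : hom P X, e \oc g = f.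

Definition is_injective (J : C) : Prop :=
  forall (X Y : C) (m : hom X Y) (f : hom X J), is_mono m ->
    exists g : hom Y J, g \oc m = f.

(* Yoneda's description of Ext^1(X, Y): its elements are the equivalence      *)
(* classes of extensions 0 -> Y -> E -> X -> 0, and its zero is the class of  *)
(* the split one. Hence Ext^1(X, Y) = 0 iff there is a single class.          *)
Record extension (X Y : C) := Extension {
  ext_ob : C;
  ext_in : hom Y ext_ob;
  ext_out : hom ext_ob X;
  ext_exact : short_exact ext_in ext_out }.

Definition ext_equiv (X Y : C) (E F : extension X Y) : Prop :=
  exists2 u : hom (ext_ob E) (ext_ob F), is_iso u &
    u \oc ext_in E = ext_in F /\ ext_out F \oc u = ext_out E.

Definition Ext1_zero (X Y : C) : Prop := forall E F : extension X Y, ext_equiv E F.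

(* Classes of objects. The type set of classical_sets is not available here   *)
(* for universe reasons: it is constrained to the level of small types.       *)
Definition obclass := C -> Prop.
Definition class_eq (G D : obclass) : Prop := forall X, G X <-> D X.

Definition rperp (G : obclass) : obclass := fun Y => forall X, G X -> Ext1_zero X Y.
Definition lperp (D : obclass) : obclass := fun X => forall Y, D Y -> Ext1_zero X Y.

Definition cotorsion_pair (G D : obclass) : Prop :=
  class_eq G (lperp D) /\ class_eq (rperp G) D.

Definition closed_ker_epi (G : obclass) : Prop :=
  forall (K X Y : C) (i : hom K X) (p : hom X Y),
    is_epi p -> is_kernel i p -> G X -> G Y -> G K.

Definition closed_coker_mono (D : obclass) : Prop :=
  forall (X Y L : C) (i : hom X Y) (p : hom Y L),
    is_mono i -> is_cokernel p i -> D X -> D Y -> D L.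

Definition hereditary (G D : obclass) : Prop :=
  closed_ker_epi G /\ closed_coker_mono D.

(* Compatibility of (F, F') and (P', P), in this order. *)
Definition compatible (F F' P' P : obclass) : Prop :=
  (forall X Y, F X -> P Y -> Ext1_zero X Y) /\ class_eq (fun X => F X /\ F' X) (fun X => P' X /\ P X).

Record proj_resolution (X : C) := ProjResolution {
  pr_ob : nat -> C;
  pr_d : forall n, hom (pr_ob n.+1) (pr_ob n);
  pr_aug : hom (pr_ob 0) X;
  pr_proj : forall n, is_projective (pr_ob n);
  pr_epi : is_epi pr_aug;
  pr_exact0 : exact_at (pr_d 0) pr_aug;
  pr_exact : forall n, exact_at (pr_d n.+1) (pr_d n) }.

Record inj_resolution (X : C) := InjResolution {
  ir_ob : nat -> C;
  ir_d : forall n, hom (ir_ob n) (ir_ob n.+1);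
  ir_aug : hom X (ir_ob 0);
  ir_inj : forall n, is_injective (ir_ob n);
  ir_mono : is_mono ir_aug;
  ir_exact0 : exact_at ir_aug (ir_d 0);
  ir_exact : forall n, exact_at (ir_d n) (ir_d n.+1) }.

End ZCatNotions.

Record zfunctor (C D : zcat) := ZFunctor {
  zf_ob :> C -> D;
  zf_map : forall X Y : C, hom X Y -> hom (zf_ob X) (zf_ob Y);
  zf_id : forall X : C, zf_map (idc X) = idc (zf_ob X);
  zf_comp : forall (X Y Z : C) (g : hom Y Z) (f : hom X Y),
    zf_map (g \oc f) = zf_map g \oc zf_map f;
  zf_zero : forall X Y : C, zf_map (zeroc X Y) = zeroc (zf_ob X) (zf_ob Y) }.

(* L is a value at X of the first left derived functor of F, computed from    *)
(* some projective resolution; it is determined up to isomorphism.            *)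
Definition is_L1 (C D : zcat) (F : zfunctor C D) (X : C) (L : D) : Prop :=
  exists P : proj_resolution X,
    is_homology (zf_map F (pr_d P 1)) (zf_map F (pr_d P 0)) L.

Definition is_R1 (C D : zcat) (F : zfunctor C D) (X : C) (L : D) : Prop :=
  exists J : inj_resolution X,
    is_homology (zf_map F (ir_d J 0)) (zf_map F (ir_d J 1)) L.

Definition L1_zero (C D : zcat) (F : zfunctor C D) (X : C) : Prop :=
  exists2 L : D, is_L1 F X L & is_zero L.

Definition R1_zero (C D : zcat) (F : zfunctor C D) (X : C) : Prop :=
  exists2 L : D, is_R1 F X L & is_zero L.

(* -------------------------------------------------------------------------- *)
(* k-algebras, as rings with a central structure map. In contrast with        *)
(* algType k, the zero ring is allowed.                                       *)

Record kalg (k : fieldType) := KAlg {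
  kalg_ring :> pzRingType;
  kalg_map : {rmorphism k -> kalg_ring};
  kalg_central : forall c r, kalg_map c * r = r * kalg_map c }.

Arguments kalg_map {k} R : rename.

Definition kself (k : fieldType) : kalg k :=
  @KAlg k k idfun (fun c r => mulrC c r).

Notation kscale R := (kalg_map R \; *:%R).

Lemma linear_eq (R : pzRingType) (U : lmodType R) (V : zmodType)
    (s : R -> V -> V) (f g : {linear U -> V | s}) : f =1 g -> f = g.
Proof.
case: f g => f [[fN] [fS]] [g [[gN] [gS]]] /= /funext E.
by subst g; rewrite (Prop_irrelevance fN gN) (Prop_irrelevance fS gS).
Qed.


Section RMod.
Variable R : pzRingType.
Implicit Types U V W T : lmodType R.

Fact RMod_compA U V W T (h : {linear W -> T}) (g : {linear V -> W})
  (f : {linear U -> V}) : h \o (g \o f) = (h \o g) \o f :> {linear U -> T}.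
Proof. exact: linear_eq. Qed.

Fact RMod_comp1 U V (f : {linear U -> V}) : idfun \o f = f :> {linear U -> V}.
Proof. exact: linear_eq. Qed.

Fact RMod_compr1 U V (f : {linear U -> V}) : f \o idfun = f :> {linear U -> V}.
Proof. exact: linear_eq. Qed.

Fact RMod_comp0 U V W (f : {linear U -> V}) : \0 \o f = \0 :> {linear U -> W}.
Proof. exact: linear_eq. Qed.

Fact RMod_compr0 U V W (g : {linear V -> W}) : g \o \0 = \0 :> {linear U -> W}.
Proof. by apply: linear_eq => x /=; rewrite raddf0. Qed.

Definition RMod : zcat :=
  @ZCat (lmodType R) (fun U V => {linear U -> V}) (fun U => idfun)
    (fun U V W g f => g \o f) (fun U V => \0)
    RMod_compA RMod_comp1 RMod_compr1 RMod_comp0 RMod_compr0.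

End RMod.

(* -------------------------------------------------------------------------- *)
(* Small k-preadditive categories.                                            *)

Record lincat (k : fieldType) := LinCat {
  lob :> Type;
  lhom : lob -> lob -> lmodType k;
  lid : forall p, lhom p p;
  lcomp : forall p q r, lhom q r -> lhom p q -> lhom p r;
  lcompA : forall p q r s (h : lhom r s) (g : lhom q r) (f : lhom p q),
    lcomp h (lcomp g f) = lcomp (lcomp h g) f;
  lcomp1l : forall p q (f : lhom p q), lcomp (lid q) f = f;
  lcompl1 : forall p q (f : lhom p q), lcomp f (lid p) = f;
  lcompDl : forall p q r (g g' : lhom q r) (f : lhom p q),
    lcomp (g + g') f = lcomp g f + lcomp g' f;
  lcompDr : forall p q r (g : lhom q r) (f f' : lhom p q),
    lcomp g (f + f') = lcomp g f + lcomp g f';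
  lcompZl : forall p q r c (g : lhom q r) (f : lhom p q),
    lcomp (c *: g) f = c *: lcomp g f;
  lcompZr : forall p q r c (g : lhom q r) (f : lhom p q),
    lcomp g (c *: f) = c *: lcomp g f }.

Arguments lhom {k Q} p q : rename.
Arguments lid {k Q} p : rename.
Arguments lcomp {k Q p q r} g f : rename.
Notation "g \ol f" := (lcomp g f) : cat_scope.

Section LinCatTheory.
Variables (k : fieldType) (Q : lincat k).
Implicit Types p q r : Q.

Fact lcomp0l p q r (f : lhom p q) : (0 : lhom q r) \ol f = 0.
Proof. by rewrite -(scale0r (0 : lhom q r)) lcompZl scale0r. Qed.

Fact lcompl0 p q r (g : lhom q r) : g \ol (0 : lhom p q) = 0.
Proof. by rewrite -(scale0r (0 : lhom p q)) lcompZr scale0r. Qed.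

Fact lcompBr p q r (g : lhom q r) (f f' : lhom p q) :
  g \ol (f - f') = g \ol f - g \ol f'.
Proof. by rewrite -(scaleN1r f') lcompDr lcompZr scaleN1r. Qed.

Fact lcompBl p q r (g g' : lhom q r) (f : lhom p q) :
  (g - g') \ol f = g \ol f - g' \ol f.
Proof. by rewrite -(scaleN1r g') lcompDl lcompZl scaleN1r. Qed.

Definition lop : lincat k :=
  @LinCat k Q (fun p q => lhom q p) (fun p => lid p) (fun p q r g f => f \ol g)
    (fun p q r s h g f => esym (lcompA f g h))
    (fun p q f => lcompl1 f) (fun p q f => lcomp1l f)
    (fun p q r g g' f => lcompDr f g g') (fun p q r g f f' => lcompDl f f' g)
    (fun p q r c g f => lcompZr c f g) (fun p q r c g f => lcompZl c f g).

Definition liso p q (f : lhom p q) : Prop :=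
  exists g : lhom q p, g \ol f = lid p /\ f \ol g = lid q.

Definition lrad p q (f : lhom p q) : Prop :=
  forall g : lhom q p, liso (lid p - g \ol f).

(* The ideal rad^n: all sums of n-fold composites of radical morphisms. *)
Inductive lrad_pow : nat -> forall p q, lhom p q -> Prop :=
| LRadPow0 p q (f : lhom p q) : lrad_pow 0 f
| LRadPowZero n p q : lrad_pow n (0 : lhom p q)
| LRadPowAdd n p q (f g : lhom p q) :
    lrad_pow n f -> lrad_pow n g -> lrad_pow n (f + g)
| LRadPowComp n p q r (g : lhom q r) (f : lhom p q) :
    lrad g -> lrad_pow n f -> lrad_pow n.+1 (g \ol f).

Fact liso_comp p q r (g : lhom q r) (f : lhom p q) :
  liso g -> liso f -> liso (g \ol f).
Proof.
move=> [g' [g'g gg']] [f' [f'f ff']]; exists (f' \ol g'); split.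
  by rewrite lcompA -(lcompA f') g'g lcompl1.
by rewrite lcompA -(lcompA g) ff' lcompl1.
Qed.

Fact lrad0 p q : lrad (0 : lhom p q).
Proof.
by move=> g; rewrite lcompl0 subr0; exists (lid p); rewrite lcomp1l.
Qed.

Fact lradZ p q c (f : lhom p q) : lrad f -> lrad (c *: f).
Proof. by move=> fr g; rewrite lcompZr -lcompZl. Qed.

Fact lradD p q (f g : lhom p q) : lrad f -> lrad g -> lrad (f + g).
Proof.
move=> fr gr h; have [u [uf fu]] := fr h.
have -> : lid p - h \ol (f + g) =
    (lid p - h \ol f) \ol (lid p - (u \ol h) \ol g).
  rewrite lcompBr lcompl1 -lcompA (lcompA _ u) fu lcomp1l.
  by rewrite lcompDr opprD addrA.
by apply: liso_comp; [exact: fr | exact: gr].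
Qed.

Fact lrad_compl p q r (g : lhom q r) (f : lhom p q) : lrad f -> lrad (g \ol f).
Proof. by move=> fr h; rewrite lcompA. Qed.

Definition lradb p q (f : lhom p q) : bool := `[< lrad f >].

Fact lradb_zmod p q : zmod_closed (@lradb p q).
Proof.
split; first by apply/asboolP/lrad0.
move=> f g /asboolP fr /asboolP gr; apply/asboolP/lradD => //.
by rewrite -scaleN1r; exact: lradZ.
Qed.

HB.instance Definition _ p q :=
  GRing.isZmodClosed.Build (lhom p q) (@lradb p q) (@lradb_zmod p q).

(* Q(p, q) / rad_Q(p, q) as a vector space over k. *)
Definition lquot p q : Type :=
  Quotient.quot (GRing.ZmodClosed.clone (lhom p q) (@lradb p q) _).

HB.instance Definition _ p q := GRing.Zmodule.on (lquot p q).
HB.instance Definition _ p q := EqQuotient.on (lquot p q).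

Definition lquot_pi p q (f : lhom p q) : lquot p q := \pi f.

Fact lquot_eqP p q (f g : lhom p q) : lquot_pi f = lquot_pi g <-> lrad (f - g).
Proof.
split=> [/eqP|fr].
  by rewrite /lquot_pi -Quotient.idealrBE => /asboolP.
by apply/eqP; rewrite /lquot_pi -Quotient.idealrBE; apply/asboolP.
Qed.

Fact lquot_reprK p q (x : lquot p q) : lquot_pi (repr x) = x.
Proof. exact: reprK. Qed.

Fact lquot_piD p q (f g : lhom p q) :
  lquot_pi (f + g) = lquot_pi f + lquot_pi g.
Proof. exact: raddfD. Qed.

Definition lquot_scale p q (c : k) (x : lquot p q) : lquot p q :=
  lquot_pi (c *: repr x).

Fact lquot_piZ p q c (f : lhom p q) :
  lquot_scale c (lquot_pi f) = lquot_pi (c *: f).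
Proof.
apply/lquot_eqP; rewrite -scalerBr; apply/lradZ/lquot_eqP.
exact: lquot_reprK.
Qed.

Fact lquot_scaleA p q a b (x : lquot p q) :
  lquot_scale a (lquot_scale b x) = lquot_scale (a * b) x.
Proof. by rewrite -(lquot_reprK x) !lquot_piZ scalerA. Qed.

Fact lquot_scale1 p q : left_id 1 (@lquot_scale p q).
Proof. by move=> x; rewrite -(lquot_reprK x) lquot_piZ scale1r. Qed.

Fact lquot_scaleDr p q : right_distributive (@lquot_scale p q) +%R.
Proof.
move=> a x y; rewrite -(lquot_reprK x) -(lquot_reprK y).
by rewrite -lquot_piD !lquot_piZ scalerDr lquot_piD.
Qed.

Fact lquot_scaleDl p q (x : lquot p q) :
  {morph (@lquot_scale p q)^~ x : a b / a + b}.
Proof.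
by move=> a b; rewrite -(lquot_reprK x) !lquot_piZ scalerDl lquot_piD.
Qed.

HB.instance Definition _ p q := GRing.Zmodule_isLmodule.Build k (lquot p q)
  (@lquot_scaleA p q) (@lquot_scale1 p q) (@lquot_scaleDr p q)
  (@lquot_scaleDl p q).

(* The map Q(q, p) / rad -> Q(q, r) / rad induced by f : p -> r. *)
Definition lquot_map q p r (f : lhom p r) (x : lquot q p) : lquot q r :=
  lquot_pi (f \ol repr x).

Fact lquot_mapE q p r (f : lhom p r) (g : lhom q p) :
  lquot_map f (lquot_pi g) = lquot_pi (f \ol g).
Proof.
apply/lquot_eqP; rewrite -lcompBr; apply/lrad_compl/lquot_eqP.
exact: lquot_reprK.
Qed.

Fact lquot_map_linear q p r (f : lhom p r) : linear (@lquot_map q p r f).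
Proof.
move=> a x y; rewrite -(lquot_reprK x) -(lquot_reprK y).
rewrite [a *: _]lquot_piZ -lquot_piD !lquot_mapE [a *: _]lquot_piZ -lquot_piD.
by rewrite lcompDr lcompZr.
Qed.

HB.instance Definition _ q p r (f : lhom p r) :=
  GRing.isLinear.Build k (lquot q p) (lquot q r) *:%R (lquot_map f)
    (@lquot_map_linear q p r f).

End LinCatTheory.

Section Conditions.
Variables (k : fieldType) (Q : lincat k).

Definition fin_dim (V : lmodType k) : Prop := exists n, inhabited (Vector.axiom n V).

Definition FinCond : Prop :=
  [/\ forall p q : Q, fin_dim (lhom p q),
      forall q : Q, finite_set
        [set p : Q | ~ ((forall f : lhom p q, f = 0) /\
                        (forall f : lhom q p, f = 0))]
    & exists N : nat, forall (p q : Q) (f : lhom p q), lrad_pow N f -> f = 0].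

Definition left_ideal (q : Q) (I : set (lhom q q)) : Prop :=
  [/\ I 0, forall f g, I f -> I g -> I (f + g)
    & forall h f, I f -> I (h \ol f)].

Definition max_left_ideal (q : Q) (I : set (lhom q q)) : Prop :=
  [/\ left_ideal I, ~ I (lid q)
    & forall J : set (lhom q q),
        left_ideal J -> ~ J (lid q) -> (I `<=` J)%classic -> J = I].

Definition local_end (q : Q) : Prop := exists! I : set (lhom q q), max_left_ideal I.

(* rad_Q(q, q) is the Jacobson radical of the ring Q(q, q); the canonical map *)
(* is always a morphism of k-algebras.                                        *)
Definition RadCond : Prop :=
  (forall q : Q, local_end q /\
     bijective (fun c : k => lquot_pi (c *: lid q : lhom q q))) /\
  (forall p q : Q, p <> q -> forall f : lhom p q, lrad f).

End Conditions.

Section Dual.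
Variables (k : fieldType).

Definition kdual (V : lmodType k) : Type := {linear V -> k^o}.

Section DualLmod.
Variable V : lmodType k.

HB.instance Definition _ := gen_eqMixin (kdual V).
HB.instance Definition _ := gen_choiceMixin (kdual V).

Definition dual0 : kdual V := \0.
Definition dualD (f g : kdual V) : kdual V := f \+ g.
Definition dualN (f : kdual V) : kdual V := \- f.
Definition dualZ (c : k) (f : kdual V) : kdual V := c \*: f.

Fact dualDA : associative dualD.
Proof. by move=> f g h; apply: linear_eq => x /=; rewrite addrA. Qed.
Fact dualDC : commutative dualD.
Proof. by move=> f g; apply: linear_eq => x /=; rewrite addrC. Qed.
Fact dual0D : left_id dual0 dualD.
Proof. by move=> f; apply: linear_eq => x /=; rewrite add0r. Qed.
Fact dualND : left_inverse dual0 dualN dualD.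
Proof. by move=> f; apply: linear_eq => x /=; rewrite addNr. Qed.

HB.instance Definition _ :=
  GRing.isZmodule.Build (kdual V) dualDA dualDC dual0D dualND.

Fact dualZA a b f : dualZ a (dualZ b f) = dualZ (a * b) f.
Proof. by apply: linear_eq => x /=; rewrite scalerA. Qed.
Fact dualZ1 : left_id 1 dualZ.
Proof. by move=> f; apply: linear_eq => x /=; rewrite scale1r. Qed.
Fact dualZDr : right_distributive dualZ +%R.
Proof. by move=> a f g; apply: linear_eq => x /=; rewrite scalerDr. Qed.
Fact dualZDl f : {morph dualZ^~ f : a b / a + b}.
Proof. by move=> a b; apply: linear_eq => x /=; rewrite scalerDl. Qed.

HB.instance Definition _ :=
  GRing.Zmodule_isLmodule.Build k (kdual V) dualZA dualZ1 dualZDr dualZDl.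

End DualLmod.

Definition dual_map (U V : lmodType k) (f : {linear U -> V}) (g : kdual V) :
  kdual U := g \o f.

Fact dual_map_linear (U V : lmodType k) (f : {linear U -> V}) :
  linear (dual_map f).
Proof. by move=> a g h; apply: linear_eq. Qed.

HB.instance Definition _ (U V : lmodType k) (f : {linear U -> V}) :=
  GRing.isLinear.Build k (kdual V) (kdual U) *:%R (dual_map f) (dual_map_linear f).

End Dual.

Record lfunctor (k : fieldType) (P Q : lincat k) := LFunctor {
  lf_ob :> P -> Q;
  lf_map : forall p q : P, {linear lhom p q -> lhom (lf_ob p) (lf_ob q)};
  lf_id : forall p : P, lf_map p p (lid p) = lid (lf_ob p);
  lf_comp : forall (p q r : P) (g : lhom q r) (f : lhom p q),
    lf_map p r (g \ol f) = lf_map q r g \ol lf_map p q f }.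

Arguments lf_map {k P Q} l {p q}.

Section Serre.
Variables (k : fieldType) (Q : lincat k).

Definition quasi_inverse (W V : lfunctor Q Q) : Prop :=
  (exists2 a : forall p : Q, lhom p (V (W p)), forall p, liso (a p) &
     forall (p q : Q) (f : lhom p q),
       lf_map V (lf_map W f) \ol a p = a q \ol f) /\
  (exists2 b : forall p : Q, lhom (W (V p)) p, forall p, liso (b p) &
     forall (p q : Q) (f : lhom p q),
       b q \ol lf_map W (lf_map V f) = f \ol b p).

Definition autoequivalence (W : lfunctor Q Q) : Prop :=
  exists V, quasi_inverse W V.

(* The isomorphisms s p q : Q(p, q) -> D Q(q, W p) are natural in q and in p. *)
Definition serre_functor (W : lfunctor Q Q) : Prop :=
  autoequivalence W /\
  exists s : forall p q : Q, {linear lhom p q -> kdual (lhom q (W p))},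
    [/\ forall p q, bijective (s p q),
        forall (p q q' : Q) (h : lhom q q') (f : lhom p q) (g : lhom q' (W p)),
          s p q' (h \ol f) g = s p q f (g \ol h)
      & forall (p p' q : Q) (h : lhom p' p) (f : lhom p q) (g : lhom q (W p')),
          s p' q (f \ol h) g = s p q f (lf_map W h \ol g)].

Definition SelfInjCond : Prop := exists W, serre_functor W.

End Serre.

(* -------------------------------------------------------------------------- *)

Record qmod (k : fieldType) (Q : lincat k) (R : kalg k) := QMod {
  qm_ob :> Q -> lmodType R;
  qm_map : forall p q : Q, lhom p q -> {linear qm_ob p -> qm_ob q};
  qm_id : forall (p : Q) (x : qm_ob p), qm_map (lid p) x = x;
  qm_comp : forall (p q r : Q) (g : lhom q r) (f : lhom p q) (x : qm_ob p),
    qm_map (g \ol f) x = qm_map g (qm_map f x);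
  qm_add : forall (p q : Q) (f g : lhom p q) (x : qm_ob p),
    qm_map (f + g) x = qm_map f x + qm_map g x;
  qm_scale : forall (p q : Q) (c : k) (f : lhom p q) (x : qm_ob p),
    qm_map (c *: f) x = kalg_map R c *: qm_map f x }.

Record qmor (k : fieldType) (Q : lincat k) (R : kalg k) (X Y : qmod Q R) := QMor {
  qmor_app :> forall p : Q, {linear X p -> Y p};
  qmor_nat : forall (p q : Q) (f : lhom p q) (x : X p),
    qmor_app q (qm_map X f x) = qm_map Y f (qmor_app p x) }.

Section QRMod.
Variables (k : fieldType) (Q : lincat k) (R : kalg k).
Implicit Types X Y Z : qmod Q R.

Lemma qmor_eq X Y (u v : qmor X Y) : (forall p, u p =1 v p) -> u = v.
Proof.
case: u v => [u un] [v vn] /= E.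
have {}E : u = v by apply: functional_extensionality_dep => p; exact: linear_eq (E p).
by subst v; rewrite (Prop_irrelevance un vn).
Qed.

Definition qmor_id X : qmor X X := @QMor k Q R X X (fun p => idfun) (fun _ _ _ _ => erefl).

Definition qmor_zero X Y : qmor X Y :=
  @QMor k Q R X Y (fun p => \0) (fun p q f x => esym (raddf0 (qm_map Y f))).

Fact qmor_comp_nat X Y Z (v : qmor Y Z) (u : qmor X Y) (p q : Q) (f : lhom p q)
  (x : X p) : v q (u q (qm_map X f x)) = qm_map Z f (v p (u p x)).
Proof. by rewrite !qmor_nat. Qed.

Definition qmor_comp X Y Z (v : qmor Y Z) (u : qmor X Y) : qmor X Z :=
  @QMor k Q R X Z (fun p => v p \o u p) (qmor_comp_nat v u).

Fact qmor_compA X Y Z T (w : qmor Z T) (v : qmor Y Z) (u : qmor X Y) :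
  qmor_comp w (qmor_comp v u) = qmor_comp (qmor_comp w v) u.
Proof. exact: qmor_eq. Qed.

Fact qmor_comp1l X Y (u : qmor X Y) : qmor_comp (qmor_id Y) u = u.
Proof. exact: qmor_eq. Qed.

Fact qmor_compl1 X Y (u : qmor X Y) : qmor_comp u (qmor_id X) = u.
Proof. exact: qmor_eq. Qed.

Fact qmor_comp0l X Y Z (u : qmor X Y) :
  qmor_comp (qmor_zero Y Z) u = qmor_zero X Z.
Proof. exact: qmor_eq. Qed.

Fact qmor_compl0 X Y Z (v : qmor Y Z) :
  qmor_comp v (qmor_zero X Y) = qmor_zero X Z.
Proof. by apply: qmor_eq => p x /=; rewrite raddf0. Qed.

Definition QRMod : zcat :=
  ZCat qmor_compA qmor_comp1l qmor_compl1 qmor_comp0l qmor_compl0.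

End QRMod.

Section SimpleObjects.
Variables (k : fieldType) (Q : lincat k) (q : Q).

Fact simple_id (p : Q) (x : lquot q p) : lquot_map (lid p) x = x.
Proof. by rewrite -(lquot_reprK x) lquot_mapE lcomp1l. Qed.

Fact simple_comp (p r s : Q) (g : lhom r s) (f : lhom p r) (x : lquot q p) :
  lquot_map (g \ol f) x = lquot_map g (lquot_map f x).
Proof. by rewrite -(lquot_reprK x) !lquot_mapE lcompA. Qed.

Fact simple_add (p r : Q) (f g : lhom p r) (x : lquot q p) :
  lquot_map (f + g) x = lquot_map f x + lquot_map g x.
Proof. by rewrite -(lquot_reprK x) !lquot_mapE lcompDl lquot_piD. Qed.

Fact simple_scale (p r : Q) (c : k) (f : lhom p r) (x : lquot q p) :
  lquot_map (c *: f) x = c *: lquot_map f x.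
Proof.
by rewrite -(lquot_reprK x) !lquot_mapE lcompZl [RHS]lquot_piZ.
Qed.

(* S<q> = Q(q, -) / rad_Q(q, -). *)
Definition simpleq : qmod Q (kself k) :=
  @QMod k Q (kself k) (fun p => lquot q p) (fun p r f => lquot_map f)
    simple_id simple_comp simple_add simple_scale.

End SimpleObjects.

Section DualFunctor.
Variables (k : fieldType) (Q : lincat k) (S : qmod Q (kself k)).

Let Sob (p : Q) : lmodType k := S p.
Let Smap (p q : Q) (f : lhom p q) : {linear Sob p -> Sob q} := qm_map S f.

Fact dualq_id (p : lop Q) (x : kdual (Sob p)) :
  dual_map (Smap (lid (p : Q))) x = x.
Proof. by apply: linear_eq => y /=; rewrite /Smap qm_id. Qed.

Fact dualq_comp (p q r : lop Q) (g : lhom q r) (f : lhom p q)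
  (x : kdual (Sob p)) :
  dual_map (Smap (lcomp (Q := Q) f g)) x = dual_map (Smap g) (dual_map (Smap f) x).
Proof. by apply: linear_eq => y /=; rewrite /Smap qm_comp. Qed.

Fact dualq_add (p q : lop Q) (f g : lhom p q) (x : kdual (Sob p)) :
  dual_map (Smap (f + g)) x = dual_map (Smap f) x + dual_map (Smap g) x.
Proof. by apply: linear_eq => y /=; rewrite /Smap qm_add raddfD. Qed.

Fact dualq_scale (p q : lop Q) (c : k) (f : lhom p q) (x : kdual (Sob p)) :
  dual_map (Smap (c *: f)) x = c *: dual_map (Smap f) x.
Proof. by apply: linear_eq => y /=; rewrite /Smap qm_scale linearZ. Qed.

Definition dualq : qmod (lop Q) (kself k) :=
  @QMod k (lop Q) (kself k) (fun p => kdual (Sob p)) (fun p q f => dual_map (Smap f))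
    dualq_id dualq_comp dualq_add dualq_scale.

End DualFunctor.

(* -------------------------------------------------------------------------- *)
(* The tensor product N (x)_Q X of a k-linear functor N from Q^op to k-Mod    *)
(* and a k-linear functor X from Q to R-Mod, i.e. the coend of the N(p) (x)_k *)
(* X(p): finite formal sums of pure tensors n (x) x with n in N(p), x in X(p) *)
(* modulo the congruence tens_eqv; R acts through X.                          *)

Section Tensor.
Variables (k : fieldType) (Q : lincat k) (R : kalg k).
Variable N : qmod (lop Q) (kself k).

Section TensorObject.
Variable X : qmod Q R.

Definition tsum : Type := seq {p : Q & (N p * X p)%type}.

Definition ptens (p : Q) (n : N p) (x : X p) : {p : Q & (N p * X p)%type} :=
  existT _ p (n, x).

Inductive tens_eqv : tsum -> tsum -> Prop :=
| TensRefl s : tens_eqv s s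
| TensSym s t : tens_eqv s t -> tens_eqv t s
| TensTrans s t u : tens_eqv s t -> tens_eqv t u -> tens_eqv s u
| TensCat s s' t t' : tens_eqv s s' -> tens_eqv t t' -> tens_eqv (s ++ t) (s' ++ t')
| TensComm s t : tens_eqv (s ++ t) (t ++ s)
| TensZero (p : Q) (n : N p) : tens_eqv [:: ptens n 0] [::]
| TensAddl (p : Q) (n n' : N p) (x : X p) :
    tens_eqv [:: ptens (n + n') x] [:: ptens n x; ptens n' x]
| TensAddr (p : Q) (n : N p) (x x' : X p) :
    tens_eqv [:: ptens n (x + x')] [:: ptens n x; ptens n x']
| TensScale (p : Q) (c : k) (n : N p) (x : X p) :
    tens_eqv [:: ptens (c *: n) x] [:: ptens n (kalg_map R c *: x)]
| TensMap (p q : Q) (f : lhom p q) (n : N q) (x : X p) :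
    tens_eqv [:: ptens (qm_map N (f : @lhom k (lop Q) q p) n) x]
             [:: ptens n (qm_map X f x)].

HB.instance Definition _ := gen_eqMixin tsum.
HB.instance Definition _ := gen_choiceMixin tsum.

Definition tens_eqvb (s t : tsum) : bool := `[< tens_eqv s t >].

Fact tens_eqvb_equiv : equiv_class_of tens_eqvb.
Proof.
split=> [s|s t|t s u].
- by apply/asboolP; exact: TensRefl.
- by apply/asboolP/asboolP; exact: TensSym.
- by move=> /asboolP st /asboolP tu; apply/asboolP; exact: TensTrans st tu.
Qed.

Canonical tens_equiv := EquivRelPack tens_eqvb_equiv.
Canonical tens_encModRel := defaultEncModRel tens_eqvb.

Definition tensor : Type := {eq_quot tens_eqvb}.

HB.instance Definition _ := Choice.on tensor.
HB.instance Definition _ := EqQuotient.on tensor.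

Definition tens_pi (s : tsum) : tensor := \pi s.

Fact tens_eqP s t : tens_pi s = tens_pi t <-> tens_eqv s t.
Proof.
split=> [/eqP|st]; first by rewrite /tens_pi eqmodE => /asboolP.
by apply/eqP; rewrite /tens_pi eqmodE; apply/asboolP.
Qed.

Fact tens_reprK x : tens_pi (repr x) = x.
Proof. exact: reprK. Qed.

Definition tsum_map (g : forall p, X p -> X p) (s : tsum) : tsum :=
  [seq ptens (projT2 t).1 (g _ (projT2 t).2) | t <- s].

Definition tsum_scale (r : R) : tsum -> tsum := tsum_map (fun p x => r *: x).

Fact tsum_scale_eqv r s t : tens_eqv s t -> tens_eqv (tsum_scale r s) (tsum_scale r t).
Proof.
elim=> {s t} /=.
- by move=> s; exact: TensRefl.
- by move=> s t _; exact: TensSym.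
- by move=> s t u _ st _; exact: TensTrans.
- by move=> s s' t t' _ IHs _ IHt; rewrite /tsum_scale /tsum_map !map_cat; exact: TensCat.
- by move=> s t; rewrite /tsum_scale /tsum_map !map_cat; exact: TensComm.
- by move=> p n; rewrite scaler0; exact: TensZero.
- by move=> p n n' x; exact: TensAddl.
- by move=> p n x x'; rewrite scalerDr; exact: TensAddr.
- by move=> p c n x; rewrite scalerA -kalg_central -scalerA; exact: TensScale.
- by move=> p q f n x; rewrite -linearZ; exact: TensMap.
Qed.

Definition tens_zero : tensor := tens_pi [::].
Definition tens_add (x y : tensor) : tensor := tens_pi (repr x ++ repr y).
Definition tens_scale (r : R) (x : tensor) : tensor := tens_pi (tsum_scale r (repr x)).
Definition tens_opp (x : tensor) : tensor := tens_scale (-1) x.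

Fact tens_piD s t : tens_add (tens_pi s) (tens_pi t) = tens_pi (s ++ t).
Proof. by apply/tens_eqP; apply: TensCat; apply/tens_eqP; exact: tens_reprK. Qed.

Fact tens_piZ r s : tens_scale r (tens_pi s) = tens_pi (tsum_scale r s).
Proof. by apply/tens_eqP/tsum_scale_eqv/tens_eqP; exact: tens_reprK. Qed.

Fact tens_ind (P : tensor -> Prop) : (forall s, P (tens_pi s)) -> forall x, P x.
Proof. by move=> IH x; rewrite -(tens_reprK x). Qed.

Fact tens_addA : associative tens_add.
Proof.
elim/tens_ind=> s; elim/tens_ind=> t; elim/tens_ind=> u.
by rewrite !tens_piD catA.
Qed.

Fact tens_addC : commutative tens_add.
Proof.
elim/tens_ind=> s; elim/tens_ind=> t.
by rewrite !tens_piD; apply/tens_eqP; exact: TensComm.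
Qed.

Fact tens_add0 : left_id tens_zero tens_add.
Proof. by elim/tens_ind=> s; rewrite tens_piD. Qed.

Fact tens_pi_cons t s : tens_pi (t :: s) = tens_add (tens_pi [:: t]) (tens_pi s).
Proof. by rewrite tens_piD. Qed.

Fact tens_addACA : interchange tens_add tens_add.
Proof.
move=> x y z t; rewrite -!tens_addA; congr tens_add.
by rewrite !tens_addA [tens_add y z]tens_addC.
Qed.

Fact tens_scaleDl x : {morph tens_scale^~ x : a b / a + b >-> tens_add a b}.
Proof.
move=> a b; elim/tens_ind: x => s; rewrite !tens_piZ.
elim: s => [|[p [n x]] s IHs]; first by rewrite tens_piD.
have E c : tens_pi (tsum_scale c (existT _ p (n, x) :: s)) =
    tens_add (tens_pi [:: ptens n (c *: x)]) (tens_pi (tsum_scale c s)).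
  exact: tens_pi_cons.
rewrite !E IHs tens_addACA; congr tens_add.
by rewrite tens_piD scalerDl; apply/tens_eqP; exact: TensAddr.
Qed.

Fact tens_scale1 : left_id 1 tens_scale.
Proof.
elim/tens_ind=> s; rewrite tens_piZ; congr tens_pi.
by elim: s => [|[p [n x]] s IHs] //=; rewrite scale1r IHs.
Qed.

Fact tens_scale0 x : tens_scale 0 x = tens_zero.
Proof.
elim/tens_ind: x => s; rewrite tens_piZ.
elim: s => [|[p [n x]] s IHs] //.
have -> : tens_pi (tsum_scale 0 (existT _ p (n, x) :: s)) =
    tens_add (tens_pi [:: ptens n (0 *: x)]) (tens_pi (tsum_scale 0 s)).
  exact: tens_pi_cons.
by rewrite IHs tens_addC tens_add0 scale0r; apply/tens_eqP; exact: TensZero.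
Qed.

Fact tens_addN : left_inverse tens_zero tens_opp tens_add.
Proof.
by move=> x; rewrite -[in X in tens_add _ X](tens_scale1 x) -tens_scaleDl addNr tens_scale0.
Qed.

HB.instance Definition _ :=
  GRing.isZmodule.Build tensor tens_addA tens_addC tens_add0 tens_addN.

Fact tens_scaleA a b x : tens_scale a (tens_scale b x) = tens_scale (a * b) x.
Proof.
elim/tens_ind: x => s; rewrite !tens_piZ; congr tens_pi.
by elim: s => [|[p [n x]] s IHs] //=; rewrite scalerA IHs.
Qed.

Fact tens_scaleDr : right_distributive tens_scale +%R.
Proof.
move=> a; elim/tens_ind=> s; elim/tens_ind=> t.
rewrite -[_ + _]/(tens_add _ _) -[RHS]/(tens_add _ _) tens_piD !tens_piZ tens_piD.
by rewrite /tsum_scale /tsum_map map_cat.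
Qed.

HB.instance Definition _ := GRing.Zmodule_isLmodule.Build R tensor
  tens_scaleA tens_scale1 tens_scaleDr tens_scaleDl.

End TensorObject.

Section TensorMap.
Variables (X Y : qmod Q R) (u : qmor X Y).

Definition tsum_mor (s : tsum X) : tsum Y :=
  [seq ptens (projT2 t).1 (u _ (projT2 t).2) | t <- s].

Fact tsum_mor_eqv s t : tens_eqv s t -> tens_eqv (tsum_mor s) (tsum_mor t).
Proof.
elim=> {s t} /=.
- by move=> s; exact: TensRefl.
- by move=> s t _; exact: TensSym.
- by move=> s t v _ st _; exact: TensTrans.
- by move=> s s' t t' _ IHs _ IHt; rewrite /tsum_mor !map_cat; exact: TensCat.
- by move=> s t; rewrite /tsum_mor !map_cat; exact: TensComm.
- by move=> p n; rewrite raddf0; exact: TensZero.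
- by move=> p n n' x; exact: TensAddl.
- by move=> p n x x'; rewrite raddfD; exact: TensAddr.
- by move=> p c n x; rewrite linearZ; exact: TensScale.
- by move=> p q f n x; rewrite qmor_nat; exact: TensMap.
Qed.

Definition tens_map (x : tensor X) : tensor Y := tens_pi (tsum_mor (repr x)).

Fact tens_mapE s : tens_map (tens_pi s) = tens_pi (tsum_mor s).
Proof. by apply/tens_eqP/tsum_mor_eqv/tens_eqP; exact: tens_reprK. Qed.

Fact tens_map_linear : linear tens_map.
Proof.
move=> a; elim/tens_ind=> s; elim/tens_ind=> t.
rewrite -[a *: _]/(tens_scale _ _) -[_ + _]/(tens_add _ _) -[RHS]/(tens_add _ _).
rewrite tens_piZ tens_piD !tens_mapE [X in tens_add X]tens_piZ tens_piD.
congr tens_pi; rewrite /tsum_mor map_cat; congr (_ ++ _).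
by elim: s => [|[p [n x]] s IHs] //=; rewrite linearZ IHs.
Qed.

HB.instance Definition _ :=
  GRing.isLinear.Build R (tensor X) (tensor Y) *:%R tens_map tens_map_linear.

End TensorMap.

Fact tensor_id (X : QRMod Q R) :
  tens_map (idc X) = idfun :> {linear tensor X -> tensor X}.
Proof.
apply: linear_eq; elim/tens_ind=> s /=; rewrite tens_mapE; congr tens_pi.
by elim: s => [|[p [n x]] s IHs] //=; rewrite IHs.
Qed.

Fact tensor_comp (X Y Z : QRMod Q R) (v : hom Y Z) (u : hom X Y) :
  tens_map (v \oc u) = tens_map v \o tens_map u
    :> {linear tensor X -> tensor Z}.
Proof.
apply: linear_eq; elim/tens_ind=> s /=; rewrite !tens_mapE; congr tens_pi.
by elim: s => [|[p [n x]] s IHs] //=; rewrite IHs.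
Qed.

Fact tensor_zero (X Y : QRMod Q R) :
  tens_map (zeroc X Y) = \0 :> {linear tensor X -> tensor Y}.
Proof.
apply: linear_eq; elim/tens_ind=> s /=; rewrite tens_mapE.
elim: s => [|[p [n x]] s IHs] //.
have -> : tens_pi (tsum_mor (zeroc X Y) (existT _ p (n, x) :: s)) =
    tens_add (tens_pi [:: ptens n 0]) (tens_pi (tsum_mor (zeroc X Y) s)).
  exact: tens_pi_cons.
by rewrite IHs tens_addC tens_add0; apply/tens_eqP; exact: TensZero.
Qed.

Definition tensor_functor : zfunctor (QRMod Q R) (RMod R) :=
  @ZFunctor (QRMod Q R) (RMod R) (fun X => tensor X : lmodType R)
    (fun X Y u => tens_map u) tensor_id tensor_comp tensor_zero.

End Tensor.

(* Hom_Q(S, X): k-linear natural transformations S -> X, with R acting on the *)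
(* values.                                                                    *)
Section HomQ.
Variables (k : fieldType) (Q : lincat k) (R : kalg k) (S : qmod Q (kself k)).

Let Sob (p : Q) : lmodType k := S p.

Record homq (X : qmod Q R) := HomQ {
  homq_app :> forall p : Q, {linear Sob p -> X p | kscale R};
  homq_nat : forall (p q : Q) (f : lhom p q) (x : Sob p),
    homq_app q (qm_map S f x) = qm_map X f (homq_app p x) }.

Lemma homq_eq X (u v : homq X) : (forall p, u p =1 v p) -> u = v.
Proof.
case: u v => [u un] [v vn] /= E.
have {}E : u = v by apply: functional_extensionality_dep => p; exact: linear_eq (E p).
by subst v; rewrite (Prop_irrelevance un vn).
Qed.

Section HomQObject.
Variable X : qmod Q R.

HB.instance Definition _ := gen_eqMixin (homq X).
HB.instance Definition _ := gen_choiceMixin (homq X).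

Fact homq_zero_nat (p q : Q) (f : lhom p q) (x : Sob p) : 0 = qm_map X f 0.
Proof. by rewrite raddf0. Qed.

Definition homq_zero : homq X := @HomQ X (fun p => \0) homq_zero_nat.

Fact homq_add_nat (u v : homq X) (p q : Q) (f : lhom p q) (x : Sob p) :
  u q (qm_map S f x) + v q (qm_map S f x) = qm_map X f (u p x + v p x).
Proof. by rewrite !homq_nat raddfD. Qed.

Definition homq_add (u v : homq X) : homq X :=
  @HomQ X (fun p => u p \+ v p) (homq_add_nat u v).

Fact homq_opp_nat (u : homq X) (p q : Q) (f : lhom p q) (x : Sob p) :
  - u q (qm_map S f x) = qm_map X f (- u p x).
Proof. by rewrite homq_nat raddfN. Qed.

Definition homq_opp (u : homq X) : homq X :=
  @HomQ X (fun p => \- u p) (homq_opp_nat u).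

Definition homq_scale_fun (r : R) (u : homq X) (p : Q) (x : Sob p) : X p := r *: u p x.

Fact homq_scale_linear r u p : linear_for (kscale R) (@homq_scale_fun r u p).
Proof.
move=> c x y; rewrite /homq_scale_fun linearP /= scalerDr !scalerA.
by rewrite kalg_central.
Qed.

HB.instance Definition _ r u p :=
  GRing.isLinear.Build k (Sob p) (X p) (kscale R) (@homq_scale_fun r u p)
    (@homq_scale_linear r u p).

Fact homq_scale_nat r (u : homq X) (p q : Q) (f : lhom p q) (x : Sob p) :
  homq_scale_fun r u (qm_map S f x) = qm_map X f (homq_scale_fun r u x).
Proof. by rewrite /homq_scale_fun homq_nat linearZ. Qed.

Definition homq_scale r (u : homq X) : homq X :=
  @HomQ X (fun p => @homq_scale_fun r u p) (homq_scale_nat r u).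

Fact homq_addA : associative homq_add.
Proof. by move=> u v w; apply: homq_eq => p x /=; rewrite addrA. Qed.
Fact homq_addC : commutative homq_add.
Proof. by move=> u v; apply: homq_eq => p x /=; rewrite addrC. Qed.
Fact homq_add0 : left_id homq_zero homq_add.
Proof. by move=> u; apply: homq_eq => p x /=; rewrite add0r. Qed.
Fact homq_addN : left_inverse homq_zero homq_opp homq_add.
Proof. by move=> u; apply: homq_eq => p x /=; rewrite addNr. Qed.

HB.instance Definition _ :=
  GRing.isZmodule.Build (homq X) homq_addA homq_addC homq_add0 homq_addN.

Fact homq_scaleA a b u : homq_scale a (homq_scale b u) = homq_scale (a * b) u.
Proof. by apply: homq_eq => p x; rewrite /= /homq_scale_fun /= scalerA. Qed.
Fact homq_scale1 : left_id 1 homq_scale.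
Proof. by move=> u; apply: homq_eq => p x; rewrite /= /homq_scale_fun scale1r. Qed.
Fact homq_scaleDr : right_distributive homq_scale +%R.
Proof.
by move=> a u v; apply: homq_eq => p x; rewrite /= /homq_scale_fun /= scalerDr.
Qed.
Fact homq_scaleDl u : {morph homq_scale^~ u : a b / a + b}.
Proof. by move=> a b; apply: homq_eq => p x; rewrite /= /homq_scale_fun scalerDl. Qed.

HB.instance Definition _ := GRing.Zmodule_isLmodule.Build R (homq X)
  homq_scaleA homq_scale1 homq_scaleDr homq_scaleDl.

End HomQObject.

Section HomQMap.
Variables (X Y : qmod Q R) (v : qmor X Y).

Definition homq_map_fun (u : homq X) (p : Q) (x : Sob p) : Y p := v p (u p x).

Fact homq_map_fun_linear u p : linear_for (kscale R) (@homq_map_fun u p).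
Proof. by move=> c x y; rewrite /homq_map_fun linearP /= [LHS]linearP. Qed.

HB.instance Definition _ u p :=
  GRing.isLinear.Build k (Sob p) (Y p) (kscale R) (@homq_map_fun u p)
    (@homq_map_fun_linear u p).

Fact homq_map_nat (u : homq X) (p q : Q) (f : lhom p q) (x : Sob p) :
  homq_map_fun u (qm_map S f x) = qm_map Y f (homq_map_fun u x).
Proof. by rewrite /homq_map_fun homq_nat qmor_nat. Qed.

Definition homq_map (u : homq X) : homq Y :=
  @HomQ Y (fun p => @homq_map_fun u p) (homq_map_nat u).

Fact homq_map_linear : linear homq_map.
Proof.
by move=> a u w; apply: homq_eq => p x; rewrite /= /homq_map_fun /= linearP.
Qed.

HB.instance Definition _ :=
  GRing.isLinear.Build R (homq X) (homq Y) *:%R homq_map homq_map_linear.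

End HomQMap.

Fact homq_functor_id (X : QRMod Q R) :
  homq_map (idc X) = idfun :> {linear homq X -> homq X}.
Proof. by apply: linear_eq => u; apply: homq_eq. Qed.

Fact homq_functor_comp (X Y Z : QRMod Q R) (w : hom Y Z) (v : hom X Y) :
  homq_map (w \oc v) = homq_map w \o homq_map v :> {linear homq X -> homq Z}.
Proof. by apply: linear_eq => u; apply: homq_eq. Qed.

Fact homq_functor_zero (X Y : QRMod Q R) :
  homq_map (zeroc X Y) = \0 :> {linear homq X -> homq Y}.
Proof. by apply: linear_eq => u; apply: homq_eq. Qed.

Definition homq_functor : zfunctor (QRMod Q R) (RMod R) :=
  @ZFunctor (QRMod Q R) (RMod R) (fun X => homq X : lmodType R)
    (fun X Y v => homq_map v) homq_functor_id homq_functor_comp homq_functor_zero.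

End HomQ.

Section PhiPsi.
Variables (k : fieldType) (Q : lincat k) (R : kalg k).

Definition Cq (q : Q) : zfunctor (QRMod Q R) (RMod R) :=
  tensor_functor R (dualq (simpleq q)).

Definition Kq (q : Q) : zfunctor (QRMod Q R) (RMod R) :=
  homq_functor R (simpleq q).

Definition Phi (A : obclass (RMod R)) : obclass (QRMod Q R) :=
  fun X => forall q : Q, A (Cq q X) /\ L1_zero (Cq q) X.

Definition Psi (B : obclass (RMod R)) : obclass (QRMod Q R) :=
  fun X => forall q : Q, B (Kq q X) /\ R1_zero (Kq q) X.

End PhiPsi.

Arguments Cq {k Q} R q.
Arguments Kq {k Q} R q.
Arguments Phi {k} Q {R} A.
Arguments Psi {k} Q {R} B.

(* Main.v *)
From Pilot Require Import Defs.
From HB Require Import structures.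
From mathcomp Require Import all_boot all_order all_algebra.
From mathcomp Require Import boolp classical_sets cardinality.
Import Pilot.Defs.

Set Implicit Arguments.
Unset Strict Implicit.
Unset Printing Implicit Defensive.

Import GRing.Theory.
Local Open Scope ring_scope.
Local Open Scope quotient_scope.
Local Open Scope cat_scope.

(* The adjunctions C_q -| S_q -| K_q identify Phi(A) with the left Ext^1-      *)
(* orthogonal of all S_q(B), B in the class B, and Psi(B) with the right       *)
(* orthogonal of all S_q(A). The radical of Q is nilpotent, so for a finite    *)
(* dimensional right Q-module V the functor Hom_k(V, M) is an iterated         *)
(* extension of functors killed by the radical, and those are products of      *)
(* S_q's; hence Phi(A) is orthogonal to all Hom_k(V, B) and all Hom_k(V, A)    *)
(* are orthogonal to Psi(B). Heredity follows by dimension shifting along      *)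
(* 0 -> S_q B -> G_q B -> Hom_k(rad(-, q), B) -> 0, where G_q is right adjoint *)
(* to the evaluation at q, and dually with its left adjoint F_q.               *)
(* An X in Phi(A) is filtered by rad^i X, whose layers are killed by the       *)
(* radical and have their values in A; this gives Ext^1(Phi(A), Psi(B)) = 0.   *)
(* By Serre duality F_p is also right adjoint to the evaluation at W p. So     *)
(* X in Phi(A) embeds into the locally finite product T of the F_p(X(W p)).    *)
(* Maps X -> S_q B lift along F_q B -> S_q B and so extend to T; thus T / X is *)
(* in Phi(A). If X is moreover in the right orthogonal of Phi(A), then X is a  *)
(* direct summand of T, which lies in Psi(B). The converse is dual.            *)

(** * Abelian categories and Ext^1-orthogonality *)

Record abelian (C : zcat) := Abelian {
  addc : forall X Y : C, hom X Y -> hom X Y -> hom X Y;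
  oppc : forall X Y : C, hom X Y -> hom X Y;
  addcA : forall X Y : C, associative (@addc X Y);
  addcC : forall X Y : C, commutative (@addc X Y);
  add0c : forall X Y : C, left_id (zeroc X Y) (@addc X Y);
  addNc : forall X Y : C, left_inverse (zeroc X Y) (@oppc X Y) (@addc X Y);
  compcDl : forall (X Y Z : C) (g g' : hom Y Z) (f : hom X Y),
    addc g g' \oc f = addc (g \oc f) (g' \oc f);
  compcDr : forall (X Y Z : C) (g : hom Y Z) (f f' : hom X Y),
    g \oc addc f f' = addc (g \oc f) (g \oc f');
  kernel_ex : forall (X Y : C) (f : hom X Y),
    exists (K : C) (i : hom K X), is_kernel i f;
  cokernel_ex : forall (X Y : C) (f : hom X Y),
    exists (L : C) (p : hom Y L), is_cokernel p f;
  mono_kernel : forall (X Y L : C) (i : hom X Y) (p : hom Y L),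
    is_mono i -> is_cokernel p i -> is_kernel i p;
  epi_cokernel : forall (K X Y : C) (i : hom K X) (p : hom X Y),
    is_epi p -> is_kernel i p -> is_cokernel p i;
  biproduct_ex : forall X Y : C,
    exists (Z : C) (i1 : hom X Z) (i2 : hom Y Z) (p1 : hom Z X) (p2 : hom Z Y),
      [/\ p1 \oc i1 = idc X, p2 \oc i2 = idc Y, p1 \oc i2 = zeroc Y X,
          p2 \oc i1 = zeroc X Y & addc (i1 \oc p1) (i2 \oc p2) = idc Z];
  enough_proj : forall X : C,
    exists (P : C) (p : hom P X), is_projective P /\ is_epi p;
  enough_inj : forall X : C,
    exists (J : C) (i : hom X J), is_injective J /\ is_mono i }.

Section Opposite.
Variable C : zcat.

Definition opcat : zcat :=
  @ZCat C (fun X Y => hom Y X) (fun X => idc X) (fun X Y Z g f => f \oc g)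
    (fun X Y => zeroc Y X) (fun X Y Z T h g f => esym (compcA f g h))
    (fun X Y f => compc1 f) (fun X Y f => comp1c f)
    (fun X Y Z f => compc0 Z f) (fun X Y Z g => comp0c X g).

Variable aC : abelian C.

Definition op_abelian : abelian opcat.
Proof.
refine (@Abelian opcat (fun X Y => @addc _ aC Y X) (fun X Y => @oppc _ aC Y X)
  _ _ _ _ _ _ _ _ _ _ _ _ _).
- by move=> X Y; exact: (addcA aC).
- by move=> X Y; exact: (addcC aC).
- by move=> X Y; exact: (add0c aC).
- by move=> X Y; exact: (addNc aC).
- by move=> X Y Z g g' f; exact: (compcDr aC).
- by move=> X Y Z g f f'; exact: (compcDl aC).
- by move=> X Y f; have [L [p pf]] := cokernel_ex aC f; exists L, p.
- by move=> X Y f; have [L [p pf]] := kernel_ex aC f; exists L, p.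
- by move=> X Y L i p im pi; apply: (epi_cokernel aC im pi).
- by move=> X Y L i p im pi; exact: (mono_kernel aC im pi).
- move=> X Y; have [Z [i1 [i2 [p1 [p2 [h1 h2 h3 h4 h5]]]]]] := biproduct_ex aC X Y.
  by exists Z, p1, p2, i1, i2; split.
- move=> X; have [J [i [iJ mi]]] := enough_inj aC X; exists J, i.
  by split=> // Y Z e f; exact: iJ.
- move=> X; have [J [i [iJ mi]]] := enough_proj aC X; exists J, i.
  by split=> // Y Z e f; exact: iJ.
Defined.

End Opposite.

Lemma op_ses (C : zcat) (X Y Z : C) (i : hom X Y) (p : hom Y Z) :
  short_exact i p -> @short_exact (opcat C) Z Y X p i.
Proof. by case. Qed.

Section Basics.
Variables (C : zcat) (aC : abelian C).
Implicit Types X Y Z K L P T : C.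
Local Notation "f \+c g" := (addc aC f g) (at level 50, left associativity).
Definition subc X Y (f g : hom X Y) : hom X Y := f \+c oppc aC g.

Lemma addc0 X Y (f : hom X Y) : f \+c zeroc X Y = f.
Proof. by rewrite addcC add0c. Qed.

Lemma subcc X Y (f : hom X Y) : subc f f = zeroc X Y.
Proof. by rewrite /subc addcC addNc. Qed.

Lemma subcK X Y (f g : hom X Y) : subc f g \+c g = f.
Proof. by rewrite /subc -addcA addNc addc0. Qed.

Lemma subc_addK X Y (f g h : hom X Y) : f = g \+c h -> subc f g = h.
Proof. by move=> ->; rewrite /subc [g \+c h]addcC -addcA [g \+c _]addcC addNc addc0. Qed.

Lemma subc_eq0 X Y (f g : hom X Y) : subc f g = zeroc X Y -> f = g.
Proof. by move=> fg; rewrite -(subcK f g) fg add0c. Qed.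

Lemma subc0 X Y (f : hom X Y) : subc f (zeroc X Y) = f.
Proof. by apply: subc_addK; rewrite add0c. Qed.

Lemma compcBl X Y Z (g g' : hom Y Z) (f : hom X Y) :
  subc g g' \oc f = subc (g \oc f) (g' \oc f).
Proof. by symmetry; apply: subc_addK; rewrite -compcDl addcC subcK. Qed.

Lemma compcBr X Y Z (g : hom Y Z) (f f' : hom X Y) :
  g \oc subc f f' = subc (g \oc f) (g \oc f').
Proof. by symmetry; apply: subc_addK; rewrite -compcDr addcC subcK. Qed.

Lemma ker_lift K X Y (i : hom K X) (f : hom X Y) T (t : hom T X) :
  is_kernel i f -> f \oc t = zeroc T Y -> exists u : hom T K, i \oc u = t.
Proof. by move=> [_ /(_ T t) ki] /ki[u [iu _]]; exists u. Qed.

Lemma coker_desc X Y L (p : hom Y L) (f : hom X Y) T (t : hom Y T) :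
  is_cokernel p f -> t \oc f = zeroc X T -> exists u : hom L T, u \oc p = t.
Proof. by move=> [_ /(_ T t) ki] /ki[u [iu _]]; exists u. Qed.

Lemma ker_mono K X Y (i : hom K X) (f : hom X Y) : is_kernel i f -> is_mono i.
Proof.
move=> [fi ki] T u v uv; have [|w [_ wP]] := ki T (i \oc u).
  by rewrite compcA fi comp0c.
by rewrite -(wP u) // (wP v).
Qed.

Lemma coker_epi X Y L (p : hom Y L) (f : hom X Y) : is_cokernel p f -> is_epi p.
Proof.
move=> [fi ki] T u v uv; have [|w [_ wP]] := ki T (u \oc p).
  by rewrite -compcA fi compc0.
by rewrite -(wP u) // (wP v).
Qed.

Lemma mono_eq0 X Y (i : hom X Y) T (t : hom T X) :
  is_mono i -> i \oc t = zeroc T Y -> t = zeroc T X.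
Proof. by move=> im it; apply: im; rewrite it compc0. Qed.

Lemma epi_eq0 X Y (p : hom X Y) T (t : hom Y T) :
  is_epi p -> t \oc p = zeroc X T -> t = zeroc Y T.
Proof. by move=> ep tp; apply: ep; rewrite tp comp0c. Qed.

Lemma monoI X Y (i : hom X Y) :
  (forall T (t : hom T X), i \oc t = zeroc T Y -> t = zeroc T X) -> is_mono i.
Proof. by move=> h T u v uv; apply/subc_eq0/h; rewrite compcBr uv subcc. Qed.

Lemma epiI X Y (i : hom X Y) :
  (forall T (t : hom Y T), t \oc i = zeroc X T -> t = zeroc Y T) -> is_epi i.
Proof. by move=> h T u v uv; apply/subc_eq0/h; rewrite compcBl uv subcc. Qed.

Lemma ses_mono X Y Z (i : hom X Y) (p : hom Y Z) : short_exact i p -> is_mono i.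
Proof. by move=> [/ker_mono]. Qed.

Lemma ses_epi X Y Z (i : hom X Y) (p : hom Y Z) : short_exact i p -> is_epi p.
Proof. by move=> [_ /coker_epi]. Qed.

Lemma ses0 X Y Z (i : hom X Y) (p : hom Y Z) : short_exact i p -> p \oc i = zeroc X Z.
Proof. by move=> [[]]. Qed.

Lemma mono_ses X Y (i : hom X Y) :
  is_mono i -> exists Z (p : hom Y Z), short_exact i p.
Proof.
move=> im; have [Z [p pc]] := cokernel_ex aC i; exists Z, p; split=> //.
exact (mono_kernel aC im pc).
Qed.

Lemma epi_ses Y Z (p : hom Y Z) :
  is_epi p -> exists X (i : hom X Y), short_exact i p.
Proof.
move=> im; have [X [i pc]] := kernel_ex aC p; exists X, i; split=> //.
exact (epi_cokernel aC im pc).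
Qed.

Lemma epi_kernel_ses X Y Z (i : hom X Y) (p : hom Y Z) :
  is_epi p -> is_kernel i p -> short_exact i p.
Proof. by move=> ep ki; split=> //; exact (epi_cokernel aC ep ki). Qed.

Lemma mono_cokernel_ses X Y Z (i : hom X Y) (p : hom Y Z) :
  is_mono i -> is_cokernel p i -> short_exact i p.
Proof. by move=> ep ki; split=> //; exact (mono_kernel aC ep ki). Qed.

Lemma ses_retr_sect X Y Z (i : hom X Y) (p : hom Y Z) (r : hom Y X) :
  short_exact i p -> r \oc i = idc X ->
  exists s : hom Z Y, [/\ p \oc s = idc Z, r \oc s = zeroc Z X
    & (i \oc r) \+c (s \oc p) = idc Y].
Proof.
move=> [[pi _] cp] ri; have [|s sp] := coker_desc (t := subc (idc Y) (i \oc r)) cp.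
  by rewrite compcBl comp1c -compcA ri compc1 subcc.
have rs : r \oc s = zeroc Z X.
  apply: (coker_epi cp); rewrite -compcA sp compcBr compc1 compcA ri comp1c subcc.
  by rewrite comp0c.
exists s; split=> //.
  apply: (coker_epi cp); rewrite -compcA sp compcBr compc1 compcA pi comp0c subc0.
  by rewrite comp1c.
by rewrite sp addcC subcK.
Qed.

Lemma retr_ses_iso X Z Y Y' (i : hom X Y) (p : hom Y Z) (r : hom Y X)
    (i' : hom X Y') (p' : hom Y' Z) (r' : hom Y' X) :
  short_exact i p -> short_exact i' p' -> r \oc i = idc X -> r' \oc i' = idc X ->
  exists2 u : hom Y Y', is_iso u & u \oc i = i' /\ p' \oc u = p.
Proof.
move=> S S' ri ri'; have [s [ps rs dec]] := ses_retr_sect S ri.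
have [s' [ps' rs' dec']] := ses_retr_sect S' ri'.
exists ((i' \oc r) \+c (s' \oc p)).
  exists ((i \oc r') \+c (s \oc p')); split.
    rewrite compcDl !compcDr -!compcA !(compcA r') !(compcA p') ri' rs' (ses0 S') ps'.
    by rewrite !(comp0c, compc0, comp1c) addc0 add0c.
  rewrite compcDl !compcDr -!compcA !(compcA r) !(compcA p) ri rs (ses0 S) ps.
  by rewrite !(comp0c, compc0, comp1c) addc0 add0c.
split.
  by rewrite compcDl -!compcA ri (ses0 S) compc0 compc1 addc0.
by rewrite compcDr !compcA (ses0 S') ps' comp0c comp1c add0c.
Qed.

Lemma split_ses_ex X Y :
  exists E (i : hom Y E) (p : hom E X) (r : hom E Y),
    short_exact i p /\ r \oc i = idc Y.
Proof.
have [Z [i1 [i2 [p1 [p2 [h1 h2 h3 h4 h5]]]]]] := biproduct_ex aC Y X.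
exists Z, i1, p2, p1; split=> //; split; split=> // T t tz.
  exists (p1 \oc t); split.
    by rewrite compcA -[RHS]comp1c -h5 compcDl -(compcA i2) tz compc0 addc0.
  by move=> u <-; rewrite compcA h1 comp1c.
exists (t \oc i2); split.
  by rewrite -[RHS]compc1 -h5 compcDr !compcA tz comp0c add0c.
by move=> u <-; rewrite -compcA h2 compc1.
Qed.

Lemma Ext1_zero_retrP X Y :
  Ext1_zero X Y <-> forall E (i : hom Y E) (p : hom E X), short_exact i p ->
    exists r : hom E Y, r \oc i = idc Y.
Proof.
split=> [XY E i p S|h [E i p S] [E' i' p' S']].
  have [E' [i' [p' [r [S' ri]]]]] := split_ses_ex X Y.
  have [u _ [/= ui pu]] := XY (Extension S) (Extension S').
  by exists (r \oc u); rewrite -compcA ui.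
have [r ri] := h _ _ _ S; have [r' ri'] := h _ _ _ S'.
exact: retr_ses_iso S S' ri ri'.
Qed.

End Basics.

Section Duality.
Variables (C : zcat) (aC : abelian C).
Implicit Types X Y Z K L P T : C.

Lemma Ext1_zero_sectP X Y :
  Ext1_zero X Y <-> forall E (i : hom Y E) (p : hom E X), short_exact i p ->
    exists s : hom X E, p \oc s = idc X.
Proof.
rewrite (Ext1_zero_retrP aC); split=> h E i p S; have [r ri] := h _ _ _ S.
  by have [s []] := ses_retr_sect aC S ri; exists s.
have [s [? _ _]] := ses_retr_sect (op_abelian aC) (op_ses S) ri.
by exists s.
Qed.

Lemma Ext1_zero_op X Y : @Ext1_zero (opcat C) Y X <-> Ext1_zero X Y.
Proof.
rewrite (Ext1_zero_retrP (op_abelian aC)) Ext1_zero_sectP.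
split=> h E i p S.
  exact: (h E p i (op_ses S)).
exact: (h E p i (op_ses S)).
Qed.

End Duality.

Lemma dep_choice (I : Type) (T : I -> Type) (P : forall i, T i -> Prop) :
  (forall i, exists x, P i x) -> exists f : forall i, T i, forall i, P i (f i).
Proof. by move=> h; exists (fun i => projT1 (cid (h i))) => i; case: cid. Qed.

Section Pushout.
Variables (C : zcat) (aC : abelian C).

Lemma ses_pushout (K P X Y : C) (i : hom K P) (p : hom P X) (f : hom K Y) :
  short_exact i p -> exists (E : C) (j : hom Y E) (q : hom E X) (g : hom P E),
    [/\ short_exact j q, g \oc i = j \oc f & q \oc g = p].
Proof.
move=> S; have im := ses_mono S.
have [Z [i1 [i2 [p1 [p2 [h1 h2 h3 h4 h5]]]]]] := biproduct_ex aC Y P.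
pose m := subc aC (i2 \oc i) (i1 \oc f).
have p2m : p2 \oc m = i.
  by rewrite compcBr !compcA h2 h4 comp0c comp1c subc0.
have mm : is_mono m.
  by move=> T u v uv; apply: im; rewrite -p2m -!compcA uv.
have [E [c S']] := mono_ses aC mm.
have [|q qc] := coker_desc (t := p \oc p2) (proj2 S').
  by rewrite -compcA p2m (ses0 S).
exists E, (c \oc i1), q, (c \oc i2).
have gi : c \oc i2 \oc i = c \oc i1 \oc f.
  by apply: (@subc_eq0 _ aC); rewrite -!compcA -compcBr (ses0 S').
have qg : q \oc (c \oc i2) = p by rewrite compcA qc -compcA h2 compc1.
have qj : q \oc (c \oc i1) = zeroc Y X by rewrite compcA qc -compcA h4 compc0.
have qe : is_epi q.
  by move=> T u v uv; apply: (ses_epi S); rewrite -qg !compcA uv.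
split=> //; apply: (mono_cokernel_ses aC).
  apply: (monoI aC) => T t; rewrite -compcA => /(ker_lift (proj1 S')) [u mu].
  have u0 : u = zeroc T K.
    apply: (mono_eq0 im).
    by rewrite -p2m -compcA mu compcA h4 comp0c.
  by rewrite -(comp1c t) -h1 -compcA -mu u0 !compc0.
split=> // T t tj.
have tj' : t \oc c \oc i1 = zeroc Y T by rewrite -compcA.
have [|w wp] := coker_desc (t := t \oc (c \oc i2)) (proj2 S).
  by rewrite -compcA gi compcA tj comp0c.
have wq : w \oc q = t.
  apply: (ses_epi S'); rewrite -compcA qc compcA wp.
  by rewrite -[RHS]compc1 -h5 compcDr !compcA tj' comp0c add0c.
by exists w; split=> // w' w'q; apply: qe; rewrite w'q.
Qed.

Lemma Ext1_zero_extend (K P X Y : C) (i : hom K P) (p : hom P X) (f : hom K Y) :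
  Ext1_zero X Y -> short_exact i p -> exists g : hom P Y, g \oc i = f.
Proof.
move=> /(Ext1_zero_retrP aC) XY S; have [E [j [q [g [S' gi _]]]]] := ses_pushout f S.
have [r rj] := XY _ _ _ S'.
by exists (r \oc g); rewrite -compcA gi compcA rj comp1c.
Qed.

End Pushout.

Section Orthogonality.
Variables (C : zcat) (aC : abelian C).
Implicit Types X Y Z K L P T : C.

Lemma ses_pullback Y E Z X (j : hom Y E) (q : hom E Z) (f : hom X Z) :
  short_exact j q -> exists P (i : hom Y P) (p : hom P X) (g : hom P E),
    [/\ short_exact i p, q \oc g = f \oc p & g \oc i = j].
Proof.
move=> /op_ses S; have [P [p [i [g [S' h1 h2]]]]] := ses_pushout (op_abelian aC) f S.
by exists P, i, p, g; split=> //; exact: (op_ses S').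
Qed.

Lemma Ext1_zero_lift Y E Z X (j : hom Y E) (q : hom E Z) (f : hom X Z) :
  Ext1_zero X Y -> short_exact j q -> exists g : hom X E, q \oc g = f.
Proof.
move=> /(Ext1_zero_op aC) XY /op_ses S.
by have [g gi] := Ext1_zero_extend (op_abelian aC) f XY S; exists g.
Qed.

Lemma Ext1_zeroI_extend K P X Y (i : hom K P) (p : hom P X) :
  short_exact i p -> Ext1_zero P Y ->
  (forall f : hom K Y, exists g : hom P Y, g \oc i = f) -> Ext1_zero X Y.
Proof.
move=> S PY ext; apply/(Ext1_zero_sectP aC) => E j q S'.
have [g qg] := Ext1_zero_lift p PY S'.
have [|f jf] := ker_lift (t := g \oc i) (proj1 S').
  by rewrite compcA qg (ses0 S).
have [h hi] := ext f.
have [|s sp] := coker_desc (t := subc aC g (j \oc h)) (proj2 S).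
  by rewrite compcBl -jf -compcA hi subcc.
exists s; apply: (ses_epi S); rewrite -compcA sp compcBr qg compcA (ses0 S').
by rewrite comp0c subc0 comp1c.
Qed.

End Orthogonality.

Section Orthogonality2.
Variables (C : zcat) (aC : abelian C).
Implicit Types X Y Z K L P T : C.

Lemma Ext1_zeroI_lift Y E Z X (j : hom Y E) (q : hom E Z) :
  short_exact j q -> Ext1_zero X E ->
  (forall f : hom X Z, exists g : hom X E, q \oc g = f) -> Ext1_zero X Y.
Proof.
move=> S /(Ext1_zero_op aC) XE lif; apply/(Ext1_zero_op aC).
exact: (Ext1_zeroI_extend (op_abelian aC) (op_ses S) XE).
Qed.

Lemma proj_Ext1_zero P Y : is_projective P -> Ext1_zero P Y.
Proof.
move=> pP; apply/(Ext1_zero_sectP aC) => E i p S.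
exact: pP (ses_epi S).
Qed.

Lemma inj_Ext1_zero X J : is_injective J -> Ext1_zero X J.
Proof.
move=> pP; apply/(Ext1_zero_retrP aC) => E i p S.
exact: pP (ses_mono S).
Qed.

Lemma Ext1_zero_ext_r X Y E Z (j : hom Y E) (q : hom E Z) :
  short_exact j q -> Ext1_zero X Y -> Ext1_zero X Z -> Ext1_zero X E.
Proof.
move=> S XY XZ; have [P [p [pP ep]]] := enough_proj aC X.
have [K [i S']] := epi_ses aC ep.
apply: (Ext1_zeroI_extend aC S'); first exact: proj_Ext1_zero.
move=> f; have [a ai] := Ext1_zero_extend aC (q \oc f) XZ S'.
have [b qb] := pP _ _ _ a (ses_epi S).
have [|c jc] := ker_lift (t := subc aC f (b \oc i)) (proj1 S).
  by rewrite compcBr compcA qb ai subcc.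
have [d di] := Ext1_zero_extend aC c XY S'.
exists (addc aC (j \oc d) b).
by rewrite compcDl -compcA di jc subcK.
Qed.

Lemma retract_Ext1_zero_r X Y Z (i : hom Y Z) (r : hom Z Y) :
  r \oc i = idc Y -> Ext1_zero X Z -> Ext1_zero X Y.
Proof.
move=> ri XZ; apply/(Ext1_zero_retrP aC) => E j q S.
have [g gj] := Ext1_zero_extend aC i XZ S.
by exists (r \oc g); rewrite -compcA gj.
Qed.

End Orthogonality2.

Section Orthogonality3.
Variables (C : zcat) (aC : abelian C).
Implicit Types X Y Z K L P T : C.

Lemma Ext1_zero_ext_l Y K P X (i : hom K P) (p : hom P X) :
  short_exact i p -> Ext1_zero K Y -> Ext1_zero X Y -> Ext1_zero P Y.
Proof.
move=> S /(Ext1_zero_op aC) KY /(Ext1_zero_op aC) XY; apply/(Ext1_zero_op aC).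
exact: (Ext1_zero_ext_r (op_abelian aC) (op_ses S)).
Qed.

Lemma retract_Ext1_zero_l X Y Z (i : hom X Z) (r : hom Z X) :
  r \oc i = idc X -> Ext1_zero Z Y -> Ext1_zero X Y.
Proof.
move=> ri /(Ext1_zero_op aC) ZY; apply/(Ext1_zero_op aC).
exact: (@retract_Ext1_zero_r _ (op_abelian aC) _ _ _ r i).
Qed.

Definition is_product (I : Type) (Z : I -> C) (P : C) (pr : forall i, hom P (Z i)) :=
  (forall T (f : forall i, hom T (Z i)), exists g : hom T P, forall i, pr i \oc g = f i) /\
  (forall T (f g : hom T P), (forall i, pr i \oc f = pr i \oc g) -> f = g).

Definition is_coproduct (I : Type) (Z : I -> C) (P : C) (inj : forall i, hom (Z i) P) :=
  (forall T (f : forall i, hom (Z i) T), exists g : hom P T, forall i, g \oc inj i = f i) /\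
  (forall T (f g : hom P T), (forall i, f \oc inj i = g \oc inj i) -> f = g).

Lemma product_Ext1_zero I (Z : I -> C) P (pr : forall i, hom P (Z i)) X :
  is_product pr -> (forall i, Ext1_zero X (Z i)) -> Ext1_zero X P.
Proof.
move=> [pex puniq] XZ; apply/(Ext1_zero_retrP aC) => E j q S.
have [a aP] := dep_choice (fun i => Ext1_zero_extend aC (pr i) (XZ i) S).
have [r rP] := pex _ a; exists r; apply: puniq => i.
by rewrite compcA rP aP compc1.
Qed.

End Orthogonality3.

Lemma coproduct_Ext1_zero (C : zcat) (aC : abelian C) I (Z : I -> C) P
    (inj : forall i, hom (Z i) P) Y :
  is_coproduct inj -> (forall i, Ext1_zero (Z i) Y) -> Ext1_zero P Y.
Proof.
move=> cP ZY; apply/(Ext1_zero_op aC).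
apply: (product_Ext1_zero (op_abelian aC) cP) => i.
by apply/(Ext1_zero_op aC); exact: ZY.
Qed.

Section CotorsionPairs.
Variables (C : zcat) (aC : abelian C).
Implicit Types X Y Z K L P T : C.

Lemma closed_coker_rperp (F : obclass C) :
  (forall P : C, is_projective P -> F P) -> closed_ker_epi F ->
  closed_coker_mono (rperp F).
Proof.
move=> Fproj Fker X Y L i p im cp FX FY A FA.
have [P [e [pP ee]]] := enough_proj aC A; have [K [j S]] := epi_ses aC ee.
have S' := mono_cokernel_ses aC im cp.
apply: (Ext1_zeroI_extend aC S); first exact: proj_Ext1_zero.
have FK : F K by apply: Fker ee (proj1 S) _ FA; exact: Fproj.
move=> f; have [g pg] := Ext1_zero_lift aC f (FX _ FK) S'.
have [h hj] := Ext1_zero_extend aC g (FY _ FA) S.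
by exists (p \oc h); rewrite -compcA hj.
Qed.

Lemma closed_ker_lperp (S : obclass C) :
  (forall Z, S Z -> exists G T (i : hom Z G) (p : hom G T), [/\ short_exact i p,
     forall Y, lperp S Y -> Ext1_zero Y T
     & forall K X Y (j : hom K X) (q : hom X Y), short_exact j q ->
         lperp S X -> lperp S Y -> Ext1_zero K G]) ->
  closed_ker_epi (lperp S).
Proof.
move=> H K X Y j q eq kq SX SY Z SZ; have S' := epi_kernel_ses aC eq kq.
have [G [T [i [p [S0 YT KG]]]]] := H Z SZ.
apply: (Ext1_zeroI_lift aC S0); first exact: KG S' SX SY.
move=> f; have [g gj] := Ext1_zero_extend aC f (YT _ SY) S'.
have [h ph] := Ext1_zero_lift aC g (SX _ SZ) S0.
by exists (h \oc j); rewrite compcA ph.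
Qed.

Lemma lperp_rperp_retract (S : obclass C) X T (i : hom X T) :
  is_mono i -> lperp S T -> rperp (lperp S) X ->
  (forall Z (f : hom X Z), S Z -> exists g : hom T Z, g \oc i = f) ->
  exists r : hom T X, r \oc i = idc X.
Proof.
move=> im ST SX ext; have [L [p S']] := mono_ses aC im.
have SL : lperp S L.
  by move=> Z SZ; apply: (Ext1_zeroI_extend aC S' (ST _ SZ)) => f; exact: ext.
exact: (Ext1_zero_extend aC (idc X) (SX _ SL) S').
Qed.

End CotorsionPairs.

(** * Adjunctions and first derived functors *)

Section OppositeFunctor.
Variables C D : zcat.

Definition op_functor (F : zfunctor C D) : zfunctor (opcat C) (opcat D) :=
  @ZFunctor (opcat C) (opcat D) (zf_ob F) (fun X Y f => zf_map F f)
    (fun X => zf_id F X) (fun X Y Z g f => zf_comp F f g)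
    (fun X Y => zf_zero F Y X).

Definition exact_functor (F : zfunctor C D) : Prop :=
  forall (X Y Z : C) (i : hom X Y) (p : hom Y Z),
    short_exact i p -> short_exact (zf_map F i) (zf_map F p).

Definition right_exact_functor (F : zfunctor C D) : Prop :=
  forall (X Y Z : C) (f : hom X Y) (p : hom Y Z),
    is_cokernel p f -> is_cokernel (zf_map F p) (zf_map F f).

End OppositeFunctor.

Lemma op_exact_functor (C D : zcat) (F : zfunctor C D) :
  exact_functor F -> exact_functor (op_functor F).
Proof. by move=> eF X Y Z i p /op_ses S; exact: (op_ses (eF _ _ _ _ _ S)). Qed.

Record adjunction (C D : zcat) (L : zfunctor C D) (G : zfunctor D C) := Adjunction {
  adjr : forall (X : C) (Y : D), hom (L X) Y -> hom X (G Y);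
  adjl : forall (X : C) (Y : D), hom X (G Y) -> hom (L X) Y;
  adjrK : forall (X : C) (Y : D) (f : hom (L X) Y), adjl (adjr f) = f;
  adjlK : forall (X : C) (Y : D) (f : hom X (G Y)), adjr (adjl f) = f;
  adjr_natl : forall (X X' : C) (Y : D) (f : hom (L X) Y) (u : hom X' X),
    adjr (f \oc zf_map L u) = adjr f \oc u;
  adjr_natr : forall (X : C) (Y Y' : D) (f : hom (L X) Y) (v : hom Y Y'),
    adjr (v \oc f) = zf_map G v \oc adjr f }.

Section AdjunctionTheory.
Variables (C D : zcat) (L : zfunctor C D) (G : zfunctor D C) (adj : adjunction L G).

Lemma adjl_natl (X X' : C) (Y : D) (f : hom X (G Y)) (u : hom X' X) :
  adjl adj (f \oc u) = adjl adj f \oc zf_map L u.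
Proof. by rewrite -[RHS](adjrK adj) adjr_natl adjlK. Qed.

Lemma adjl_natr (X : C) (Y Y' : D) (f : hom X (G Y)) (v : hom Y Y') :
  adjl adj (zf_map G v \oc f) = v \oc adjl adj f.
Proof. by rewrite -[RHS](adjrK adj) adjr_natr adjlK. Qed.

Lemma adjr0 (X : C) (Y : D) : adjr adj (zeroc (L X) Y) = zeroc X (G Y).
Proof.
by rewrite -(comp0c Y (zeroc (L X) (L X))) adjr_natr zf_zero comp0c.
Qed.

Lemma adj_right_exact : right_exact_functor L.
Proof.
move=> X Y Z f p [pf pu]; split; first by rewrite -zf_comp pf zf_zero.
move=> T t tf; have [|u [up uP]] := pu _ (adjr adj t).
  by rewrite -adjr_natl tf adjr0.
exists (adjl adj u); split; first by rewrite -adjl_natl up adjrK.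
by move=> u' u'p; rewrite (uP (adjr adj u')) ?adjrK // -adjr_natl u'p.
Qed.

Definition op_adjunction : adjunction (op_functor G) (op_functor L) :=
  @Adjunction (opcat D) (opcat C) (op_functor G) (op_functor L)
    (fun Y X f => adjl adj f) (fun Y X f => adjr adj f)
    (fun Y X f => adjlK adj f) (fun Y X f => adjrK adj f)
    (fun Y Y' X f u => adjl_natr f u) (fun Y X X' f v => adjl_natl f v).

Lemma adj_factor X Y (f : hom X (G Y)) :
  f = zf_map G (adjl adj f) \oc adjr adj (idc (L X)).
Proof. by rewrite -adjr_natr compc1 adjlK. Qed.

Lemma adj_proj P : (forall X Y (f : hom X Y), is_epi f -> is_epi (zf_map G f)) ->
  is_projective P -> is_projective (L P).
Proof.
move=> Gepi pP X Y e f ee; have [g gf] := pP _ _ _ (adjr adj f) (Gepi _ _ _ ee).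
by exists (adjl adj g); rewrite -adjl_natr gf adjrK.
Qed.

End AdjunctionTheory.

Section ExtAdjunction.
Variables (C D : zcat) (aC : abelian C) (aD : abelian D).
Variables (L : zfunctor C D) (G : zfunctor D C) (adj : adjunction L G).

Lemma adj_Ext1_zero_left X Y :
  exact_functor G -> Ext1_zero X (G Y) -> Ext1_zero (L X) Y.
Proof.
move=> eG XY; apply/(Ext1_zero_sectP aD) => E i p S.
have [g gE] := Ext1_zero_lift aC (adjr adj (idc (L X))) XY (eG _ _ _ _ _ S).
by exists (adjl adj g); rewrite -adjl_natr gE adjrK.
Qed.

Lemma adj_Ext1_zero_right X Y :
  exact_functor L -> Ext1_zero (L X) Y -> Ext1_zero X (G Y).
Proof.
move=> eL XY; apply/(Ext1_zero_retrP aC) => E i p S.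
have [g gE] := Ext1_zero_extend aD (adjl adj (idc (G Y))) XY (eL _ _ _ _ _ S).
by exists (adjr adj g); rewrite -adjr_natl gE adjlK.
Qed.

End ExtAdjunction.

Section Exactness.
Variables (C : zcat) (aC : abelian C).

Lemma exact_atP (X Y Z : C) (f : hom X Y) (g : hom Y Z) :
  exact_at f g <-> exists (K : C) (i : hom K Y) (e : hom X K),
    [/\ is_kernel i g, i \oc e = f & is_epi e].
Proof.
split=> [[gf [H [K [i [e [c [ki ie ce]]]]] H0]]|[K [i [e [ki ie ee]]]]].
  exists K, i, e; split=> //; apply: (epiI aC) => T t te.
  have [u <-] := coker_desc ce te.
  by rewrite -(comp1c c) H0 comp0c compc0.
split; first by rewrite -ie compcA (proj1 ki) comp0c.
have [H [c cc]] := cokernel_ex aC e; exists H; first by exists K, i, e, c.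
apply: (coker_epi cc); rewrite comp1c comp0c.
by apply: (epi_eq0 ee); case: cc.
Qed.

Lemma image_epi (X Y Z N : C) (f : hom X Y) (p : hom Y Z) (n : hom N Y) (m : hom X N) :
  is_cokernel p f -> is_kernel n p -> n \oc m = f -> is_epi m.
Proof.
move=> cp kn nm; apply: (epiI aC) => T t tm; have nmono := ker_mono kn.
have [K [k kt]] := kernel_ex aC t; have kmono := ker_mono kt.
have nk : is_mono (n \oc k).
  by move=> U u v; rewrite -!compcA => /nmono/kmono.
have [W [c S]] := mono_ses aC nk; have [m' km] := ker_lift kt tm.
have [|w wp] := coker_desc (t := c) cp.
  by rewrite -nm -km !compcA -(compcA c) (ses0 S) comp0c.
have [|v nv] := ker_lift (t := n) (proj1 S).
  by rewrite -wp -compcA (proj1 kn) compc0.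
have kv : k \oc v = idc N by apply: nmono; rewrite compcA nv compc1.
by rewrite -(compc1 t) -kv compcA (proj1 kt) comp0c.
Qed.

Lemma cokernel_comp_epi (X K Y Z : C) (e : hom X K) (i : hom K Y) (p : hom Y Z) :
  is_epi e -> is_cokernel p i <-> is_cokernel p (i \oc e).
Proof.
move=> ee; split=> [] [pi pu].
  split=> [|T t]; first by rewrite compcA pi comp0c.
  by rewrite compcA => /(epi_eq0 ee); exact: pu.
have pi0 : p \oc i = zeroc K Z by apply: (epi_eq0 ee); rewrite -compcA.
by split=> // T t ti; apply: pu; rewrite compcA ti comp0c.
Qed.

Lemma kernel_comp_mono (K X Y Z : C) (k : hom K X) (f : hom X Y) (m : hom Y Z) :
  is_mono m -> is_kernel k f <-> is_kernel k (m \oc f).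
Proof.
move=> mm; split=> [] [pi pu].
  split=> [|T t]; first by rewrite -compcA pi compc0.
  by rewrite -compcA => /(mono_eq0 mm); exact: pu.
have pi0 : f \oc k = zeroc K Y by apply: (mono_eq0 mm); rewrite compcA.
by split=> // T t ti; apply: pu; rewrite -compcA ti compc0.
Qed.

End Exactness.

Section ExactOp.
Variables (C : zcat) (aC : abelian C).

Lemma image_mono (X Y Z N : C) (f : hom X Y) (p : hom Z X) (n : hom X N) (m : hom N Y) :
  is_kernel p f -> is_cokernel n p -> m \oc n = f -> is_mono m.
Proof. exact: (@image_epi _ (op_abelian aC)). Qed.

Lemma exact_at_op (X Y Z : C) (f : hom X Y) (g : hom Y Z) :
  exact_at f g -> @exact_at (opcat C) Z Y X g f.
Proof.
move=> /(exact_atP aC)[K [i [e [ki ie ee]]]].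
have [L [p cp]] := cokernel_ex aC i.
have [m mp] := coker_desc cp (proj1 ki).
apply/(exact_atP (op_abelian aC)); exists L, p, m; split=> //.
  by rewrite -ie; apply/(cokernel_comp_epi _ _ ee).
exact: (image_mono ki cp mp).
Qed.

End ExactOp.

Section LeftDerived.
Variables (C D : zcat) (aC : abelian C) (aD : abelian D).
Variables (F : zfunctor C D) (eF : right_exact_functor F).

Lemma right_exact_epi (X Y : C) (p : hom X Y) : is_epi p -> is_epi (zf_map F p).
Proof.
move=> /(epi_ses aC)[K [i [_ cp]]].
exact: coker_epi (eF cp).
Qed.

Lemma L1_zeroE X : L1_zero F X ->
  exists (K P : C) (i : hom K P) (p : hom P X),
    [/\ short_exact i p, is_projective P & is_mono (zf_map F i)].
Proof.
move=> [L [P hL] L0].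
have [K [i [e0 [ki ie0 ee0]]]] := (proj1 (exact_atP aC _ _)) (pr_exact0 P).
have [K1 [i1 [e1 [ki1 ie1 ee1]]]] := (proj1 (exact_atP aC _ _)) (pr_exact P 0).
have im := ker_mono ki.
exists K, (pr_ob P 0), i, (pr_aug P); split.
- exact (epi_kernel_ses aC (@pr_epi _ _ P) ki).
- exact: pr_proj.
have c0 : is_cokernel e0 (pr_d P 1).
  rewrite -ie1; apply/(cokernel_comp_epi _ _ ee1).
  apply: (epi_cokernel aC) => //; apply/(kernel_comp_mono _ _ im).
  by rewrite ie0.
have /(exact_atP aD)[N [n [m [kn nm em]]]] :
    exact_at (zf_map F (pr_d P 1)) (zf_map F (pr_d P 0)).
  split; last by exists L.
  by case: hL => [N [n [m [_ [[kn _] <- _]]]]]; rewrite compcA kn comp0c.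
have n0 : zf_map F e0 \oc n = zeroc _ _.
  by apply: (epi_eq0 em); rewrite -compcA nm; case: (eF c0).
apply: (monoI aD) => T t it.
have [Z [j S]] := epi_ses aD (right_exact_epi ee0).
have [W [j' [p [g [S' gE _]]]]] := ses_pullback aD t S.
apply: (epi_eq0 (ses_epi S')); rewrite -gE.
have [|u <-] := ker_lift (t := g) kn.
  by rewrite -ie0 zf_comp -compcA gE compcA it comp0c.
by rewrite compcA n0 comp0c.
Qed.

Lemma L1_zeroI (X K P : C) (i : hom K P) (p : hom P X) :
  short_exact i p -> is_projective P -> is_mono (zf_map F i) -> L1_zero F X.
Proof.
move=> S pP im.
have cov (Y : C) : exists c : {P : C & {K : C & (hom P Y * hom K P)%type}},
    is_projective (projT1 c) /\
    short_exact (projT2 (projT2 c)).2 (projT2 (projT2 c)).1.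
  have [P' [q [pP' eq]]] := enough_proj aC Y; have [K' [k S']] := epi_ses aC eq.
  by exists (existT _ P' (existT _ K' (q, k))).
have [c cP] := dep_choice cov.
pose fix syz n : C := if n is n'.+1 then projT1 (projT2 (c (syz n'))) else K.
pose ob n : C := if n is n'.+1 then projT1 (c (syz n')) else P.
pose e n : hom (ob n.+1) (syz n) := (projT2 (projT2 (c (syz n)))).1.
pose k n : hom (syz n) (ob n) :=
  match n with 0 => i | n'.+1 => (projT2 (projT2 (c (syz n')))).2 end.
have Se n : short_exact (k n.+1) (e n) by exact: (cP _).2.
have ee n : is_epi (e n) := ses_epi (Se n).
have km n : is_mono (k n).
  by case: n => [|n]; [exact: ses_mono S | exact: ses_mono (Se n)].
have prob n : is_projective (ob n) by case: n => //= n; exact: (cP _).1.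
have ex0 : exact_at (k 0 \oc e 0) p.
  by apply/(exact_atP aC); exists K, i, (e 0); split=> //; case: S.
have exn n : exact_at (k n.+1 \oc e n.+1) (k n \oc e n).
  apply/(exact_atP aC); exists (syz n.+1), (k n.+1), (e n.+1); split=> //.
  by apply/(kernel_comp_mono _ _ (km n)); case: (Se n).
pose R := ProjResolution prob (ses_epi S) ex0 exn.
have [_ [H hH H0]] : exact_at (zf_map F (pr_d R 1)) (zf_map F (pr_d R 0)).
  apply/(exact_atP aD); rewrite /= !zf_comp.
  have ce := eF (proj2 (Se 0)).
  have [N [n kn]] := kernel_ex aD (zf_map F (e 0)).
  have [m nm] := ker_lift kn (proj1 ce).
  exists N, n, (m \oc zf_map F (e 1)); split.
  - by apply/(kernel_comp_mono _ _ im).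
  - by rewrite compcA nm.
  move=> T u v; rewrite !compcA => /(right_exact_epi (ee 1)).
  exact: (image_epi aD ce kn nm).
by exists H => //; exists R.
Qed.

End LeftDerived.

Section RightDerived.
Variables (C D : zcat) (aC : abelian C) (aD : abelian D).
Variables (F : zfunctor C D).

Lemma R1_zero_op X : R1_zero F X <-> L1_zero (op_functor F) X.
Proof.
have pi (P : C) : is_injective P <-> @is_projective (opcat C) P.
  by split=> iP Y Z e f; exact: iP.
split=> [[L [J hL] L0]|[L [P hL] L0]].
  pose P := @ProjResolution (opcat C) X (ir_ob J) (ir_d J) (ir_aug J)
    (fun n => (pi _).1 (@ir_inj _ _ J n)) (@ir_mono _ _ J)
    (exact_at_op aC (ir_exact0 J)) (fun n => exact_at_op aC (ir_exact J n)).
  have /(exact_at_op aD)[_ [H hH H0]] :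
      exact_at (zf_map F (ir_d J 0)) (zf_map F (ir_d J 1)).
    split; last by exists L.
    by case: hL => [N [n [m [_ [[kn _] <- _]]]]]; rewrite compcA kn comp0c.
  by exists H => //; exists P.
pose oC := op_abelian aC; pose oD := op_abelian aD.
have exop (X' Y Z : C) (f : hom X' Y) (g : hom Y Z) :
  @exact_at (opcat C) Z Y X' g f -> exact_at f g := @exact_at_op _ oC _ _ _ g f.
pose J := @InjResolution C X (pr_ob P) (pr_d P) (pr_aug P)
    (fun n => (pi _).2 (@pr_proj _ _ P n)) (@pr_epi _ _ P)
    (exop _ _ _ _ _ (pr_exact0 P)) (fun n => exop _ _ _ _ _ (pr_exact P n)).
have /(exact_at_op oD)[_ [H hH H0]] :
    @exact_at (opcat D) _ _ _ (zf_map (op_functor F) (pr_d P 1))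
      (zf_map (op_functor F) (pr_d P 0)).
  split; last by exists L.
  by case: hL => [N [n [m [_ [[kn _] <- _]]]]]; rewrite compcA kn comp0c.
by exists H => //; exists J.
Qed.

End RightDerived.

Section DerivedPerp.
Variables (C D : zcat) (aC : abelian C) (aD : abelian D).
Variables (L : zfunctor C D) (G : zfunctor D C) (adj : adjunction L G).
Hypothesis eG : exact_functor G.

Lemma left_adjoint_perp (A B : obclass D) (X : C) :
  class_eq A (lperp B) -> (forall J : D, is_injective J -> B J) ->
  A (L X) /\ L1_zero L X <-> forall b, B b -> Ext1_zero X (G b).
Proof.
move=> AB Binj; have rL := adj_right_exact adj; split.
  move=> [/AB AX /(L1_zeroE aC aD rL) [K [P [i [p [S pP im]]]]]] b Bb.
  apply: (Ext1_zeroI_extend aC S); first exact: proj_Ext1_zero.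
  move=> f; have S' := mono_cokernel_ses aD im (rL _ _ _ _ _ (proj2 S)).
  have [g gi] := Ext1_zero_extend aD (adjl adj f) (AX _ Bb) S'.
  by exists (adjr adj g); rewrite -adjr_natl gi adjlK.
move=> XB; split.
  by apply/AB => b Bb; apply: (adj_Ext1_zero_left aC aD adj eG); exact: XB.
have [P [p [pP ep]]] := enough_proj aC X; have [K [i S]] := epi_ses aC ep.
apply: (L1_zeroI aC aD rL S pP).
apply: (monoI aD) => U u iu.
have [J [m [iJ mm]]] := enough_inj aD (L K).
apply: (mono_eq0 mm).
have [g gi] := Ext1_zero_extend aC (adjr adj m) (XB _ (Binj _ iJ)) S.
have <- : adjl adj g \oc zf_map L i = m by rewrite -adjl_natl gi adjrK.
by rewrite -compcA iu compc0.
Qed.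

End DerivedPerp.

Section DerivedPerpDual.
Variables (C D : zcat) (aC : abelian C) (aD : abelian D).
Variables (L : zfunctor D C) (G : zfunctor C D) (adj : adjunction L G).
Hypothesis eL : exact_functor L.

Lemma right_adjoint_perp (A B : obclass D) (X : C) :
  class_eq (rperp A) B -> (forall J : D, is_projective J -> A J) ->
  B (G X) /\ R1_zero G X <-> forall a, A a -> Ext1_zero (L a) X.
Proof.
move=> AB Aproj; rewrite (R1_zero_op aC aD).
have := @left_adjoint_perp _ _ (op_abelian aC) (op_abelian aD) _ _
  (op_adjunction adj) (op_exact_functor eL) B A X.
move=> ->.
- by split=> h a /h /(Ext1_zero_op aC).
- move=> Y; rewrite -AB; split=> h a Aa; apply/(Ext1_zero_op aD); exact: h.
- by move=> J iJ; apply: Aproj => Y Z e f; exact: iJ.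
Qed.

End DerivedPerpDual.

(** * Modules over R and over Q *)

Section MkLinear.
Variables (R : pzRingType) (U : lmodType R) (V : zmodType) (s : GRing.Scale.law R V).
Variable f : U -> V.
Hypothesis fL : linear_for s f.

Definition lin_fun of linear_for s f := f.
HB.instance Definition _ := GRing.isLinear.Build R U V s (lin_fun fL) fL.
Definition mklin : {linear U -> V | s} := lin_fun fL.

End MkLinear.

Section Submodule.
Variables (R : pzRingType) (V : lmodType R).

Record subpred := SubPred {
  sp_pred :> V -> Prop;
  sp0 : sp_pred 0;
  spP : forall a x y, sp_pred x -> sp_pred y -> sp_pred (a *: x + y) }.

Variable U : subpred.

Definition spb : pred V := fun x => `[< U x >].

Fact spb_submod : submod_closed spb.
Proof.
split; first by apply/asboolP/sp0.
by move=> a x y /asboolP xU /asboolP yU; apply/asboolP/spP.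
Qed.

HB.instance Definition _ := GRing.isSubmodClosed.Build R V spb spb_submod.

Record smod : Type := SMod { smod_val : V; smod_valP : spb smod_val }.
HB.instance Definition _ := [isSub for smod_val].
HB.instance Definition _ := [Choice of smod by <:].
HB.instance Definition _ := [SubChoice_isSubLmodule of smod by <:].

Definition smod_in x (xU : U x) : smod := SMod (introT (asboolP _) xU).

Lemma smod_prop (x : smod) : U (\val x).
Proof. by have /asboolP := smod_valP x. Qed.

Definition smod_inj : {linear smod -> V} := \val.

Lemma smod_injI : injective smod_inj.
Proof. exact: val_inj. Qed.

Definition qtmod : Type := Quotient.quot (GRing.ZmodClosed.clone V spb _).
HB.instance Definition _ := GRing.Zmodule.on qtmod.
HB.instance Definition _ := EqQuotient.on qtmod.

Definition qtmod_pi (x : V) : qtmod := \pi x.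

Lemma qtmod_eqP x y : qtmod_pi x = qtmod_pi y <-> U (x - y).
Proof.
split=> [/eqP|xy]; first by rewrite /qtmod_pi -Quotient.idealrBE => /asboolP.
by apply/eqP; rewrite /qtmod_pi -Quotient.idealrBE; apply/asboolP.
Qed.

Lemma qtmod_reprK x : qtmod_pi (repr x) = x.
Proof. exact: reprK. Qed.

Lemma sp_scale a x : U x -> U (a *: x).
Proof. by move=> xU; rewrite -[_ *: _]addr0; apply: spP => //; exact: sp0. Qed.

Lemma qtmod_piD x y : qtmod_pi (x + y) = qtmod_pi x + qtmod_pi y.
Proof. exact: raddfD. Qed.

Definition qtmod_scale a (x : qtmod) : qtmod := qtmod_pi (a *: repr x).

Lemma qtmod_piZ a x : qtmod_scale a (qtmod_pi x) = qtmod_pi (a *: x).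
Proof.
apply/qtmod_eqP; rewrite -scalerBr; apply: sp_scale; apply/qtmod_eqP.
exact: qtmod_reprK.
Qed.

Fact qtmod_scaleA a b x : qtmod_scale a (qtmod_scale b x) = qtmod_scale (a * b) x.
Proof. by rewrite -(qtmod_reprK x) !qtmod_piZ scalerA. Qed.

Fact qtmod_scale1 : left_id 1 qtmod_scale.
Proof. by move=> x; rewrite -(qtmod_reprK x) qtmod_piZ scale1r. Qed.

Fact qtmod_scaleDr : right_distributive qtmod_scale +%R.
Proof.
move=> a x y; rewrite -(qtmod_reprK x) -(qtmod_reprK y) -qtmod_piD !qtmod_piZ.
by rewrite scalerDr qtmod_piD.
Qed.

Fact qtmod_scaleDl x : {morph qtmod_scale^~ x : a b / a + b}.
Proof.
by move=> a b; rewrite -(qtmod_reprK x) !qtmod_piZ scalerDl qtmod_piD.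
Qed.

HB.instance Definition _ := GRing.Zmodule_isLmodule.Build R qtmod
  qtmod_scaleA qtmod_scale1 qtmod_scaleDr qtmod_scaleDl.

Fact qtmod_pi_linear : linear qtmod_pi.
Proof. by move=> a x y; rewrite qtmod_piD; congr (_ + _); rewrite -qtmod_piZ. Qed.

Definition qtmod_proj : {linear V -> qtmod} := mklin qtmod_pi_linear.

Lemma qtmod_surj y : exists x, qtmod_proj x = y.
Proof. by exists (repr y); exact: qtmod_reprK. Qed.

Lemma qtmod_eq0 x : qtmod_proj x = 0 <-> U x.
Proof.
have -> : (0 : qtmod) = qtmod_pi 0 by rewrite -[RHS]/(qtmod_proj 0) raddf0.
by rewrite qtmod_eqP subr0.
Qed.

End Submodule.

Section LinearFactor.
Variables (R : pzRingType) (U V : lmodType R).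

Definition kerpred (f : {linear U -> V}) : subpred U.
Proof.
refine (@SubPred R U (fun x => f x = 0) (raddf0 f) _).
by move=> a x y xf yf; rewrite linearP xf yf scaler0 addr0.
Defined.

Definition impred (f : {linear U -> V}) : subpred V.
Proof.
refine (@SubPred R V (fun y => exists x, f x = y) (ex_intro _ 0 (raddf0 f)) _).
by move=> a x y [x' <-] [y' <-]; exists (a *: x' + y'); rewrite linearP.
Defined.

End LinearFactor.

Lemma lift_inj (R : pzRingType) (U V W : lmodType R) (j : {linear U -> V})
    (f : {linear W -> V}) :
  injective j -> (forall x, exists u, j u = f x) ->
  exists g : {linear W -> U}, forall x, j (g x) = f x.
Proof.
move=> ji h; have [g gP] := choice h.
have gL : linear g by move=> a x y; apply: ji; rewrite linearP !gP linearP.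
by exists (mklin gL).
Qed.

(* The scaling of the target is kept general so as to cover k-linear maps into *)
(* R-modules. *)
Lemma desc_surj (R : pzRingType) (U V : lmodType R) (W : zmodType)
    (s : GRing.Scale.law R W) (p : {linear U -> V}) (f : {linear U -> W | s}) :
  (forall y, exists x, p x = y) -> (forall x, p x = 0 -> f x = 0) ->
  exists g : {linear V -> W | s}, forall x, g (p x) = f x.
Proof.
move=> ps h; have [sec secP] := choice ps.
have fE x y : p x = p y -> f x = f y.
  by move=> xy; apply/subr0_eq; rewrite -linearB; apply: h; rewrite linearB xy subrr.
have gL : linear_for s (f \o sec).
  by move=> a x y /=; rewrite -linearP; apply: fE; rewrite linearP !secP.
by exists (mklin gL) => x; rewrite /= /lin_fun /=; exact/fE/secP.
Qed.

Section RModBasics.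
Variable R : pzRingType.
Implicit Types X Y Z T : RMod R.

Lemma homE_R X Y (f g : hom X Y) (x : (X : lmodType R)) : f = g -> f x = g x.
Proof. by move=> ->. Qed.

Lemma rmod_monoP X Y (f : hom X Y) :
  is_mono f <-> injective (f : {linear X -> Y}).
Proof.
split=> [fm x y fxy|fi T u v /(homE_R (X := T)) uv]; last first.
  by apply: linear_eq => x; apply: fi; apply: uv.
apply/subr0_eq; pose K := kerpred f.
have kz : K (x - y) by rewrite /= linearB fxy subrr.
have /(homE_R (smod_in kz)) // :
  (smod_inj K : @hom (RMod R) (smod K : lmodType R) X) = (\0 : {linear smod K -> X}).
by apply: fm; apply: linear_eq => z /=; rewrite linear0; exact: (smod_prop z).
Qed.

Lemma rmod_epiP X Y (f : hom X Y) :
  is_epi f <-> forall y, exists x, (f : {linear X -> Y}) x = y.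
Proof.
split=> [fm y|fs T u v uv]; last first.
  by apply: linear_eq => y; have [x <-] := fs y; exact: (homE_R x uv).
apply/(qtmod_eq0 (impred f)).
have /(homE_R y) // :
  (qtmod_proj (impred f) : @hom (RMod R) Y (qtmod (impred f) : lmodType R)) = (\0 : {linear _ -> _}).
apply: fm; apply: linear_eq => x /=.
by apply/(qtmod_eq0 (impred f)); exists x.
Qed.

Lemma rmod_kernelP X Y Z (i : hom X Y) (p : hom Y Z) :
  is_kernel i p <-> injective (i : {linear X -> Y}) /\
    forall y, (p : {linear Y -> Z}) y = 0 <-> exists x, i x = y.
Proof.
split=> [kip|[ii ip]].
  have ii : injective (i : {linear X -> Y}) by apply/rmod_monoP; exact: ker_mono kip.
  split=> // y; split=> [py|[x <-]]; last exact: (homE_R x (proj1 kip)).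
  have [|u iu] := @ker_lift (RMod R) _ _ _ _ _ (smod (kerpred p) : lmodType R)
      (smod_inj (kerpred p)) kip.
    by apply: linear_eq => z /=; exact: (smod_prop z).
  exists (u (smod_in (U := kerpred p) py)).
  exact: (homE_R (smod_in (U := kerpred p) py) iu).
split; first by apply: linear_eq => x /=; apply/ip; exists x.
move=> T t pt; have [|g gP] := @lift_inj _ _ _ _ (i : {linear X -> Y}) (t : {linear T -> Y}) ii.
  by move=> x; apply/ip; exact: (homE_R x pt).
exists g; split=> [|g' g't]; first exact: linear_eq.
by apply: linear_eq => x; apply: ii; rewrite gP -(homE_R x g't).
Qed.

Lemma rmod_cokernelP X Y Z (i : hom X Y) (p : hom Y Z) :
  is_cokernel p i <-> (forall z, exists y, (p : {linear Y -> Z}) y = z) /\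
    forall y, p y = 0 <-> exists x, (i : {linear X -> Y}) x = y.
Proof.
split=> [cpi|[ps ip]].
  have ps : forall z, exists y, (p : {linear Y -> Z}) y = z.
    by apply/rmod_epiP; exact: coker_epi cpi.
  split=> // y; split=> [py|[x <-]]; last exact: (homE_R x (proj1 cpi)).
  have [|u up] := @coker_desc (RMod R) _ _ _ _ _ (qtmod (impred i) : lmodType R)
      (qtmod_proj (impred i)) cpi.
    by apply: linear_eq => z /=; apply/(qtmod_eq0 (impred i)); exists z.
  by apply/(qtmod_eq0 (impred i)); rewrite -(homE_R y up) /= py linear0.
split; first by apply: linear_eq => x /=; apply/ip; exists x.
move=> T t ti; have [|g gP] := @desc_surj _ _ _ _ _ (p : {linear Y -> Z}) (t : {linear Y -> T}) ps.
  by move=> y /ip[x <-]; exact: (homE_R x ti).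
exists g; split=> [|g' g't]; first exact: linear_eq.
by apply: linear_eq => z; have [y <-] := ps z; rewrite gP -(homE_R y g't).
Qed.

Lemma rmod_sesP X Y Z (i : hom X Y) (p : hom Y Z) :
  short_exact i p <-> [/\ injective (i : {linear X -> Y}),
    forall z, exists y, (p : {linear Y -> Z}) y = z
    & forall y, p y = 0 <-> exists x, i x = y].
Proof.
rewrite /short_exact rmod_kernelP rmod_cokernelP; split=> [[[]] ? ? []|[]] //.
Qed.

End RModBasics.

Section QSub.
Variables (k : fieldType) (Q : lincat k) (R : kalg k) (X : qmod Q R).
Variable U : forall p, subpred (X p).
Hypothesis Ust : forall p q (f : lhom p q) x, U p x -> U q (qm_map X f x).

Fact qsub_ex (p q : Q) (f : lhom p q) : exists g : {linear smod (U p) -> smod (U q)},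
  forall x, smod_inj (U q) (g x) = qm_map X f (smod_inj (U p) x).
Proof.
apply: (lift_inj (f := qm_map X f \o smod_inj (U p)) (@smod_injI _ _ (U q))) => x.
by exists (smod_in (Ust f (smod_prop x))).
Qed.

Definition qsub_map (p q : Q) (f : lhom p q) := projT1 (cid (qsub_ex f)).

Fact qsub_mapE (p q : Q) (f : lhom p q) x :
  smod_inj (U q) (qsub_map f x) = qm_map X f (smod_inj (U p) x).
Proof. by rewrite /qsub_map; case: cid. Qed.

Definition qsub : qmod Q R.
Proof.
refine (@QMod k Q R (fun p => smod (U p)) qsub_map _ _ _ _).
- by move=> p x; apply: smod_injI; rewrite qsub_mapE qm_id.
- by move=> p q r g f x; apply: smod_injI; rewrite !qsub_mapE qm_comp.
- by move=> p q f g x; apply: smod_injI; rewrite linearD !qsub_mapE qm_add.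
- by move=> p q c f x; apply: smod_injI; rewrite linearZ !qsub_mapE qm_scale.
Defined.

Definition qsub_inj : qmor qsub X := @QMor k Q R qsub X (fun p => smod_inj (U p)) qsub_mapE.

Fact qquot_ex (p q : Q) (f : lhom p q) : exists g : {linear qtmod (U p) -> qtmod (U q)},
  forall x, g (qtmod_proj (U p) x) = qtmod_proj (U q) (qm_map X f x).
Proof.
apply: (desc_surj (f := qtmod_proj (U q) \o qm_map X f) (@qtmod_surj _ _ (U p))) => x.
by move/(qtmod_eq0 (U p)) => xU; apply/(qtmod_eq0 (U q)); exact: Ust.
Qed.

Definition qquot_map (p q : Q) (f : lhom p q) := projT1 (cid (qquot_ex f)).

Fact qquot_mapE (p q : Q) (f : lhom p q) x :
  qquot_map f (qtmod_proj (U p) x) = qtmod_proj (U q) (qm_map X f x).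
Proof. by rewrite /qquot_map; case: cid. Qed.

Definition qquot : qmod Q R.
Proof.
refine (@QMod k Q R (fun p => qtmod (U p)) qquot_map _ _ _ _).
- by move=> p x; have [y <-] := qtmod_surj x; rewrite qquot_mapE qm_id.
- by move=> p q r g f x; have [y <-] := qtmod_surj x; rewrite !qquot_mapE qm_comp.
- by move=> p q f g x; have [y <-] := qtmod_surj x; rewrite !qquot_mapE qm_add linearD.
- by move=> p q c f x; have [y <-] := qtmod_surj x; rewrite !qquot_mapE qm_scale linearZ.
Defined.

Definition qquot_proj : qmor X qquot :=
  @QMor k Q R X qquot (fun p => qtmod_proj (U p)) (fun p q f x => esym (qquot_mapE f x)).

End QSub.

Section QLift.
Variables (k : fieldType) (Q : lincat k) (R : kalg k).
Implicit Types X Y Z T : qmod Q R.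

Lemma qlift_inj X Y T (j : qmor X Y) (t : qmor T Y) :
  (forall p, injective (j p)) -> (forall p x, exists u, j p u = t p x) ->
  exists g : qmor T X, forall p x, j p (g p x) = t p x.
Proof.
move=> ji h; have [g gP] := dep_choice (fun p => lift_inj (ji p) (h p)).
have gN (p q : Q) (f : lhom p q) x : g q (qm_map T f x) = qm_map X f (g p x).
  by apply: ji; rewrite qmor_nat !gP qmor_nat.
by exists (@QMor k Q R T X g gN).
Qed.

Lemma qdesc_surj X Y T (e : qmor X Y) (t : qmor X T) :
  (forall p y, exists x, e p x = y) -> (forall p x, e p x = 0 -> t p x = 0) ->
  exists g : qmor Y T, forall p x, g p (e p x) = t p x.
Proof.
move=> es h; have [g gP] := dep_choice (fun p => desc_surj (es p) (h p)).
have gN (p q : Q) (f : lhom p q) y : g q (qm_map Y f y) = qm_map T f (g p y).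
  by have [x <-] := es p y; rewrite -qmor_nat !gP qmor_nat.
by exists (@QMor k Q R Y T g gN).
Qed.

End QLift.

Section QRModBasics.
Variables (k : fieldType) (Q : lincat k) (R : kalg k).
Implicit Types X Y Z T : QRMod Q R.

Lemma homE_Q X Y (f g : hom X Y) (p : Q) (x : (X : qmod Q R) p) :
  f = g -> (f : qmor X Y) p x = (g : qmor X Y) p x.
Proof. by move=> ->. Qed.

Definition qker X Y (f : hom X Y) p := kerpred ((f : qmor X Y) p).
Definition qim X Y (f : hom X Y) p := impred ((f : qmor X Y) p).

Lemma qker_st X Y (f : hom X Y) (p q : Q) (g : lhom p q) x :
  qker f p x -> qker f q (qm_map (X : qmod Q R) g x).
Proof. by rewrite /= => fx; rewrite qmor_nat fx linear0. Qed.

Lemma qim_st X Y (f : hom X Y) (p q : Q) (g : lhom p q) y :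
  qim f p y -> qim f q (qm_map (Y : qmod Q R) g y).
Proof. by move=> [x <-]; exists (qm_map (X : qmod Q R) g x); rewrite qmor_nat. Qed.

Lemma qmod_monoP X Y (f : hom X Y) :
  is_mono f <-> forall p, injective ((f : qmor X Y) p).
Proof.
split=> [fm p x y fxy|fi T u v uv]; last first.
  by apply: qmor_eq => p x; apply: fi; exact: (homE_Q x uv).
apply/subr0_eq.
have kz : qker f p (x - y) by rewrite /= linearB fxy subrr.
pose K : QRMod Q R := qsub (@qker_st X Y f); pose j : hom K X := qsub_inj (@qker_st X Y f).
have E : j = zeroc K X.
  by apply: fm; apply: qmor_eq => q z /=; rewrite linear0; exact: (smod_prop z).
exact: (@homE_Q K X _ _ p (smod_in kz) E).
Qed.

Lemma qmod_epiP X Y (f : hom X Y) :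
  is_epi f <-> forall p y, exists x, (f : qmor X Y) p x = y.
Proof.
split=> [fm p y|fs T u v uv]; last first.
  by apply: qmor_eq => p y; have [x <-] := fs p y; exact: (homE_Q x uv).
apply/(qtmod_eq0 (qim f p)).
pose L : QRMod Q R := qquot (@qim_st X Y f); pose e : hom Y L := qquot_proj (@qim_st X Y f).
have E : e = zeroc Y L.
  apply: fm; apply: qmor_eq => q x /=.
  by apply/(qtmod_eq0 (qim f q)); exists x.
exact: (@homE_Q Y L _ _ p y E).
Qed.

Lemma qmod_kernelP X Y Z (i : hom X Y) (e : hom Y Z) :
  is_kernel i e <-> (forall p, injective ((i : qmor X Y) p)) /\
    forall p y, (e : qmor Y Z) p y = 0 <-> exists x, (i : qmor X Y) p x = y.
Proof.
split=> [kie|[ii ie]].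
  have ii : forall p, injective ((i : qmor X Y) p) by apply/qmod_monoP; exact: ker_mono kie.
  split=> // p y; split=> [ey|[x <-]]; last exact: (homE_Q x (proj1 kie)).
  pose K : QRMod Q R := qsub (@qker_st Y Z e); pose j : hom K Y := qsub_inj (@qker_st Y Z e).
  have [|u iu] := ker_lift (t := j) kie.
    by apply: qmor_eq => q z /=; exact: (smod_prop z).
  exists ((u : qmor _ _) p (smod_in (U := qker e p) ey)).
  exact: (@homE_Q K Y _ _ p (smod_in (U := qker e p) ey) iu).
split; first by apply: qmor_eq => p x /=; apply/ie; exists x.
move=> T t et; have [|g gP] := @qlift_inj _ _ _ _ _ _ (i : qmor X Y) (t : qmor T Y) ii.
  by move=> p x; apply/ie; exact: (homE_Q x et).
exists g; split=> [|g' g't]; first exact: qmor_eq.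
by apply: qmor_eq => p x; apply: ii; rewrite gP -(homE_Q x g't).
Qed.

Lemma qmod_cokernelP X Y Z (i : hom X Y) (e : hom Y Z) :
  is_cokernel e i <-> (forall p z, exists y, (e : qmor Y Z) p y = z) /\
    forall p y, (e : qmor Y Z) p y = 0 <-> exists x, (i : qmor X Y) p x = y.
Proof.
split=> [cei|[es ie]].
  have es : forall p z, exists y, (e : qmor Y Z) p y = z.
    by apply/qmod_epiP; exact: coker_epi cei.
  split=> // p y; split=> [ey|[x <-]]; last exact: (homE_Q x (proj1 cei)).
  pose L : QRMod Q R := qquot (@qim_st X Y i); pose j : hom Y L := qquot_proj (@qim_st X Y i).
  have [|u ue] := coker_desc (t := j) cei.
    by apply: qmor_eq => q z /=; apply/(qtmod_eq0 (qim i q)); exists z.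
  apply/(qtmod_eq0 (qim i p)); rewrite -[LHS](@homE_Q Y L _ _ p y ue) /= ey.
  exact: linear0.
split; first by apply: qmor_eq => p x /=; apply/ie; exists x.
move=> T t ti; have [|g gP] := @qdesc_surj _ _ _ _ _ _ (e : qmor Y Z) (t : qmor Y T) es.
  by move=> p y /ie[x <-]; exact: (homE_Q x ti).
exists g; split=> [|g' g't]; first exact: qmor_eq.
by apply: qmor_eq => p z; have [y <-] := es p z; rewrite gP -(homE_Q y g't).
Qed.

Lemma qmod_sesP X Y Z (i : hom X Y) (e : hom Y Z) :
  short_exact i e <-> [/\ forall p, injective ((i : qmor X Y) p),
    forall p z, exists y, (e : qmor Y Z) p y = z
    & forall p y, (e : qmor Y Z) p y = 0 <-> exists x, (i : qmor X Y) p x = y].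
Proof.
rewrite /short_exact qmod_kernelP qmod_cokernelP; split=> [[[]] ? ? []|[]] //.
Qed.

End QRModBasics.

Lemma kretraction (k : fieldType) (U V : lmodType k) (j : {linear U -> V}) :
  injective j -> exists r : {linear V -> U}, forall u, r (j u) = u.
Proof.
move=> ji.
pose indep (S : set V) := (forall a x y, S x -> S y -> S (a *: x + y)) /\
  (forall u, S (j u) -> u = 0).
have [F Fsub Ftot|S [[SP Sj] Smax]] := @Zorn_bigcup V indep.
  split=> [a x y [A FA Ax] [B FB By]|u [A FA Au]]; last exact: (Fsub A FA).2 Au.
  have [AB|BA] := Ftot A B FA FB.
    by exists B => //; apply: (Fsub B FB).1 => //; exact: AB.
  by exists A => //; apply: (Fsub A FA).1 => //; exact: BA.
pose S0 x := S x \/ x = 0.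
have S0P a x y : S0 x -> S0 y -> S0 (a *: x + y).
  move=> [Sx|->] [Sy|->].
  - by left; exact: SP.
  - have [->|a0] := eqVneq a 0; first by right; rewrite scale0r addr0.
    left; rewrite addr0 -[a *: x](subrK x) -[X in _ - X]scale1r -scalerBl.
    exact: SP.
  - by left; rewrite scaler0 add0r.
  - by right; rewrite scaler0 addr0.
have S0j u : S0 (j u) -> u = 0 by case=> [/Sj//|u0]; apply: ji; rewrite u0 linear0.
have dec v : exists u, S0 (v - j u).
  apply: contrapT => /forallNP nv.
  pose S' := [set x | exists a s, S0 s /\ x = a *: v + s]%classic.
  have S'P : indep S'.
    split=> [a _ _ [b [s [Ss ->]]] [c [t [St ->]]]|u [a [s [Ss jE]]]].
      exists (a * b + c), (a *: s + t); split; first exact: S0P.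
      by rewrite scalerDr scalerA addrACA -scalerDl.
    have [a0|a0] := eqVneq a 0.
      by apply: S0j; rewrite jE a0 scale0r add0r.
    case: (nv (a^-1 *: u)); rewrite linearZ /= jE scalerDr scalerA mulVf // scale1r.
    rewrite opprD addrA subrr add0r -scalerN -scaleN1r scalerA.
    by rewrite -[_ *: s]addr0; apply: S0P => //; right.
  have SS' : (S `<=` S')%classic.
    by move=> x Sx; exists 0, x; split; [left | rewrite scale0r add0r].
  have [EE|nE] := pselect (S' = S).
    apply: (nv 0); rewrite linear0 subr0; left; rewrite -EE.
    by exists 1, 0; split; [right | rewrite scale1r addr0].
  apply: (Smax S') => //; split=> // S'S; apply: nE.
  by apply/seteqP; split.
have [r rP] := choice dec.
have runiq v u : S0 (v - j u) -> r v = u.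
  move=> vu; apply/subr0_eq/S0j.
  have -> : j (r v - u) = (-1) *: (v - j (r v)) + (v - j u).
    by rewrite linearB scaleN1r opprB addrA subrK.
  exact: S0P.
have rL : linear r.
  move=> a x y; apply: runiq; rewrite linearP opprD addrACA -scalerBr.
  exact: S0P.
exists (mklin rL) => u; apply: runiq; rewrite subrr; by right.
Qed.

Lemma ksection (k : fieldType) (V W : lmodType k) (p : {linear V -> W}) :
  (forall w, exists v, p v = w) -> exists s : {linear W -> V}, forall w, p (s w) = w.
Proof.
move=> ps; have [r rP] := kretraction (@smod_injI _ _ (kerpred p)).
have fL : linear (fun v => v - smod_inj (kerpred p) (r v)).
  move=> a x y; rewrite (linearP r) (linearP (smod_inj _)) opprD addrACA.
  by rewrite scalerBr.
have [|s sP] := @desc_surj _ _ _ _ _ p (mklin fL) ps.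
  move=> v pv; rewrite /= /lin_fun.
  have -> : v = smod_inj (kerpred p) (smod_in (U := kerpred p) pv) by [].
  by rewrite rP subrr.
exists s => w; have [v <-] := ps w; rewrite sP /= /lin_fun linearB.
by rewrite (smod_prop (r v) : p _ = 0) subr0.
Qed.

Section KLin.
Variables (k : fieldType) (R : kalg k) (V : lmodType k) (M : lmodType R).

Definition klin : Type := {linear V -> M | kscale R}.
Definition klin_fun (u : klin) : {linear V -> M | kscale R} := u.
Coercion klin_fun : klin >-> GRing.Linear.type.

HB.instance Definition _ := gen_eqMixin klin.
HB.instance Definition _ := gen_choiceMixin klin.

Lemma klin_eq (u v : klin) : u =1 v -> u = v.
Proof. exact: linear_eq. Qed.

Definition klin0 : klin := (\0 : {linear V -> M | kscale R}).
Definition klinD (u v : klin) : klin :=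
  (klin_fun u \+ klin_fun v : {linear V -> M | kscale R}).
Definition klinN (u : klin) : klin := (\- (klin_fun u) : {linear V -> M | kscale R}).

Fact klinDA : associative klinD.
Proof. by move=> f g h; apply: klin_eq => x /=; rewrite addrA. Qed.
Fact klinDC : commutative klinD.
Proof. by move=> f g; apply: klin_eq => x /=; rewrite addrC. Qed.
Fact klin0D : left_id klin0 klinD.
Proof. by move=> f; apply: klin_eq => x /=; rewrite add0r. Qed.
Fact klinND : left_inverse klin0 klinN klinD.
Proof. by move=> f; apply: klin_eq => x /=; rewrite addNr. Qed.

HB.instance Definition _ := GRing.isZmodule.Build klin klinDA klinDC klin0D klinND.

Fact klinZ_linear (r : R) (u : klin) : linear_for (kscale R) (fun v => r *: u v).
Proof. by move=> c x y; rewrite linearP /= scalerDr !scalerA kalg_central. Qed.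

Definition klinZ r u : klin := mklin (klinZ_linear r u).

Fact klinZA a b u : klinZ a (klinZ b u) = klinZ (a * b) u.
Proof. by apply: klin_eq => x; rewrite /= /lin_fun /= scalerA. Qed.
Fact klinZ1 : left_id 1 klinZ.
Proof. by move=> u; apply: klin_eq => x; rewrite /= /lin_fun scale1r. Qed.
Fact klinZDr : right_distributive klinZ +%R.
Proof. by move=> a u v; apply: klin_eq => x; rewrite /= /lin_fun /= scalerDr. Qed.
Fact klinZDl u : {morph klinZ^~ u : a b / a + b}.
Proof. by move=> a b; apply: klin_eq => x; rewrite /= /lin_fun /= scalerDl. Qed.

HB.instance Definition _ := GRing.Zmodule_isLmodule.Build R klin
  klinZA klinZ1 klinZDr klinZDl.

Lemma klinDE (u v : klin) x : (u + v) x = u x + v x. Proof. by []. Qed.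
Lemma klinZE r (u : klin) x : (r *: u) x = r *: u x. Proof. by []. Qed.
Lemma klin0E x : (0 : klin) x = 0. Proof. by []. Qed.

Lemma klinZr (u : klin) c x : u (c *: x) = kalg_map R c *: u x.
Proof. by rewrite linearZ. Qed.

Lemma klin_ev_linear x : linear (fun u : klin => u x).
Proof. by []. Qed.
Definition klin_ev x : {linear klin -> M} := mklin (klin_ev_linear x).

End KLin.

Section KLinMaps.
Variables (k : fieldType) (R : kalg k).

Lemma klin_pre_linear (V W : lmodType k) (M : lmodType R) (f : {linear V -> W}) :
  linear (fun u : klin W M =>
    ((klin_fun u \o f : {linear V -> M | kscale R}) : klin V M)).
Proof. by move=> a u v; apply: klin_eq. Qed.
Definition klin_pre V W M f : {linear klin W M -> klin V M} :=
  mklin (@klin_pre_linear V W M f).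

Lemma klin_post_fun_linear (V : lmodType k) (M N : lmodType R) (f : {linear M -> N})
  (u : klin V M) : linear_for (kscale R) (fun x => f (u x)).
Proof. by move=> c x y; rewrite linearP /= linearP. Qed.
Lemma klin_post_linear (V : lmodType k) (M N : lmodType R) (f : {linear M -> N}) :
  linear (fun u : klin V M => (mklin (klin_post_fun_linear f u) : klin V N)).
Proof. by move=> a u v; apply: klin_eq => x; rewrite /= /lin_fun /= linearP. Qed.
Definition klin_post V M N f : {linear klin V M -> klin V N} :=
  mklin (@klin_post_linear V M N f).

Lemma klin_extend (V W : lmodType k) (M : lmodType R) (j : {linear V -> W})
    (u : klin V M) : injective j -> exists w : klin W M, forall x, w (j x) = u x.
Proof.
move=> /kretraction[r rj]; exists (klin_fun u \o r : {linear W -> M | kscale R}) => x /=.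
by rewrite rj.
Qed.

End KLinMaps.

Section RestrictScalars.
Variables (k : fieldType) (R : kalg k) (M : lmodType R).

Definition kres : Type := M.
HB.instance Definition _ := GRing.Zmodule.on kres.

Definition kres_scale (c : k) (x : kres) : kres := kalg_map R c *: (x : M).

Fact kres_scaleA a b x : kres_scale a (kres_scale b x) = kres_scale (a * b) x.
Proof. by rewrite /kres_scale scalerA -rmorphM. Qed.
Fact kres_scale1 : left_id 1 kres_scale.
Proof. by move=> x; rewrite /kres_scale rmorph1 scale1r. Qed.
Fact kres_scaleDr : right_distributive kres_scale +%R.
Proof. by move=> a x y; rewrite /kres_scale scalerDr. Qed.
Fact kres_scaleDl x : {morph kres_scale^~ x : a b / a + b}.
Proof. by move=> a b; rewrite /kres_scale rmorphD scalerDl. Qed.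

HB.instance Definition _ := GRing.Zmodule_isLmodule.Build k kres
  kres_scaleA kres_scale1 kres_scaleDr kres_scaleDl.

Fact kres_id_linear : linear_for (kscale R) (fun x : kres => (x : M)).
Proof. by []. Qed.
Definition kres_id : klin kres M := mklin kres_id_linear.

End RestrictScalars.

Section RestrictMap.
Variables (k : fieldType) (R : kalg k) (M N : lmodType R) (f : {linear M -> N}).
Fact kres_map_linear : linear (f : kres M -> kres N).
Proof. by move=> a x y; rewrite linearP. Qed.
Definition kres_map : {linear kres M -> kres N} := mklin kres_map_linear.
End RestrictMap.

(* Hom_k(R, M), with (s u)(r) = u(r s). *)
Section Coinduced.
Variables (k : fieldType) (R : kalg k) (M : lmodType R).
Local Notation Rk := (kres (R^o : lmodType R)).

Definition coind : Type := klin Rk M.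
HB.instance Definition _ := GRing.Zmodule.on coind.

Fact coindZ_linear (s : R) (u : coind) :
  linear_for (kscale R) (fun r : Rk => (u : klin Rk M) (r * s : R)).
Proof.
move=> c x y; rewrite -linearP; congr (klin_fun u _).
by rewrite -[LHS]/((kalg_map R c * (x : R) + y) * s) mulrDl -mulrA.
Qed.
Definition coindZ s u : coind := mklin (coindZ_linear s u).

Fact coindZA a b u : coindZ a (coindZ b u) = coindZ (a * b) u.
Proof. by apply: klin_eq => x; rewrite /= /lin_fun /= /lin_fun mulrA. Qed.
Fact coindZ1 : left_id 1 coindZ.
Proof. by move=> u; apply: klin_eq => x; rewrite /= /lin_fun mulr1. Qed.
Fact coindZDr : right_distributive coindZ +%R.
Proof. by move=> a u v; apply: klin_eq. Qed.
Fact coindZDl u : {morph coindZ^~ u : a b / a + b}.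
Proof.
move=> a b; apply: klin_eq => x; rewrite /= /lin_fun /= /lin_fun.
by rewrite -linearD; congr (klin_fun u _); rewrite mulrDr.
Qed.

HB.instance Definition _ := GRing.Zmodule_isLmodule.Build R coind
  coindZA coindZ1 coindZDr coindZDl.

Definition coind_inj : @is_injective (RMod R) (coind : lmodType R).
Proof.
move=> X Y m f /rmod_monoP mi.
have f1L : linear_for (kscale R) (fun x : kres X => (f x : klin Rk M) (1 : R)).
  move=> c x y; rewrite [_ + _](_ : _ = kalg_map R c *: (x : X) + y) //.
  rewrite linearP /=; congr (_ + _).
  rewrite -[LHS]/((f x : klin Rk M) (1 * kalg_map R c : R)) mul1r.
  rewrite -(klinZr (f x : klin Rk M) c (1 : R)); congr (klin_fun _ _).
  exact: esym (mulr1 _).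
have [|w wP] := @klin_extend _ _ _ _ _ (kres_map (m : {linear X -> Y})) (mklin f1L : klin _ _).
  exact: mi.
have gL1 (y : Y) : linear_for (kscale R) (fun r : Rk => w ((r : R) *: y : Y)).
  move=> c a b; rewrite -linearP; congr (klin_fun w _).
  by rewrite -[LHS]/((kalg_map R c * (a : R) + b) *: y) scalerDl -scalerA.
have gL2 : linear (fun y => mklin (gL1 y) : coind).
  move=> a x y; apply: klin_eq => r; rewrite /= /lin_fun /=.
  rewrite -[RHS]/(w (((r : R) * a) *: x : Y) + w ((r : R) *: y : Y)) -linearD.
  by congr (klin_fun w _); rewrite scalerDr scalerA.
exists (mklin gL2); apply: linear_eq => x; apply: klin_eq => r.
have E : (r : R) *: m x = m ((r : R) *: x) by rewrite linearZ.
transitivity (w (m ((r : R) *: x) : Y)); first by congr (klin_fun w _).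
rewrite [LHS]wP /= /lin_fun linearZ.
by rewrite -[LHS]/((f x : klin Rk M) (1 * r : R)) mul1r.
Qed.

Lemma coind_embed : exists f : @hom (RMod R) M (coind : lmodType R), is_mono f.
Proof.
have gL1 (y : M) : linear_for (kscale R) (fun r : Rk => (r : R) *: y).
  by move=> c a b; rewrite -[LHS]/((kalg_map R c * (a : R) + b) *: y) scalerDl -scalerA.
have gL2 : linear (fun y => mklin (gL1 y) : coind).
  move=> a x y; apply: klin_eq => r; rewrite /= /lin_fun /=.
  by rewrite -[RHS]/(((r : R) * a) *: x + (r : R) *: y) scalerDr scalerA.
exists (mklin gL2); apply/rmod_monoP => x y /(congr1 (fun u : coind => (u : klin Rk M) (1 : R))).
by rewrite /= /lin_fun !scale1r.
Qed.

End Coinduced.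

(** * Adjunctions between R-modules and functors on Q *)

Section HMod.
Variables (k : fieldType) (Q : lincat k) (R : kalg k).
Implicit Types (V W : qmod (lop Q) (kself k)) (M N : lmodType R).

Definition kob V (p : Q) : lmodType k := V p.
Definition kmap V (p q : Q) (f : lhom p q) : {linear kob V q -> kob V p} :=
  qm_map V (f : @lhom k (lop Q) q p).

(* The functor r |-> Hom_k(V(r), M), for a right Q-module V. With V = Q(-, q) it *)
(* is the right adjoint G_q of the evaluation X |-> X(q), with V = D Q(q, -) its *)
(* left adjoint F_q, and with V = D S<q> it is S_q(M). *)
Definition hmod V M : qmod Q R.
Proof.
refine (@QMod k Q R (fun p => klin (kob V p) M) (fun p q f => klin_pre M (kmap V f)) _ _ _ _).
- move=> p u; apply: klin_eq => x /=; congr (klin_fun u _).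
  exact: (@qm_id _ _ _ V).
- move=> p q r g f u; apply: klin_eq => x /=; congr (klin_fun u _).
  exact: (@qm_comp _ _ _ V r q p f g).
- move=> p q f g u; apply: klin_eq => x /=.
  rewrite -[RHS]linearD; congr (klin_fun u _).
  exact: (@qm_add _ _ _ V q p f g).
- move=> p q c f u; apply: klin_eq => x; rewrite klinZE -(klinZr u c (kmap V f x)).
  congr (klin_fun u _); exact: (@qm_scale _ _ _ V q p c f).
Defined.

Lemma hmod_mapE V M (p q : Q) (f : lhom p q) (u : klin (kob V p) M) x :
  (qm_map (hmod V M) f u : klin _ _) x = u (kmap V f x).
Proof. by []. Qed.

Definition hpost V M N (f : {linear M -> N}) : qmor (hmod V M) (hmod V N) :=
  @QMor k Q R (hmod V M) (hmod V N) (fun p => klin_post (kob V p) f)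
    (fun p q g u => @klin_eq _ _ _ _
      (klin_post (kob V q) f (qm_map (hmod V M) g u))
      (qm_map (hmod V N) g (klin_post (kob V p) f u)) (fun x => erefl)).

Definition kapp V W (g : qmor V W) (p : Q) : {linear kob V p -> kob W p} := g p.

Lemma hpre_nat V W M (g : qmor V W) (p q : Q) (f : lhom p q) (u : hmod W M p) :
  klin_pre M (kapp g q) (qm_map (hmod W M) f u) =
  qm_map (hmod V M) f (klin_pre M (kapp g p) u).
Proof.
apply: klin_eq => x /=; congr (klin_fun u _); exact: esym (qmor_nat g _ _).
Qed.

Definition hpre V W M (g : qmor V W) : qmor (hmod W M) (hmod V M) :=
  @QMor k Q R (hmod W M) (hmod V M) (fun p => klin_pre M (kapp g p)) (hpre_nat (M := M) g).

Definition hfun V : zfunctor (RMod R) (QRMod Q R).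
Proof.
refine (@ZFunctor (RMod R) (QRMod Q R) (fun M => hmod V M)
  (fun M N f => hpost V f) _ _ _).
- by move=> M; apply: qmor_eq => p u; apply: klin_eq.
- by move=> M N L g f; apply: qmor_eq => p u; apply: klin_eq.
- by move=> M N; apply: qmor_eq => p u; apply: klin_eq.
Defined.

Lemma hpre_ses (U V W : QRMod (lop Q) (kself k)) (i : hom U V) (e : hom V W) M :
  short_exact i e ->
  @short_exact (QRMod Q R) (hmod W M) (hmod V M) (hmod U M) (hpre M e) (hpre M i).
Proof.
move=> /qmod_sesP[ii es ie]; apply/qmod_sesP; split.
- move=> p u v uv; apply: klin_eq => w; have [x <-] := es p w.
  exact: (congr1 (fun h : klin (kob V p) M => h x) uv).
- move=> p u; have [w wP] := @klin_extend _ _ _ _ _ (kapp i p) u (ii p).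
  by exists w; apply: klin_eq.
move=> p u; split=> [u0|[w <-]]; last first.
  apply: klin_eq => x; rewrite klin0E -[RHS](linear0 (klin_fun w)).
  by congr (klin_fun w _); apply/ie; exists x.
have [|w wP] := @desc_surj _ _ _ _ _ (kapp e p) (klin_fun u) (es p).
  move=> x /ie[y <-].
  exact: (congr1 (fun h : klin (kob U p) M => h y) u0).
by exists (w : klin _ _); apply: klin_eq.
Qed.

End HMod.

Section FinDim.
Variable k : fieldType.

Definition fdim (V : lmodType k) : Prop :=
  exists n (e : 'I_n -> V) (c : 'I_n -> {linear V -> k^o}),
    forall v, v = \sum_i c i v *: e i.

Lemma fin_dim_fdim (V : lmodType k) : fin_dim V -> fdim V.
Proof.
move=> [n [[v2r v2rL [r2v v2rK r2vK]]]].
have r2vL : linear r2v.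
  by move=> a x y; apply: (can_inj v2rK); rewrite v2rL !r2vK.
have cL i : linear (fun v => v2r v 0 i : k^o).
  by move=> a x y; rewrite v2rL !mxE.
exists n, (fun i => r2v (delta_mx 0 i)), (fun i => mklin (cL i)) => v.
rewrite -[LHS]v2rK [v2r v in LHS]row_sum_delta -[r2v]/(mklin r2vL : _ -> _) linear_sum.
by apply: eq_bigr => i _; rewrite linearZ.
Qed.

Lemma fdim_sub (U V : lmodType k) (j : {linear U -> V}) :
  injective j -> fdim V -> fdim U.
Proof.
move=> /kretraction[r rj] [n [e [c dec]]].
exists n, (fun i => r (e i)), (fun i => c i \o j) => u.
rewrite -[LHS]rj [j u in LHS]dec linear_sum; apply: eq_bigr => i _.
by rewrite linearZ.
Qed.

Lemma fdim_quot (V W : lmodType k) (p : {linear V -> W}) :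
  (forall w, exists v, p v = w) -> fdim V -> fdim W.
Proof.
move=> /ksection[s ps] [n [e [c dec]]].
exists n, (fun i => p (e i)), (fun i => c i \o s) => w.
rewrite -[LHS]ps [s w in LHS]dec linear_sum; apply: eq_bigr => i _.
by rewrite linearZ.
Qed.

Lemma kdual_sumE (V : lmodType k) n (F : 'I_n -> kdual V) (x : V) :
  (\sum_i F i : {linear V -> k^o}) x = \sum_i (F i : {linear V -> k^o}) x.
Proof. by elim/big_ind2: _ => // ? ? ? ? <- <-. Qed.

Lemma kdual_dec (V : lmodType k) n (e : 'I_n -> V) (c : 'I_n -> {linear V -> k^o}) :
  (forall v, v = \sum_i c i v *: e i) ->
  forall f : kdual V, f = \sum_i (((f : {linear V -> k^o}) (e i) : k) *: (c i : kdual V)).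
Proof.
move=> dec f; apply: linear_eq => v; rewrite kdual_sumE [in LHS](dec v) linear_sum.
by apply: eq_bigr => i _; rewrite linearZ; exact: mulrC.
Qed.

Lemma fdim_dual (V : lmodType k) : fdim V -> fdim (kdual V).
Proof.
move=> [n [e [c dec]]].
have evL i : linear (fun f : kdual V => (f : {linear V -> k^o}) (e i) : k^o) by [].
by exists n, (fun i => (c i : kdual V)), (fun i => mklin (evL i)) => f; exact: kdual_dec.
Qed.

End FinDim.

Section KLinFin.
Variables (k : fieldType) (R : kalg k) (V : lmodType k).

Lemma klin_lift (M N : lmodType R) (f : {linear M -> N}) (u : klin V N) :
  fdim V -> (forall y, exists x, f x = y) -> exists w : klin V M, forall v, f (w v) = u v.
Proof.
move=> [n [e [c dec]]] fs; have [m mP] := choice (fun i => fs (u (e i))).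
have wL : linear_for (kscale R) (fun v => \sum_i kalg_map R (c i v) *: m i).
  move=> a x y /=; rewrite scaler_sumr -big_split /=; apply: eq_bigr => i _.
  by rewrite linearP /= rmorphD rmorphM scalerDl scalerA.
exists (mklin wL) => v; rewrite /= /lin_fun linear_sum [in RHS](dec v) linear_sum.
by apply: eq_bigr => i _; rewrite linearZ /= mP klinZr.
Qed.

Lemma klin_lift_inj (M N : lmodType R) (f : {linear M -> N}) (u : klin V N) :
  injective f -> (forall v, exists x, f x = u v) -> exists w : klin V M, forall v, f (w v) = u v.
Proof.
move=> fi h; have [w wP] := choice h.
have wL : linear_for (kscale R) w.
  by move=> a x y; apply: fi; rewrite linearD linearZ !wP linearP.
by exists (mklin wL).
Qed.

End KLinFin.

Section HFunExact.
Variables (k : fieldType) (Q : lincat k) (R : kalg k).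

Definition pwfd (V : qmod (lop Q) (kself k)) : Prop := forall p : Q, fdim (kob V p).

Lemma hfun_exact V : pwfd V -> exact_functor (hfun R V).
Proof.
move=> Vfd M N L i p /rmod_sesP[ii ps ip]; apply/qmod_sesP; split.
- move=> q u v uv; apply: klin_eq => x; apply: ii.
  exact: (congr1 (fun h : klin (kob V q) N => h x) uv).
- move=> q u; have [w wP] := @klin_lift _ _ _ _ _ (p : {linear N -> L}) u (Vfd q) ps.
  by exists w; apply: klin_eq.
move=> q u; split=> [u0|[w <-]]; last first.
  by apply: klin_eq => x; apply/ip; exists ((w : klin (kob V q) M) x).
have [|w wP] := @klin_lift_inj _ _ _ _ _ (i : {linear M -> N}) u ii.
  move=> v; apply/ip.
  exact: (congr1 (fun h : klin (kob V q) L => h v) u0).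
by exists w; apply: klin_eq.
Qed.

End HFunExact.

Section TensorHom.
Variables (k : fieldType) (Q : lincat k) (R : kalg k).
Variables (V : qmod (lop Q) (kself k)).
Implicit Types (X : qmod Q R) (B : lmodType R).

Section Objects.
Variables (X : qmod Q R) (B : lmodType R).
Local Notation tsum := (tsum V X).
Local Notation tensor := (tensor V X).

Definition tpure (p : Q) (n : kob V p) (x : X p) : tensor :=
  tens_pi [:: @ptens k Q R V X p n x].

Lemma tpureDl p n n' x : tpure (n + n') x = tpure n x + tpure (p := p) n' x.
Proof.
by rewrite -[RHS]/(tens_add _ _) tens_piD; apply/tens_eqP; exact: TensAddl.
Qed.

Lemma tpureDr p n x x' : tpure n (x + x') = tpure n x + tpure (p := p) n x'.
Proof.
by rewrite -[RHS]/(tens_add _ _) tens_piD; apply/tens_eqP; exact: TensAddr.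
Qed.

Lemma tpureZr (p : Q) (n : kob V p) (x : X p) (r : R) : tpure n (r *: x) = r *: tpure n x.
Proof. by rewrite -[RHS]/(tens_scale _ _) tens_piZ. Qed.

Lemma tpureZl (p : Q) (n : kob V p) (x : X p) (c : k) :
  tpure (c *: n) x = kalg_map R c *: tpure n x.
Proof. by rewrite -tpureZr; apply/tens_eqP; exact: TensScale. Qed.

Lemma tpure_map (p q : Q) (f : lhom p q) (n : kob V q) (x : X p) :
  tpure (kmap V f n) x = tpure n (qm_map X f x).
Proof. by apply/tens_eqP; exact: TensMap. Qed.

Lemma tensor_ind (P : tensor -> Prop) :
  P 0 -> (forall p n x y, P y -> P (tpure (p := p) n x + y)) -> forall x, P x.
Proof.
move=> P0 PS; elim/tens_ind; elim=> [|[p [n x]] s IHs]; first exact: P0.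
by have := PS p n x _ IHs; rewrite -[_ + _]/(tens_add _ _) tens_piD.
Qed.

Variable a : qmor X (hmod V B).
Local Notation ev p n x := ((a p x : klin (kob V p) B) n).

Definition tsum_ev (s : tsum) : B :=
  \sum_(t <- s) ev (projT1 t) (projT2 t).1 (projT2 t).2.

Lemma tsum_ev_eqv s t : tens_eqv s t -> tsum_ev s = tsum_ev t.
Proof.
rewrite /tsum_ev; elim=> {s t} //=.
- by move=> s t u _ -> _ ->.
- by move=> s s' t t' _ IHs _ IHt; rewrite !big_cat IHs IHt.
- by move=> s t; rewrite !big_cat /= addrC.
- by move=> p n; rewrite big_seq1 big_nil /= linear0 klin0E.
- move=> p n n' x; rewrite big_seq1 big_cons big_seq1 /=.
  exact: (linearD (klin_fun (a p x))).
- by move=> p n x x'; rewrite big_seq1 big_cons big_seq1 /= linearD klinDE.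
- by move=> p c n x; rewrite !big_seq1 /= [a p (_ *: x)]linearZ klinZE -klinZr.
- move=> p q f n x; rewrite !big_seq1 /= qmor_nat hmod_mapE.
  by [].
Qed.

Definition tensor_desc (x : tensor) : B := tsum_ev (repr x).

Lemma tensor_descE s : tensor_desc (tens_pi s) = tsum_ev s.
Proof. by apply: tsum_ev_eqv; apply/tens_eqP; exact: tens_reprK. Qed.

Lemma tensor_desc_linear : linear tensor_desc.
Proof.
move=> r; elim/tens_ind=> s; elim/tens_ind=> t.
rewrite -[r *: _]/(tens_scale _ _) -[_ + tens_pi t]/(tens_add _ _) tens_piZ tens_piD.
rewrite !tensor_descE /tsum_ev big_cat /=; congr (_ + _).
rewrite /tsum_scale /tsum_map big_map scaler_sumr; apply: eq_bigr => -[p [n x]] _ /=.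
by rewrite linearZ klinZE.
Qed.

Definition tensor_adjl : {linear tensor -> B} := mklin tensor_desc_linear.

Lemma tensor_adjlE p n x : tensor_adjl (tpure n x) = ev p n x.
Proof. by rewrite /= /lin_fun tensor_descE /tsum_ev big_seq1. Qed.

End Objects.

Lemma tensor_eq X B (f g : {linear tensor V X -> B}) :
  (forall (p : Q) n (x : X p), f (tpure n x) = g (tpure (p := p) n x)) -> f = g.
Proof.
move=> fg; apply: linear_eq; apply: tensor_ind => [|p n x y IH]; first by rewrite !linear0.
by rewrite !linearD fg IH.
Qed.

Section AdjR.
Variables (X : qmod Q R) (B : lmodType R) (g : {linear tensor V X -> B}).

Lemma tensor_adjr1 (p : Q) (x : X p) :
  linear_for (kscale R) (fun n : kob V p => g (tpure n x)).
Proof. by move=> c n n'; rewrite tpureDl tpureZl linearP. Qed.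

Lemma tensor_adjr2 (p : Q) :
  linear (fun x : X p => (mklin (tensor_adjr1 x) : klin (kob V p) B)).
Proof.
move=> r x x'; apply: klin_eq => n; rewrite klinDE klinZE /= /lin_fun.
by rewrite tpureDr tpureZr linearP.
Qed.

Lemma tensor_adjr3 (p q : Q) (f : lhom p q) (x : X p) :
  mklin (@tensor_adjr2 q) (qm_map X f x) = qm_map (hmod V B) f (mklin (@tensor_adjr2 p) x).
Proof. by apply: klin_eq => n; rewrite /= /lin_fun /= /lin_fun -tpure_map. Qed.

Definition tensor_adjr : qmor X (hmod V B) :=
  @QMor k Q R X (hmod V B) (fun p => mklin (@tensor_adjr2 p)) tensor_adjr3.

Lemma tensor_adjrE (p : Q) (x : X p) n :
  (tensor_adjr p x : klin (kob V p) B) n = g (tpure n x).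
Proof. by []. Qed.

End AdjR.

Lemma tens_map_pure X Y (u : qmor X Y) p (n : kob V p) (x : X p) :
  tens_map u (tpure n x) = tpure (p := p) n (u p x).
Proof. by rewrite tens_mapE. Qed.

Definition tensor_adjunction : adjunction (tensor_functor R V) (hfun R V).
Proof.
refine (@Adjunction (QRMod Q R) (RMod R) (tensor_functor R V) (hfun R V)
  (fun X B g => tensor_adjr g) (fun X B a => tensor_adjl a) _ _ _ _).
- move=> X B g; apply: (@tensor_eq X B) => p n x; rewrite tensor_adjlE.
  exact: tensor_adjrE.
- move=> X B a; apply: qmor_eq => p x; apply: klin_eq => n.
  by rewrite tensor_adjrE tensor_adjlE.
- move=> X X' B g u; apply: qmor_eq => p x; apply: klin_eq => n.
  rewrite tensor_adjrE /=; congr (g _); exact: tens_map_pure.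
- by move=> X B B' g v; apply: qmor_eq => p x; apply: klin_eq => n.
Defined.

End TensorHom.

Section FreeModule.
Variables (k : fieldType) (R : kalg k).

(* The one-object category k: over it the tensor product of functors is the one *)
(* over k, and R (x)_k M is a free R-module. *)
Definition ptcat : lincat k.
Proof.
refine (@LinCat k unit (fun _ _ => k^o : lmodType k) (fun _ => 1 : k)
  (fun _ _ _ g f => (g : k) * f) _ _ _ _ _ _ _) => //=.
- by move=> *; exact: mulrA.
- by move=> *; exact: mul1r.
- by move=> *; exact: mulr1.
- by move=> *; exact: mulrDl.
- by move=> *; exact: mulrDr.
- by move=> p q r c g f; rewrite -[_ *: g]/(c * g) -mulrA.
- by move=> p q r c g f; rewrite -[_ *: f]/(c * f) mulrCA.
Defined.

Lemma kscale_linear (V : lmodType k) (c : k) : linear (fun x : V => c *: x).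
Proof. by move=> a x y; rewrite scalerDr !scalerA mulrC. Qed.

Definition ptmod (V : lmodType k) : qmod (lop ptcat) (kself k).
Proof.
refine (@QMod k (lop ptcat) (kself k) (fun _ => V) (fun _ _ c => mklin (@kscale_linear V c)) _ _ _ _).
- by move=> p x; rewrite /= /lin_fun scale1r.
- by move=> p q r g f x; rewrite /= /lin_fun scalerA mulrC.
- by move=> p q f g x; rewrite /= /lin_fun scalerDl.
- by move=> p q c f x; rewrite /= /lin_fun -scalerA.
Defined.

Lemma calg_linear (c : k) : linear (fun r : R^o => kalg_map R c * r : R^o).
Proof. by move=> a x y; rewrite mulrDr mulrA kalg_central -mulrA. Qed.

Definition ptreg : qmod ptcat R.
Proof.
refine (@QMod k ptcat R (fun _ => R^o : lmodType R) (fun _ _ c => mklin (@calg_linear c)) _ _ _ _).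
- by move=> p x; rewrite /= /lin_fun rmorph1 mul1r.
- by move=> p q r g f x; rewrite /= /lin_fun rmorphM mulrA.
- by move=> p q f g x; rewrite /= /lin_fun rmorphD mulrDl.
- by move=> p q c f x; rewrite /= /lin_fun -[_ *: f]/(c * f) rmorphM -mulrA.
Defined.

Variable M : lmodType R.
Definition freemod : lmodType R := tensor (ptmod (kres M)) ptreg.

Section FreeMap.
Variables (B : lmodType R) (u : klin (kres M) B).

Lemma freemap_linear (p : unit) :
  linear (fun r : R^o => ((r : R) *: u : klin (kob (ptmod (kres M)) p) B)).
Proof. by move=> a x y; rewrite scalerDl scalerA. Qed.

Lemma freemap_nat (p q : ptcat) (c : lhom p q) (r : ptreg p) :
  mklin (freemap_linear q) (qm_map ptreg c r) =
  qm_map (hmod (ptmod (kres M)) B) c (mklin (freemap_linear p) r).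
Proof.
apply: klin_eq => x; rewrite hmod_mapE /= /lin_fun.
by rewrite klinZr scalerA kalg_central.
Qed.

Definition freemap : qmor ptreg (hmod (ptmod (kres M)) B) :=
  @QMor k ptcat R ptreg (hmod (ptmod (kres M)) B) (fun p => mklin (freemap_linear p))
    freemap_nat.

End FreeMap.

Lemma freemap_eq (B : lmodType R) (a b : qmor ptreg (hmod (ptmod (kres M)) B)) :
  a tt (1 : R) = b tt (1 : R) -> a = b.
Proof.
move=> ab; apply: qmor_eq => -[] r.
have -> : r = (r : R) *: (1 : R^o) by rewrite -[RHS]/(r * 1 : R) mulr1.
by rewrite !linearZ; congr (_ *: _).
Qed.

Lemma freemod_proj : @is_projective (RMod R) freemod.
Proof.
move=> X Y e f /rmod_epiP es.
pose adj := tensor_adjunction R (ptmod (kres M)).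
have [s sP] := @ksection _ _ _ (kres_map (e : {linear X -> Y})) es.
pose u := (adjr adj f : qmor _ _) tt (1 : R) : klin (kres M) Y.
have wL : linear_for (kscale R) (fun m : kres M => (s (u m) : X)).
  move=> c x y.
  have -> : u (c *: x + y) = c *: (u x : kres Y) + (u y : kres Y) by exact: linearP.
  by rewrite linearP.
exists (adjl adj (freemap (mklin wL : klin _ _))).
rewrite -[LHS](adjrK adj) adjr_natr adjlK -[RHS](adjrK adj).
congr (adjl adj _).
apply: freemap_eq; apply: klin_eq => m.
rewrite /= /lin_fun /= /lin_fun scale1r.
exact: (sP (u m)).
Qed.

Lemma freemod_cover : exists f : @hom (RMod R) freemod M, is_epi f.
Proof.
pose adj := tensor_adjunction R (ptmod (kres M)).
exists (adjl adj (freemap (kres_id M))); apply/rmod_epiP => m.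
exists (@tpure _ _ _ (ptmod (kres M)) ptreg tt (m : kres M) (1 : R)).
by rewrite [LHS]tensor_adjlE /= /lin_fun /= /lin_fun scale1r.
Qed.

End FreeModule.

Section RModAbelian.
Variables (k : fieldType) (R : kalg k).

Definition rmod_abelian : abelian (RMod R).
Proof.
refine (@Abelian (RMod R) (fun X Y f g => (f \+ g : {linear X -> Y}))
  (fun X Y f => (\- f : {linear X -> Y})) _ _ _ _ _ _ _ _ _ _ _ _ _).
- by move=> X Y f g h; apply: linear_eq => x /=; rewrite addrA.
- by move=> X Y f g; apply: linear_eq => x /=; rewrite addrC.
- by move=> X Y f; apply: linear_eq => x /=; rewrite add0r.
- by move=> X Y f; apply: linear_eq => x /=; rewrite addNr.
- by move=> X Y Z g g' f; apply: linear_eq.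
- by move=> X Y Z g f f'; apply: linear_eq => x /=; rewrite linearD.
- move=> X Y f; exists (smod (kerpred f) : lmodType R), (smod_inj (kerpred f)).
  apply/rmod_kernelP; split; first exact: smod_injI.
  move=> y; split=> [fy|[x <-]]; last exact: (smod_prop x).
  by exists (smod_in (U := kerpred f) fy).
- move=> X Y f; exists (qtmod (impred f) : lmodType R), (qtmod_proj (impred f)).
  apply/rmod_cokernelP; split; first exact: qtmod_surj.
  by move=> y; exact: (qtmod_eq0 (impred f)).
- move=> X Y L i p im /rmod_cokernelP[ps ip]; apply/rmod_kernelP; split=> //.
  exact/rmod_monoP.
- move=> K X Y i p ep /rmod_kernelP[ii ip]; apply/rmod_cokernelP; split=> //.
  exact/rmod_epiP.
- move=> X Y; pose Z : lmodType R := ((X : lmodType R) * (Y : lmodType R))%type.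
  have i1L : linear (fun x : X => (x, 0) : Z).
    by move=> a x y; congr pair; rewrite /= scaler0 addr0.
  have i2L : linear (fun y : Y => (0, y) : Z).
    by move=> a x y; congr pair; rewrite /= scaler0 addr0.
  have p1L : linear (fun z : Z => z.1) by [].
  have p2L : linear (fun z : Z => z.2) by [].
  exists Z, (mklin i1L), (mklin i2L), (mklin p1L), (mklin p2L).
  split; apply: linear_eq => // -[x y].
  by congr pair; rewrite /= ?addr0 ?add0r.
- move=> X; have [f ef] := freemod_cover X.
  by exists (freemod X), f; split=> //; exact: freemod_proj.
- move=> X; have [f ef] := coind_embed X.
  by exists (coind X : lmodType R), f; split=> //; exact: coind_inj.
Defined.

End RModAbelian.

Section Evaluation.
Variables (k : fieldType) (Q : lincat k) (R : kalg k).

Definition evq (q : Q) : zfunctor (QRMod Q R) (RMod R) :=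
  @ZFunctor (QRMod Q R) (RMod R) (fun X => (X : qmod Q R) q)
    (fun X Y u => (u : qmor X Y) q) (fun X => erefl) (fun X Y Z g f => erefl)
    (fun X Y => erefl).

Lemma evq_exact q : exact_functor (evq q).
Proof.
by move=> X Y Z i p /qmod_sesP[ii ps ip]; apply/rmod_sesP; split; [exact: ii | exact: ps | exact: ip].
Qed.

End Evaluation.

Section Representable.
Variables (k : fieldType) (P : lincat k) (q : P).

Fact rep_map_linear (p r : P) (f : lhom p r) : linear (fun g : lhom q p => f \ol g).
Proof. by move=> a x y; rewrite lcompDr lcompZr. Qed.

Definition rep : qmod P (kself k).
Proof.
refine (@QMod k P (kself k) (fun p => lhom q p) (fun p r f => mklin (rep_map_linear f)) _ _ _ _).
- by move=> p x; rewrite /= /lin_fun lcomp1l.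
- by move=> p r s g f x; rewrite /= /lin_fun lcompA.
- by move=> p r f g x; rewrite /= /lin_fun lcompDl.
- by move=> p r c f x; rewrite /= /lin_fun lcompZl.
Defined.

End Representable.

Section YonedaRight.
Variables (k : fieldType) (Q : lincat k) (R : kalg k) (q : Q).

Definition corep : qmod (lop Q) (kself k) := @rep k (lop Q) q.

Lemma corep_kmapE (p r : Q) (f : lhom p r) (g : lhom r q) :
  kmap corep f (g : kob corep r) = (g \ol f : lhom p q).
Proof. by []. Qed.

Section AdjR.
Variables (X : qmod Q R) (M : lmodType R) (phi : {linear X q -> M}).

Lemma yon_adjr1 (p : Q) (x : X p) :
  linear_for (kscale R) (fun f : kob corep p => phi (qm_map X (f : lhom p q) x)).
Proof. by move=> c f g; rewrite qm_add qm_scale linearP. Qed.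

Lemma yon_adjr2 (p : Q) : linear (fun x : X p => (mklin (yon_adjr1 x) : klin (kob corep p) M)).
Proof.
by move=> r x y; apply: klin_eq => f; rewrite klinDE klinZE /= /lin_fun !linearP.
Qed.

Lemma yon_adjr3 (p r : Q) (f : lhom p r) (x : X p) :
  mklin (@yon_adjr2 r) (qm_map X f x) = qm_map (hmod corep M) f (mklin (@yon_adjr2 p) x).
Proof.
by apply: klin_eq => g; rewrite hmod_mapE /= /lin_fun /= /lin_fun -qm_comp.
Qed.

Definition yon_adjr : qmor X (hmod corep M) :=
  @QMor k Q R X (hmod corep M) (fun p => mklin (@yon_adjr2 p)) yon_adjr3.

End AdjR.

Definition yon_adjl (X : qmod Q R) (M : lmodType R) (a : qmor X (hmod corep M)) :
  {linear X q -> M} := klin_ev M (lid q : kob corep q) \o a q.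

Definition yon_adjunction : adjunction (evq R q) (hfun R corep).
Proof.
refine (@Adjunction (QRMod Q R) (RMod R) (evq R q) (hfun R corep)
  (fun X M phi => yon_adjr phi) (fun X M a => yon_adjl a) _ _ _ _).
- move=> X M phi; apply: linear_eq => x.
  by rewrite -[LHS]/(phi (qm_map X (lid q) x)) qm_id.
- move=> X M a; apply: qmor_eq => p x; apply: klin_eq => f.
  rewrite -[LHS]/((a q (qm_map X f x) : klin _ _) (lid q : lhom q q)) qmor_nat hmod_mapE.
  by rewrite corep_kmapE lcomp1l.
- move=> X X' M phi u; apply: qmor_eq => p x; apply: klin_eq => f.
  exact: (congr1 phi (qmor_nat u f x)).
- by move=> X M M' phi v; apply: qmor_eq => p x; apply: klin_eq => f.
Defined.

End YonedaRight.

Section HomAdjunction.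
Variables (k : fieldType) (Q : lincat k) (R : kalg k) (S : qmod Q (kself k)).
Let Sob (p : Q) : lmodType k := S p.
Hypothesis Sfd : forall p, fdim (Sob p).
Local Notation DS := (dualq S).
Local Notation dfun n := ((n : kdual (Sob _)) : {linear Sob _ -> k^o}).

Section Delta.
Variables (A : lmodType R) (p : Q).

Fact hdelta_linear (s : Sob p) (a : A) :
  linear_for (kscale R) (fun n : kob DS p => kalg_map R (dfun n s) *: a).
Proof. by move=> c n n'; rewrite rmorphD rmorphM scalerDl -scalerA. Qed.

Definition hdelta s a : klin (kob DS p) A := mklin (hdelta_linear s a).

Lemma hdeltaE s a (n : kob DS p) : hdelta s a n = kalg_map R (dfun n s) *: a.
Proof. by []. Qed.

Lemma hdelta_linear_r s : linear (hdelta s).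
Proof.
move=> r a b; apply: klin_eq => n; rewrite klinDE klinZE !hdeltaE scalerDr !scalerA.
by rewrite kalg_central.
Qed.

Lemma hdelta_linear_l a : linear_for (kscale R) (hdelta^~ a).
Proof.
move=> c s s'; apply: klin_eq => n; rewrite klinDE klinZE !hdeltaE linearP.
by rewrite rmorphD rmorphM scalerDl -scalerA.
Qed.

Lemma klin_sum n (F : 'I_n -> klin (kob DS p) A) x : (\sum_i F i) x = \sum_i F i x.
Proof. by elim/big_ind2: _ => // ? ? ? ? <- <-. Qed.

Lemma hdelta_ind (P : klin (kob DS p) A -> Prop) :
  (forall s a, P (hdelta s a)) -> P 0 -> (forall u v, P u -> P v -> P (u + v)) ->
  forall u, P u.
Proof.
move=> Pd P0 PD u; have [n [e [c dec]]] := Sfd p.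
have -> : u = \sum_i hdelta (e i) (u (c i : kdual (Sob p))).
  apply: klin_eq => m; rewrite klin_sum.
  rewrite [in LHS](kdual_dec dec m) linear_sum; apply: eq_bigr => i _.
  exact: klinZr.
by elim/big_ind: _.
Qed.

End Delta.

Section AdjR.
Variables (A : lmodType R) (X : qmod Q R) (h : qmor (hmod DS A) X).

Lemma hom_adjr1 (a : A) (p : Q) : linear_for (kscale R) (fun s : Sob p => h p (hdelta s a)).
Proof. by move=> c s s'; rewrite hdelta_linear_l linearP. Qed.

Lemma hom_adjr2 (a : A) (p q : Q) (f : lhom p q) (s : Sob p) :
  mklin (@hom_adjr1 a q) (qm_map S f s) = qm_map X f (mklin (@hom_adjr1 a p) s).
Proof.
rewrite /= /lin_fun -(qmor_nat h f (hdelta s a)); congr (h q _).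
exact: klin_eq.
Qed.

Lemma hom_adjr3 :
  linear (fun a : A => @HomQ k Q R S X (fun p => mklin (@hom_adjr1 a p)) (hom_adjr2 a)).
Proof.
by move=> r a b; apply: homq_eq => p s; rewrite /= /lin_fun hdelta_linear_r linearP.
Qed.

Definition hom_adjr : {linear A -> homq S X} := mklin hom_adjr3.

Lemma hom_adjrE a (p : Q) (s : Sob p) : hom_adjr a p s = h p (hdelta s a).
Proof. by []. Qed.

End AdjR.

Section AdjL.
Variables (A : lmodType R) (X : qmod Q R) (t : {linear A -> homq S X}).

Lemma homq_scaleE r (u : homq S X) (p : Q) (s : Sob p) : (r *: u) p s = r *: u p s.
Proof. by []. Qed.

Lemma hom_adjl_ex (p : Q) : exists h : {linear klin (kob DS p) A -> X p},
  forall s a, h (hdelta s a) = t a p s.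
Proof.
have [n [e [c dec]]] := Sfd p.
have hL : linear (fun u : klin (kob DS p) A => \sum_i t (u (c i : kdual (Sob p))) p (e i)).
  move=> r u v; rewrite scaler_sumr -big_split /=; apply: eq_bigr => i _.
  by rewrite linearP.
exists (mklin hL) => s a; rewrite /= /lin_fun [in RHS](dec s) linear_sum.
apply: eq_bigr => i _; rewrite hdeltaE linearZ homq_scaleE.
by rewrite [RHS]linearZ.
Qed.

Definition hom_adjl_app p := projT1 (cid (hom_adjl_ex p)).
Lemma hom_adjl_appE p s a : hom_adjl_app p (hdelta s a) = t a p s.
Proof. by rewrite /hom_adjl_app; case: cid. Qed.

Lemma hom_adjl_nat (p q : Q) (f : lhom p q) (u : hmod DS A p) :
  hom_adjl_app q (qm_map (hmod DS A) f u) = qm_map X f (hom_adjl_app p u).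
Proof.
elim/hdelta_ind: u => [s a||u v IHu IHv]; last 2 first.
- by rewrite !linear0.
- by rewrite !linearD IHu IHv.
have -> : qm_map (hmod DS A) f (hdelta s a) = hdelta (qm_map S f s : Sob q) a.
  by apply: klin_eq.
by rewrite !hom_adjl_appE homq_nat.
Qed.

Definition hom_adjl : qmor (hmod DS A) X := @QMor k Q R (hmod DS A) X hom_adjl_app hom_adjl_nat.

End AdjL.

Lemma hmod_dual_eq A (X : qmod Q R) (h g : qmor (hmod DS A) X) :
  (forall p (s : Sob p) a, h p (hdelta s a) = g p (hdelta s a)) -> h = g.
Proof.
move=> E; apply: qmor_eq => p; elim/hdelta_ind => [//||u v IHu IHv].
  by rewrite !linear0.
by rewrite !linearD IHu IHv.
Qed.

Definition hom_adjunction : adjunction (hfun R DS) (homq_functor R S).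
Proof.
refine (@Adjunction (RMod R) (QRMod Q R) (hfun R DS) (homq_functor R S)
  (fun A X h => hom_adjr h) (fun A X t => hom_adjl t) _ _ _ _).
- by move=> A X h; apply: hmod_dual_eq => p s a; rewrite [LHS]hom_adjl_appE.
- by move=> A X t; apply: linear_eq => a; apply: homq_eq => p s; rewrite [LHS]hom_adjl_appE.
- move=> A A' X h u; apply: linear_eq => a; apply: homq_eq => p s.
  rewrite /= !hom_adjrE /=; congr (h p _); apply: klin_eq => n.
  by rewrite /= /lin_fun linearZ.
- by move=> A X X' h v; apply: linear_eq => a; apply: homq_eq.
Defined.

End HomAdjunction.

Section YonedaLeft.
Variables (k : fieldType) (Q : lincat k) (R : kalg k) (q : Q).
Hypothesis Qfd : forall p : Q, fdim (lhom q p).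

Definition drep : qmod (lop Q) (kself k) := dualq (rep q).

Section Hom.
Variable X : qmod Q R.

Lemma homq_rep_ev_linear : linear (fun u : homq (rep q) X => u q (lid q)).
Proof. by []. Qed.
Definition homq_rep_ev : {linear homq (rep q) X -> X q} := mklin homq_rep_ev_linear.

Lemma homq_rep1 (x : X q) (p : Q) :
  linear_for (kscale R) (fun f : lhom q p => qm_map X f x).
Proof. by move=> c f g; rewrite qm_add qm_scale. Qed.

Lemma homq_rep2 (x : X q) (p r : Q) (f : lhom p r) (g : lhom q p) :
  mklin (@homq_rep1 x r) (qm_map (rep q) f g) = qm_map X f (mklin (@homq_rep1 x p) g).
Proof. by rewrite /= /lin_fun /= /lin_fun qm_comp. Qed.

Lemma homq_rep3 :
  linear (fun x : X q => @HomQ k Q R (rep q) X (fun p => mklin (@homq_rep1 x p)) (homq_rep2 x)).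
Proof. by move=> a x y; apply: homq_eq => p f; rewrite /= /lin_fun linearP. Qed.

Definition homq_rep : {linear X q -> homq (rep q) X} := mklin homq_rep3.

Lemma homq_rep_evK x : homq_rep_ev (homq_rep x) = x.
Proof. by rewrite -[LHS]/(qm_map X (lid q) x) qm_id. Qed.

Lemma homq_repK u : homq_rep (homq_rep_ev u) = u.
Proof.
apply: homq_eq => p f; rewrite -[LHS]/(qm_map X f (u q (lid q))) -homq_nat.
by congr (u p _); rewrite /= /lin_fun lcompl1.
Qed.

End Hom.

Definition yonl_adjunction : adjunction (hfun R drep) (evq R q).
Proof.
pose adj := @hom_adjunction k Q R (rep q) Qfd.
refine (@Adjunction (RMod R) (QRMod Q R) (hfun R drep) (evq R q)
  (fun A X h => (homq_rep_ev X \o adjr adj h : {linear A -> (X : qmod Q R) q}))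
  (fun A X t => adjl adj (homq_rep X \o t : {linear A -> homq (rep q) X}))
   _ _ _ _).
- move=> A X h; rewrite -[RHS](adjrK adj); congr (adjl adj _).
  by apply: linear_eq => a; exact: homq_repK.
- move=> A X t; rewrite adjlK; apply: linear_eq => a; exact: homq_rep_evK.
- by move=> A A' X h u; rewrite adjr_natl; apply: linear_eq.
- by move=> A X X' h v; rewrite adjr_natr; apply: linear_eq.
Defined.

Lemma drep_pwfd : pwfd drep.
Proof. by move=> p; apply: fdim_dual; exact: Qfd. Qed.

End YonedaLeft.

Section ProductModule.
Variables (R : pzRingType) (I : Type) (M : I -> lmodType R).

Definition prodm : Type := forall i, M i.
HB.instance Definition _ := gen_eqMixin prodm.
HB.instance Definition _ := gen_choiceMixin prodm.

Lemma prodm_eq (x y : prodm) : (forall i, x i = y i) -> x = y.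
Proof. exact: functional_extensionality_dep. Qed.

Fact prodmDA : associative (fun (x y : prodm) i => x i + y i).
Proof. by move=> x y z; apply: prodm_eq => i; rewrite addrA. Qed.
Fact prodmDC : commutative (fun (x y : prodm) i => x i + y i).
Proof. by move=> x y; apply: prodm_eq => i; rewrite addrC. Qed.
Fact prodm0D : left_id ((fun i => 0) : prodm) (fun (x y : prodm) i => x i + y i).
Proof. by move=> x; apply: prodm_eq => i; rewrite add0r. Qed.
Fact prodmND : left_inverse ((fun i => 0) : prodm) (fun (x : prodm) i => - x i)
  (fun (x y : prodm) i => x i + y i).
Proof. by move=> x; apply: prodm_eq => i; rewrite addNr. Qed.

HB.instance Definition _ := GRing.isZmodule.Build prodm prodmDA prodmDC prodm0D prodmND.

Fact prodmZA a b (x : prodm) :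
  (fun i => a *: (b *: x i)) = ((fun i => (a * b) *: x i) : prodm).
Proof. by apply: prodm_eq => i; rewrite scalerA. Qed.
Fact prodmZ1 : left_id 1 (fun a (x : prodm) => ((fun i => a *: x i) : prodm)).
Proof. by move=> x; apply: prodm_eq => i; rewrite scale1r. Qed.
Fact prodmZDr : right_distributive (fun a (x : prodm) => ((fun i => a *: x i) : prodm)) +%R.
Proof. by move=> a x y; apply: prodm_eq => i; rewrite scalerDr. Qed.
Fact prodmZDl (x : prodm) : {morph (fun a => ((fun i => a *: x i) : prodm)) : a b / a + b}.
Proof. by move=> a b; apply: prodm_eq => i; rewrite scalerDl. Qed.

HB.instance Definition _ := GRing.Zmodule_isLmodule.Build R prodm
  prodmZA prodmZ1 prodmZDr prodmZDl.

Lemma prodm_pr_linear i : linear (fun x : prodm => x i).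
Proof. by []. Qed.
Definition prodm_pr i : {linear prodm -> M i} := mklin (prodm_pr_linear i).

Lemma prodm_univ (T : lmodType R) (f : forall i, {linear T -> M i}) :
  linear (fun x => (fun i => f i x) : prodm).
Proof. by move=> a x y; apply: prodm_eq => i; rewrite linearP. Qed.

Definition prodm_lift (T : lmodType R) (f : forall i, {linear T -> M i}) : {linear T -> prodm} :=
  mklin (prodm_univ f).

End ProductModule.

Section QProduct.
Variables (k : fieldType) (Q : lincat k) (R : kalg k) (I : Type) (Z : I -> QRMod Q R).
Local Notation Zq i := (Z i : qmod Q R).

Definition qprod : qmod Q R.
Proof.
refine (@QMod k Q R (fun p => prodm (fun i => Zq i p))
  (fun p q f => prodm_lift (fun i => qm_map (Zq i) f \o prodm_pr (fun i => Zq i p) i)) _ _ _ _).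
- by move=> p x; apply: prodm_eq => i; rewrite /= /lin_fun qm_id.
- by move=> p q r g f x; apply: prodm_eq => i; rewrite /= /lin_fun qm_comp.
- by move=> p q f g x; apply: prodm_eq => i; rewrite /= /lin_fun qm_add.
- by move=> p q c f x; apply: prodm_eq => i; rewrite /= /lin_fun qm_scale.
Defined.

Definition qprod_pr i : @hom (QRMod Q R) qprod (Z i) :=
  @QMor k Q R qprod (Zq i) (fun p => prodm_pr (fun i => Zq i p) i) (fun p q f x => erefl).

Lemma qprod_product : is_product qprod_pr.
Proof.
split=> [T f|T f g fg]; last first.
  apply: qmor_eq => p x; apply: prodm_eq => i.
  exact: (homE_Q x (fg i)).
pose g (p : Q) := prodm_lift (fun i => (f i : qmor _ _) p).
have gN (p q : Q) (h : lhom p q) x :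
    g q (qm_map (T : qmod Q R) h x) = qm_map qprod h (g p x).
  by apply: prodm_eq => i; rewrite /= /lin_fun qmor_nat.
by exists (@QMor k Q R T qprod g gN) => i; exact: qmor_eq.
Qed.

Hypothesis lfin : forall p : Q, exists s : seq {classic I},
  uniq s /\ forall i : I, (i : {classic I}) \notin s -> forall x : Zq i p, x = 0.

Lemma qprod_delta_ex i : exists d : @hom (QRMod Q R) (Z i) qprod,
  qprod_pr i \oc d = idc (Z i) /\ forall j, i <> j -> qprod_pr j \oc d = zeroc _ _.
Proof.
have h j : exists f : hom (Z i) (Z j),
    (forall E : i = j, f = ecast j (hom (Z i) (Z j)) E (idc (Z i))) /\
    (i <> j -> f = zeroc _ _).
  have [E|nE] := pselect (i = j).
    exists (ecast j (hom (Z i) (Z j)) E (idc (Z i))); split=> // E'.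
    by rewrite (Prop_irrelevance E E').
  by exists (zeroc _ _); split=> // E; case: nE.
have [f fP] := dep_choice h; have [d dP] := (proj1 qprod_product) _ f.
exists d; split=> [|j ij]; rewrite dP; last exact: (fP j).2.
exact: ((fP i).1 erefl).
Qed.

Definition qprod_delta i : @hom (QRMod Q R) (Z i) qprod := projT1 (cid (qprod_delta_ex i)).

Lemma qprod_deltaE i (p : Q) (x : Zq i p) : (qprod_delta i : qmor _ _) p x i = x.
Proof.
rewrite /qprod_delta; case: cid => d [dP _] /=; exact: (homE_Q x dP).
Qed.

Lemma qprod_deltaN i j (p : Q) (x : Zq i p) :
  i <> j -> (qprod_delta i : qmor _ _) p x j = 0.
Proof.
move=> ij; rewrite /qprod_delta; case: cid => d [_ dP] /=.
exact: (homE_Q x (dP j ij)).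
Qed.

Lemma sum_support (M : zmodType) (s t : seq {classic I}) (a : I -> M) :
  uniq s -> uniq t -> (forall i : {classic I}, i \notin s -> a i = 0) ->
  (forall i : {classic I}, i \notin t -> a i = 0) ->
  \sum_(i <- s) a i = \sum_(i <- t) a i.
Proof.
move=> us ut as0 at0.
have E (u v : seq {classic I}) : (forall i : {classic I}, i \notin v -> a i = 0) ->
    \sum_(i <- u) a i = \sum_(i <- [seq x <- u | x \in v]) a i.
  move=> av; rewrite big_filter [RHS]big_mkcond; apply: eq_bigr => i _.
  by case: ifP => // /negbT/av.
rewrite (E s t) // (E t s) //; apply: perm_big; apply: uniq_perm.
- exact: filter_uniq.
- exact: filter_uniq.
by move=> i; rewrite !mem_filter andbC.
Qed.

Lemma prodm_sumE (p : Q) (s : seq {classic I}) (F : I -> qprod p) i :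
  (\sum_(j <- s) F j) i = \sum_(j <- s) F j i.
Proof. by elim/big_ind2: _ => // ? ? ? ? <- <-. Qed.

Lemma qprod_coproduct : is_coproduct qprod_delta.
Proof.
split=> [T f|T f g fg].
  have [s sP] := dep_choice lfin.
  have gL p : linear (fun x : qprod p => \sum_(i <- s p) (f i : qmor _ _) p (x i)).
    move=> a x y; rewrite scaler_sumr -big_split /=; apply: eq_bigr => i _.
    exact: (linearP ((f i : qmor _ _) p)).
  have gN (p q : Q) (h : lhom p q) x :
      mklin (gL q) (qm_map qprod h x) = qm_map (T : qmod Q R) h (mklin (gL p) x).
    rewrite /= /lin_fun linear_sum.
    under [RHS]eq_bigr do rewrite -qmor_nat.
    apply: sum_support; [exact: (sP q).1 | exact: (sP p).1 | |] => i ni.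
      by rewrite ((sP q).2 i ni (qm_map (Zq i) h (x i))) linear0.
    by rewrite ((sP p).2 i ni (x i)) !linear0.
  exists (@QMor k Q R qprod T (fun p => mklin (gL p)) gN) => i.
  apply: qmor_eq => p x; rewrite /= /lin_fun.
  have [si|ni] := boolP ((i : {classic I}) \in s p); last first.
    rewrite ((sP p).2 i ni x) !linear0 big1 // => j _; exact: linear0.
  rewrite (bigD1_seq (i : {classic I})) ?(sP p).1 //= qprod_deltaE big1 ?addr0 //.
  by move=> j /eqP ji; rewrite qprod_deltaN ?linear0 // => ij; apply: ji.
apply: qmor_eq => p x; have [s [us sP]] := lfin p.
have -> : x = \sum_(i <- s) (qprod_delta i : qmor _ _) p (x i).
  apply: prodm_eq => i; rewrite prodm_sumE.
  have [si|ni] := boolP ((i : {classic I}) \in s); last first.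
    rewrite (sP i ni (x i)) big1_seq // => j /andP[_ js].
    by rewrite qprod_deltaN // => ji; move: ni; rewrite -ji js.
  rewrite (bigD1_seq (i : {classic I})) //= qprod_deltaE big1 ?addr0 //.
  by move=> j /eqP ji; rewrite qprod_deltaN.
rewrite !linear_sum; apply: eq_bigr => i _; exact: (homE_Q (x i) (fg i)).
Qed.

End QProduct.

Section InjProj.
Variables (C D : zcat).

Lemma adj_inj (L : zfunctor C D) (G : zfunctor D C) (adj : adjunction L G) J :
  (forall X Y (f : hom X Y), is_mono f -> is_mono (zf_map L f)) ->
  is_injective J -> is_injective (G J).
Proof.
move=> Lmono pJ X Y m f mm; have [g gf] := pJ _ _ _ (adjl adj f) (Lmono _ _ _ mm).
by exists (adjr adj g); rewrite -adjr_natl gf adjlK.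
Qed.

Lemma coproduct_proj I (Z : I -> C) P (inj : forall i, hom (Z i) P) :
  is_coproduct inj -> (forall i, is_projective (Z i)) -> is_projective P.
Proof.
move=> [cex cun] pZ X Y e f ee.
have [g gP] := dep_choice (fun i => pZ i _ _ _ (f \oc inj i) ee).
have [h hP] := cex _ g; exists h; apply: cun => i.
by rewrite -compcA hP gP.
Qed.

Lemma product_inj I (Z : I -> C) P (pr : forall i, hom P (Z i)) :
  is_product pr -> (forall i, is_injective (Z i)) -> is_injective P.
Proof.
move=> [cex cun] pZ X Y e f ee.
have [g gP] := dep_choice (fun i => pZ i _ _ _ (pr i \oc f) ee).
have [h hP] := cex _ g; exists h; apply: cun => i.
by rewrite compcA hP gP.
Qed.

End InjProj.

Section QRModAbelian.
Variables (k : fieldType) (Q : lincat k) (R : kalg k).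
Hypothesis hFin : FinCond Q.

Lemma fdim_lhom (p q : Q) : fdim (lhom p q).
Proof. by case: hFin => /(_ p q)/fin_dim_fdim. Qed.

Lemma fin_neighbours (r : Q) : exists s : seq {classic Q},
  uniq s /\ forall q : Q, (q : {classic Q}) \notin s ->
    (forall f : lhom q r, f = 0) /\ (forall f : lhom r q, f = 0).
Proof.
have [_ /(_ r) fr _] := hFin.
have /finite_seqP[s sE] : finite_set ([set p : {classic Q} |
  ~ ((forall f : lhom (p : Q) r, f = 0) /\ (forall f : lhom r (p : Q), f = 0))]%classic) by [].
exists (undup s); split=> [|q]; first exact: undup_uniq.
rewrite mem_undup => qs; apply: contrapT => nq.
have : [set` s]%classic (q : {classic Q}) by rewrite -sE.
by rewrite /= => qs'; rewrite qs' in qs.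
Qed.

Lemma klin_triv (V : lmodType k) (M : lmodType R) (u : klin V M) :
  (forall v : V, v = 0) -> u = 0.
Proof. by move=> V0; apply: klin_eq => v; rewrite (V0 v) linear0. Qed.

Lemma drep_lfin (M : Q -> lmodType R) (r : Q) : exists s : seq {classic Q},
  uniq s /\ forall q : Q, (q : {classic Q}) \notin s ->
    forall x : hmod (drep q) (M q) r, x = 0.
Proof.
have [s [us sP]] := fin_neighbours r; exists s; split=> // q /sP[qr _] x.
by apply: klin_triv => n; apply: linear_eq => f; rewrite (qr f) !linear0.
Qed.

Lemma evq_epi (q : Q) X Y (f : hom X Y) : is_epi f -> is_epi (zf_map (evq R q) f).
Proof. by move=> /qmod_epiP fs; apply/rmod_epiP; exact: fs. Qed.

Lemma evq_mono (q : Q) X Y (f : hom X Y) : is_mono f -> is_mono (zf_map (evq R q) f).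
Proof. by move=> /qmod_monoP fs; apply/rmod_monoP; exact: fs. Qed.

Definition yonl q := @yonl_adjunction k Q R q (fdim_lhom q).

Lemma qmod_enough_proj (X : QRMod Q R) :
  exists (P : QRMod Q R) (p : hom P X), is_projective P /\ is_epi p.
Proof.
pose F q := freemod ((X : qmod Q R) q).
pose Z q : QRMod Q R := hfun R (drep q) (F q).
have cP := @qprod_coproduct k Q R Q Z (drep_lfin F).
have [f ef] := dep_choice (fun q => freemod_cover ((X : qmod Q R) q)).
have [g gP] := (proj1 cP) _ (fun q => adjl (yonl q) (f q)).
exists (qprod Z), g; split.
  apply: (coproduct_proj cP) => q; apply: (adj_proj (yonl q)).
    exact: evq_epi.
  exact: freemod_proj.
apply/qmod_epiP => p y; have [x fx] := (proj1 (rmod_epiP _)) (ef p) y.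
pose e := (adjr (yonl p) (idc (hfun R (drep p) (F p))) : {linear _ -> _}) x.
exists ((qprod_delta Z p : qmor _ _) p e).
rewrite -fx [LHS](homE_Q e (gP p)).
have := adjlK (yonl p) (f p); rewrite -{1}[adjl _ _]compc1 adjr_natr => E.
exact: (homE_R x E).
Qed.

Lemma qmod_enough_inj (X : QRMod Q R) :
  exists (J : QRMod Q R) (i : hom X J), is_injective J /\ is_mono i.
Proof.
pose F q : lmodType R := coind ((X : qmod Q R) q).
pose Z q : QRMod Q R := hfun R (corep q) (F q).
have cP := @qprod_product k Q R Q Z.
have [f ef] := dep_choice (fun q => coind_embed ((X : qmod Q R) q)).
have [g gP] := (proj1 cP) _ (fun q => adjr (yon_adjunction R q) (f q)).
exists (qprod Z), g; split.
  apply: (product_inj cP) => q; apply: (adj_inj (yon_adjunction R q)).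
    exact: evq_mono.
  exact: coind_inj.
apply/qmod_monoP => p x y gxy; apply: ((proj1 (rmod_monoP _)) (ef p)).
have E z : f p z = ((g : qmor _ _) p z p : klin (kob (corep p) p) (F p)) (lid p).
  rewrite -[RHS]/((((qprod_pr Z p \oc g) : qmor _ _) p z : klin (kob (corep p) p) (F p)) (lid p)).
  rewrite gP.
  by rewrite -[RHS]/((f p : {linear _ -> _}) (qm_map (X : qmod Q R) (lid p) z)) qm_id.
by rewrite !E gxy.
Qed.

Definition qmod_abelian : abelian (QRMod Q R).
Proof.
have DN (X Y : qmod Q R) (f g : qmor X Y) (p q : Q) (h : lhom p q) (x : X p) :
    (f q \+ g q) (qm_map X h x) = qm_map Y h ((f p \+ g p) x).
  by rewrite /= !qmor_nat linearD.
have NN (X Y : qmod Q R) (f : qmor X Y) (p q : Q) (h : lhom p q) (x : X p) :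
    (\- f q) (qm_map X h x) = qm_map Y h ((\- f p) x).
  by rewrite /= !qmor_nat linearN.
refine (@Abelian (QRMod Q R)
  (fun X Y f g => @QMor k Q R X Y (fun p => ((f : qmor X Y) p \+ (g : qmor X Y) p : {linear _ -> _})) (DN X Y f g))
  (fun X Y f => @QMor k Q R X Y (fun p => (\- (f : qmor X Y) p : {linear _ -> _})) (NN X Y f)) _ _ _ _ _ _ _ _ _ _ _ _ _).
- by move=> X Y f g h; apply: qmor_eq => p x /=; rewrite addrA.
- by move=> X Y f g; apply: qmor_eq => p x /=; rewrite addrC.
- by move=> X Y f; apply: qmor_eq => p x /=; rewrite add0r.
- by move=> X Y f; apply: qmor_eq => p x /=; rewrite addNr.
- by move=> X Y Z g g' f; apply: qmor_eq.
- by move=> X Y Z g f f'; apply: qmor_eq => p x /=; rewrite linearD.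
- move=> X Y f; exists (qsub (@qker_st _ _ _ X Y f)), (qsub_inj (@qker_st _ _ _ X Y f)).
  apply/qmod_kernelP; split=> [p|p y]; first exact: smod_injI.
  split=> [fy|[x <-]]; last exact: (smod_prop x).
  by exists (smod_in (U := qker f p) fy).
- move=> X Y f; exists (qquot (@qim_st _ _ _ X Y f)), (qquot_proj (@qim_st _ _ _ X Y f)).
  apply/qmod_cokernelP; split=> [p|p y]; first exact: qtmod_surj.
  exact: (qtmod_eq0 (qim f p)).
- move=> X Y L i p im /qmod_cokernelP[ps ip]; apply/qmod_kernelP; split=> //.
  exact/qmod_monoP.
- move=> K X Y i p ep /qmod_kernelP[ii ip]; apply/qmod_cokernelP; split=> //.
  exact/qmod_epiP.
- move=> X Y; pose Z (b : bool) : QRMod Q R := if b then X else Y.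
  have lf (p : Q) : exists s : seq {classic bool},
      uniq s /\ forall i : bool, (i : {classic bool}) \notin s ->
      forall x : (Z i : qmod Q R) p, x = 0.
    exists [:: (true : {classic bool}); (false : {classic bool})]; split.
      by rewrite /= inE andbT; apply/eqP.
    by case; rewrite !inE eqxx ?orbT.
  have [cex cun] := qprod_coproduct lf.
  exists (qprod Z), (qprod_delta Z true), (qprod_delta Z false),
    (qprod_pr Z true), (qprod_pr Z false).
  split; apply: qmor_eq => p x.
  + exact: qprod_deltaE.
  + exact: qprod_deltaE.
  + by apply: (@qprod_deltaN _ _ _ _ Z false true p x).
  + by apply: (@qprod_deltaN _ _ _ _ Z true false p x).
  apply: prodm_eq => -[]; rewrite -[LHS]/(_ + _).
  + rewrite [X in X + _](@qprod_deltaE _ _ _ _ Z true).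
    by rewrite [X in _ + X](@qprod_deltaN _ _ _ _ Z false true) // addr0.
  + rewrite [X in _ + X](@qprod_deltaE _ _ _ _ Z false).
    by rewrite [X in X + _](@qprod_deltaN _ _ _ _ Z true false) // add0r.
- exact: qmod_enough_proj.
- exact: qmod_enough_inj.
Defined.

End QRModAbelian.

Section KLinPerp.
Variables (k : fieldType) (R : kalg k).
Local Notation aM := (rmod_abelian R).

Lemma klin_rperp (V : lmodType k) (X M : RMod R) :
  fdim V -> Ext1_zero X M -> @Ext1_zero (RMod R) X (klin V M).
Proof.
move=> [n [e [c dec]]] XM; apply/(Ext1_zero_retrP aM) => E i p S.
have [r rP] := dep_choice (fun j => Ext1_zero_extend aM
  (klin_ev M (e j) : @hom (RMod R) (klin V M : lmodType R) M) XM S).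
have r1 y : linear_for (kscale R) (fun v => \sum_j kalg_map R (c j v) *: (r j : {linear _ -> _}) y).
  move=> a u v; rewrite /= scaler_sumr -big_split /=; apply: eq_bigr => j _.
  by rewrite linearP rmorphD rmorphM scalerDl scalerA.
have r2 : linear (fun y => (mklin (r1 y) : klin V M)).
  move=> a x y; apply: klin_eq => v; rewrite klinDE klinZE /= /lin_fun.
  rewrite scaler_sumr -big_split /=; apply: eq_bigr => j _.
  by rewrite linearP scalerDr !scalerA kalg_central.
exists (mklin r2); apply: linear_eq => u; apply: klin_eq => v.
rewrite /= /lin_fun /= /lin_fun -[RHS]/(u v) [in RHS](dec v) linear_sum.
apply: eq_bigr => j _; rewrite klinZr; congr (_ *: _).
exact: (homE_R u (rP j)).
Qed.

Lemma klin_lperp (V : lmodType k) (X M : RMod R) :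
  fdim V -> Ext1_zero M X -> @Ext1_zero (RMod R) (klin V M) X.
Proof.
move=> [n [e [c dec]]] XM; apply/(Ext1_zero_sectP aM) => E i p S.
have i1 j m : linear_for (kscale R) (fun v => kalg_map R (c j v) *: (m : M)).
  by move=> a u v; rewrite linearP rmorphD rmorphM scalerDl -scalerA.
have i2 j : linear (fun m => (mklin (i1 j m) : klin V M)).
  move=> a x y; apply: klin_eq => v; rewrite klinDE klinZE /= /lin_fun.
  by rewrite scalerDr !scalerA kalg_central.
have [s sP] := dep_choice (fun j => Ext1_zero_lift aM
  (mklin (i2 j) : @hom (RMod R) M (klin V M : lmodType R)) XM S).
have sL : linear (fun u : klin V M => \sum_j (s j : {linear _ -> _}) (u (e j))).
  move=> a x y; rewrite scaler_sumr -big_split /=; apply: eq_bigr => j _.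
  by rewrite linearP.
exists (mklin sL); apply: linear_eq => u; apply: klin_eq => v.
rewrite /= /lin_fun linear_sum.
have sumE (F : 'I_n -> klin V M) : (\sum_j F j) v = \sum_j F j v.
  by elim/big_ind2: _ => // ? ? ? ? <- <-.
rewrite sumE [in RHS](dec v) -[RHS]/(u _) linear_sum; apply: eq_bigr => j _.
rewrite klinZr.
exact: (congr1 (fun w : klin V M => w v) (homE_R (u (e j)) (sP j))).
Qed.

End KLinPerp.

(** * Simple functors and radical filtrations *)

Section RadicalPowers.
Variables (k : fieldType) (Q : lincat k).

Lemma lrad_pow_scale n (p q : Q) c (f : lhom p q) : lrad_pow n f -> lrad_pow n (c *: f).
Proof.
elim=> {n p q f} [p q f|n p q|n p q f g _ IHf _ IHg|n p q r g f gr fr IHf].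
- exact: LRadPow0.
- by rewrite scaler0; exact: LRadPowZero.
- by rewrite scalerDr; exact: LRadPowAdd.
- by rewrite -lcompZr; exact: LRadPowComp.
Qed.

Lemma lrad_pow_compl n (p q r : Q) (h : lhom q r) (f : lhom p q) :
  lrad_pow n f -> lrad_pow n (h \ol f).
Proof.
move=> fn; elim: fn r h => {n p q f} [p q f|n p q|n p q f g _ IHf _ IHg|n p q r g f gr fr IHf] s h.
- exact: LRadPow0.
- by rewrite lcompl0; exact: LRadPowZero.
- by rewrite lcompDr; exact: LRadPowAdd.
- by rewrite lcompA; apply: LRadPowComp => //; exact: lrad_compl.
Qed.

Lemma lrad_pow_compr n (p q r : Q) (f : lhom q r) (h : lhom p q) :
  lrad_pow n f -> lrad_pow n (f \ol h).
Proof.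
move=> fn; elim: fn p h => {n q r f} [p q f|n p q|n p q f g _ IHf _ IHg|n p q r g f gr fr IHf] s h.
- exact: LRadPow0.
- by rewrite lcomp0l; exact: LRadPowZero.
- by rewrite lcompDl; exact: LRadPowAdd.
- by rewrite -lcompA; exact: LRadPowComp.
Qed.

Lemma lrad_pow_rcomp n (p q r : Q) (f : lhom q r) (h : lhom p q) :
  lrad_pow n f -> lrad h -> lrad_pow n.+1 (f \ol h).
Proof.
move=> fn hr; elim: fn p h hr => {n q r f} [p q f|n p q|n p q f g _ IHf _ IHg|n p q r g f gr fr IHf] s h hr.
- by rewrite -[f \ol h]lcompl1; apply: LRadPowComp; [exact: lrad_compl | exact: LRadPow0].
- by rewrite lcomp0l; exact: LRadPowZero.
- by rewrite lcompDl; apply: LRadPowAdd; [exact: IHf | exact: IHg].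
- by rewrite -lcompA; apply: LRadPowComp => //; exact: IHf.
Qed.

End RadicalPowers.

Section Simples.
Variables (k : fieldType) (Q : lincat k).
Hypotheses (hFin : FinCond Q) (hRad : RadCond Q).

Lemma lquot_pi_linear (p q : Q) : linear (@lquot_pi k Q p q).
Proof. by move=> a x y; rewrite lquot_piD; congr (_ + _); rewrite -lquot_piZ. Qed.

Lemma lquot_pi_scale (p q : Q) c (f : lhom p q) : lquot_pi (c *: f) = c *: lquot_pi f.
Proof. exact: esym (lquot_piZ c f). Qed.

Lemma lquot_pi0 (p q : Q) (f : lhom p q) : lquot_pi f = 0 <-> lrad f.
Proof.
have -> : (0 : lquot p q) = lquot_pi (0 : lhom p q).
  by rewrite -[RHS]/(mklin (@lquot_pi_linear p q) 0) linear0.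
by rewrite lquot_eqP subr0.
Qed.

Lemma lquot_fdim (p q : Q) : fdim (lquot p q).
Proof.
apply: (@fdim_quot _ _ _ (mklin (@lquot_pi_linear p q))); last exact: fdim_lhom.
by move=> w; exists (repr w); exact: lquot_reprK.
Qed.

Lemma end_dec (q : Q) (f : lhom q q) : exists c : k, lrad (f - c *: lid q).
Proof.
have [/(_ q)[_ [g gK Kg]] _] := hRad.
by exists (g (lquot_pi f)); apply/lquot_eqP; rewrite Kg.
Qed.

Lemma lquot_triv (p q : Q) (x : lquot q p) : p <> q -> x = 0.
Proof.
move=> pq; rewrite -(lquot_reprK x); apply/lquot_pi0.
by apply: hRad.2 => qp; apply: pq.
Qed.

Definition dsimple (q : Q) : qmod (lop Q) (kself k) := dualq (simpleq q).

Lemma dsimple_pwfd q : pwfd (dsimple q).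
Proof. by move=> p; apply: fdim_dual; exact: lquot_fdim. Qed.

Lemma eps_ex (q : Q) : exists e : {linear lquot q q -> k^o}, e (lquot_pi (lid q)) = 1 :> k.
Proof.
have [/(_ q)[_ [g gK Kg]] _] := hRad.
have gL : linear (g : lquot q q -> k^o).
  move=> a x y; apply: (can_inj gK).
  by rewrite Kg -{1}(Kg x) -{1}(Kg y) [in RHS]scalerDl -scalerA [RHS]lquot_pi_linear.
exists (mklin gL); rewrite /= /lin_fun.
by rewrite -[lid q]scale1r gK.
Qed.

Definition eps (q : Q) : kob (dsimple q) q := projT1 (cid (eps_ex q)).

Lemma epsE q : (eps q : {linear lquot q q -> k^o}) (lquot_pi (lid q)) = 1 :> k.
Proof. by rewrite /eps; case: cid. Qed.

(* The projection of the right module Q(-, q) onto its top D S<q>. *)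
Lemma sigma_linear (q p : Q) :
  linear (fun f : lhom p q => kmap (dsimple q) f (eps q)).
Proof.
move=> a f g; rewrite -[X in X = _]/(qm_map (dsimple q) (a *: f + g : @lhom k (lop Q) q p) (eps q)).
by rewrite (@qm_add _ _ _ (dsimple q) q p) (@qm_scale _ _ _ (dsimple q) q p).
Qed.

Lemma sigma_nat (q : Q) (p r : lop Q) (f : lhom p r) (g : corep q p) :
  mklin (@sigma_linear q r) (qm_map (corep q) f g) =
  qm_map (dsimple q) f (mklin (@sigma_linear q p) g).
Proof. exact: (@qm_comp _ _ _ (dsimple q) q p r f g). Qed.

Definition sigma (q : Q) : @hom (QRMod (lop Q) (kself k)) (corep q) (dsimple q) :=
  @QMor k (lop Q) (kself k) (corep q) (dsimple q) (fun p => mklin (@sigma_linear q p))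
    (@sigma_nat q).

Lemma sigmaE q (p : Q) (f : lhom p q) (g : lhom q p) :
  ((sigma q : qmor _ _) p f : {linear lquot q p -> k^o}) (lquot_pi g) =
  (eps q : {linear lquot q q -> k^o}) (lquot_pi (f \ol g)).
Proof. by rewrite -lquot_mapE. Qed.

Lemma sigma_ker (q p : Q) (f : lhom p q) : (sigma q : qmor _ _) p f = 0 <-> lrad f.
Proof.
have [pq|pq] := pselect (p = q); last first.
  split=> _; first exact: hRad.2.
  by apply: linear_eq => s; rewrite (lquot_triv s pq) !linear0.
subst p; split=> [s0|fr].
  have := congr1 (fun n : kdual (lquot q q) => (n : {linear _ -> k^o}) (lquot_pi (lid q))) s0.
  rewrite sigmaE lcompl1 /=; have [c fc] := end_dec f.
  have -> : lquot_pi f = c *: lquot_pi (lid q).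
    by rewrite -lquot_pi_scale; apply/lquot_eqP.
  rewrite linearZ epsE => c0; have {}c0 : c * 1 = 0 by [].
  by move: fc; rewrite -[c]mulr1 c0 scale0r subr0.
apply: linear_eq => s; rewrite -(lquot_reprK s) sigmaE.
have [c sc] := end_dec (repr s).
have -> : lquot_pi (f \ol repr s) = lquot_pi (c *: f).
  apply/lquot_eqP; have -> : f \ol repr s - c *: f = f \ol (repr s - c *: lid q).
    by rewrite lcompBr lcompZr lcompl1.
  exact: lrad_compl.
rewrite (_ : lquot_pi _ = 0) ?linear0 //.
by apply/lquot_pi0; exact: lradZ.
Qed.

Lemma sigma_surj (q p : Q) n : exists f, (sigma q : qmor _ _) p f = n.
Proof.
have [pq|pq] := pselect (p = q); last first.
  exists 0; rewrite linear0; apply: linear_eq => s.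
  by rewrite (lquot_triv s pq) !linear0.
subst p; exists ((n : {linear lquot q q -> k^o}) (lquot_pi (lid q)) *: lid q).
apply: linear_eq => s; rewrite -(lquot_reprK s) sigmaE lcompZl lcomp1l.
have [c sc] := end_dec (repr s).
have sE : lquot_pi (repr s) = c *: lquot_pi (lid q).
  by rewrite -lquot_pi_scale; apply/lquot_eqP.
rewrite lquot_pi_scale sE !linearZ epsE.
by rewrite -[LHS]/(_ * (c * 1)) mulr1 mulrC.
Qed.

End Simples.

Section SimpleMaps.
Variables (k : fieldType) (Q : lincat k) (R : kalg k).
Hypotheses (hFin : FinCond Q) (hRad : RadCond Q).
Local Notation sigma := (sigma hRad).
Local Notation eps := (eps hRad).
Local Notation aX := (qmod_abelian R hFin).
Implicit Types (X Y Z : QRMod Q R) (M : lmodType R).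

Definition simple_mod (q : Q) M : QRMod Q R := hmod (dsimple q) M.

Lemma corep_pwfd (q : Q) : pwfd (corep q).
Proof. by move=> p; exact: (fdim_lhom hFin p q). Qed.

Lemma qmod_kernel_ses (P : lincat k) (A : kalg k) (U V : QRMod P A) (e : hom U V) :
  (forall p v, exists u, (e : qmor U V) p u = v) ->
  @short_exact (QRMod P A) (qsub (@qker_st _ _ _ U V e)) U V (qsub_inj (@qker_st _ _ _ U V e)) e.
Proof.
move=> es; apply/qmod_sesP; split=> [p||p y]; [exact: smod_injI|exact: es|].
split=> [ey|[x <-]]; last exact: (smod_prop x).
by exists (smod_in (U := qker e p) ey).
Qed.

Lemma qmod_cokernel_ses (P : lincat k) (A : kalg k) (U V : QRMod P A) (e : hom U V) :
  (forall p, injective ((e : qmor U V) p)) ->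
  @short_exact (QRMod P A) U V (qquot (@qim_st _ _ _ U V e)) e (qquot_proj (@qim_st _ _ _ U V e)).
Proof.
move=> es; apply/qmod_sesP; split=> [|p|p y]; [exact: es|exact: qtmod_surj|].
exact: (qtmod_eq0 (qim e p)).
Qed.

Lemma ses_pwfd (U V W : QRMod (lop Q) (kself k)) (i : hom U V) (e : hom V W) :
  short_exact i e -> pwfd V -> pwfd U /\ pwfd W.
Proof.
move=> /qmod_sesP[ii es _] Vfd; split=> p.
  exact: (@fdim_sub _ _ _ (kapp i p) (ii p)).
exact: (@fdim_quot _ _ _ (kapp e p) (es p)).
Qed.

Definition rad_mod (q : Q) : QRMod (lop Q) (kself k) :=
  qsub (@qker_st _ _ _ (corep q : QRMod (lop Q) (kself k)) (dsimple q) (sigma q)).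
Definition rad_inj (q : Q) : hom (rad_mod q) (corep q : QRMod (lop Q) (kself k)) :=
  qsub_inj (@qker_st _ _ _ (corep q : QRMod (lop Q) (kself k)) (dsimple q) (sigma q)).

Lemma sigma_ses q : short_exact (rad_inj q) (sigma q).
Proof. by apply: qmod_kernel_ses => p v; exact: sigma_surj. Qed.

Lemma simple_ses q M :
  @short_exact (QRMod Q R) (simple_mod q M) (hmod (corep q) M) (hmod (rad_mod q) M)
    (hpre M (sigma q)) (hpre M (rad_inj q)).
Proof. exact (hpre_ses M (sigma_ses q)). Qed.

(* Maps X -> S_q(M) correspond to maps X(q) -> M that vanish on rad X(q). *)
Definition simple_hom X q M (a : hom X (simple_mod q M)) : {linear (X : qmod Q R) q -> M} :=
  klin_ev M (eps q) \o (a : qmor _ _) q.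

Lemma simple_homE X q M (a : hom X (simple_mod q M)) x :
  simple_hom a x = ((a : qmor _ _) q x : klin (kob (dsimple q) q) M) (eps q).
Proof. by []. Qed.

Lemma simple_hom_rad X q M (a : hom X (simple_mod q M)) (r : Q) (f : lhom r q) x :
  lrad f -> simple_hom a (qm_map (X : qmod Q R) f x) = 0.
Proof.
move=> fr; rewrite simple_homE qmor_nat hmod_mapE.
by rewrite ((sigma_ker hRad f).2 fr : kmap (dsimple q) f (eps q) = 0) linear0.
Qed.

Lemma simple_hom_ex X q M (phi : {linear (X : qmod Q R) q -> M}) :
  (forall (r : Q) (f : lhom r q) x, lrad f -> phi (qm_map (X : qmod Q R) f x) = 0) ->
  exists a : hom X (simple_mod q M), forall x, simple_hom a x = phi x.
Proof.
move=> phir; pose b : hom X (hmod (corep q) M) := yon_adjr phi.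
have [|a ab] := ker_lift (t := b) (proj1 (simple_ses q M)).
  apply: qmor_eq => p x; apply: klin_eq => f.
  rewrite -[LHS]/(phi (qm_map (X : qmod Q R) (rad_inj q p f : lhom p q) x)).
  by apply: phir; apply/(sigma_ker hRad); exact: (smod_prop f).
exists a => x; rewrite simple_homE.
have -> : eps q = (sigma q : qmor _ _) q (lid q : lhom q q).
  symmetry; exact: (@qm_id _ _ _ (dsimple q)).
have := homE_Q x ab => /(congr1 (fun u : klin (kob (corep q) q) M => u (lid q : lhom q q))).
move=> /= E; rewrite [LHS]E -[LHS]/(phi (qm_map (X : qmod Q R) (lid q) x)) qm_id.
by [].
Qed.

(* Maps S_q(M) -> X correspond to maps from M to the socle of X at q. *)
Definition simple_adj q := @hom_adjunction k Q R (simpleq q) (fun p => lquot_fdim hFin q p).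

Lemma simple_coh_linear X q M (b : hom (simple_mod q M) X) :
  linear (fun m : M => (adjr (simple_adj q) b : {linear M -> homq (simpleq q) X}) m q (lquot_pi (lid q))).
Proof. by move=> a x y; rewrite linearP. Qed.

Definition simple_coh X q M (b : hom (simple_mod q M) X) : {linear M -> (X : qmod Q R) q} :=
  mklin (simple_coh_linear b).

Lemma simple_coh_rad X q M (b : hom (simple_mod q M) X) (r : Q) (f : lhom q r) m :
  lrad f -> qm_map (X : qmod Q R) f (simple_coh b m) = 0.
Proof.
move=> fr.
pose u : homq (simpleq q) X := (adjr (simple_adj q) b : {linear M -> homq (simpleq q) X}) m.
rewrite -[LHS]/(qm_map (X : qmod Q R) f (u q (lquot_pi (lid q)))) -homq_nat.
rewrite (_ : qm_map _ _ _ = 0) ?linear0 //.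
by rewrite -[LHS]/(lquot_map f (lquot_pi (lid q))) lquot_mapE lcompl1; apply/lquot_pi0.
Qed.

Lemma simple_coh_nat X Y q M (b : hom (simple_mod q M) X) (v : hom X Y) m :
  simple_coh (v \oc b) m = (v : qmor _ _) q (simple_coh b m).
Proof. by []. Qed.

Lemma simple_coh_ex X q M (psi : {linear M -> (X : qmod Q R) q}) :
  (forall (r : Q) (f : lhom q r) m, lrad f -> qm_map (X : qmod Q R) f (psi m) = 0) ->
  exists b : hom (simple_mod q M) X, forall m, simple_coh b m = psi m.
Proof.
move=> psir.
have wd (p : Q) (f g : lhom q p) m : lquot_pi f = lquot_pi g ->
    qm_map (X : qmod Q R) f (psi m) = qm_map (X : qmod Q R) g (psi m).
  move=> /lquot_eqP fg; rewrite -[f](subrK g) qm_add psir //.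
  by rewrite add0r.
have t1 m (p : Q) : linear_for (kscale R)
    (fun s : lquot q p => qm_map (X : qmod Q R) (repr s) (psi m)).
  move=> c s s'; rewrite -[RHS]/(kalg_map R c *: _ + _) -qm_scale -qm_add; apply: wd.
  by rewrite lquot_piD lquot_pi_scale !lquot_reprK.
have t2 m (p r : Q) (f : lhom p r) (s : simpleq q p) :
    mklin (t1 m r) (qm_map (simpleq q) f s) = qm_map (X : qmod Q R) f (mklin (t1 m p) s).
  rewrite /= /lin_fun -qm_comp; apply: wd.
  by rewrite lquot_reprK -lquot_mapE lquot_reprK.
have t3 : linear (fun m => @HomQ k Q R (simpleq q) X (fun p => mklin (t1 m p)) (t2 m)).
  by move=> a x y; apply: homq_eq => p s; rewrite /= /lin_fun !linearP.
pose t : @hom (RMod R) M (homq (simpleq q) X : lmodType R) := mklin t3.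
exists (adjl (simple_adj q) t) => m.
transitivity ((t : {linear M -> homq (simpleq q) X}) m q (lquot_pi (lid q))).
  exact: (congr1 (fun u : {linear M -> homq (simpleq q) X} => u m q (lquot_pi (lid q)))
    (adjlK (simple_adj q) t)).
rewrite /= /lin_fun /= /lin_fun.
rewrite (wd q _ (lid q)) ?qm_id //; exact: lquot_reprK.
Qed.

Definition rad_killed X : Prop :=
  forall (p q : Q) (f : lhom p q) x, lrad f -> qm_map (X : qmod Q R) f x = 0.

Lemma rad_killed_nat X Y (phi : forall p, {linear (X : qmod Q R) p -> (Y : qmod Q R) p}) :
  (forall (p q : Q) (f : lhom p q) x, lrad f -> phi q (qm_map (X : qmod Q R) f x) = 0) ->
  (forall (p q : Q) (f : lhom p q) x, lrad f -> qm_map (Y : qmod Q R) f (phi p x) = 0) ->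
  forall (p q : Q) (f : lhom p q) x,
    phi q (qm_map (X : qmod Q R) f x) = qm_map (Y : qmod Q R) f (phi p x).
Proof.
move=> phiX phiY p q f x.
have [pq|pq] := pselect (p = q); last first.
  by rewrite phiX ?phiY //; exact: hRad.2.
subst p; have [c fc] := end_dec hRad f.
have E (W : qmod Q R) (w : W q) :
    qm_map W f w = qm_map W (f - c *: lid q) w + kalg_map R c *: w.
  have {1}-> : f = f - c *: lid q + c *: lid q by rewrite subrK.
  by rewrite [LHS]qm_add qm_scale qm_id.
by rewrite !E linearD [phi q (_ *: _)]linearZ phiX // phiY.
Qed.

Lemma rad_killed_rperp Y Z :
  (forall q, Ext1_zero Y (simple_mod q ((Z : qmod Q R) q))) -> rad_killed Z ->
  Ext1_zero Y Z.
Proof.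
move=> YZ Zr; apply/(Ext1_zero_retrP aX) => E j e S.
have h q : exists phi : {linear (E : qmod Q R) q -> (Z : qmod Q R) q},
    (forall z, phi ((j : qmor _ _) q z) = z) /\
    forall (r : Q) (f : lhom r q) x, lrad f -> phi (qm_map (E : qmod Q R) f x) = 0.
  have [|a aE] := @simple_hom_ex Z q ((Z : qmod Q R) q) idfun.
    by move=> r f x fr; exact: Zr.
  have [b bj] := Ext1_zero_extend aX a (YZ q) S.
  exists (simple_hom b); split=> [z|r f x]; last exact: simple_hom_rad.
  by rewrite -[RHS]aE -bj.
have [phi phiP] := dep_choice h.
have phiN := @rad_killed_nat E Z phi
  (fun p q f x => (phiP q).2 p f x) (fun p q f x => @Zr p q f _).
exists (@QMor k Q R E Z phi phiN); apply: qmor_eq => q z; exact: (phiP q).1.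
Qed.

Lemma rad_killed_lperp Y Z :
  (forall q, Ext1_zero (simple_mod q ((Z : qmod Q R) q)) Y) -> rad_killed Z ->
  Ext1_zero Z Y.
Proof.
move=> YZ Zr; apply/(Ext1_zero_sectP aX) => E j e S.
have h q : exists psi : {linear (Z : qmod Q R) q -> (E : qmod Q R) q},
    (forall z, (e : qmor _ _) q (psi z) = z) /\
    forall (r : Q) (f : lhom q r) x, lrad f -> qm_map (E : qmod Q R) f (psi x) = 0.
  have [|a aE] := @simple_coh_ex Z q ((Z : qmod Q R) q) idfun.
    by move=> r f x fr; exact: Zr.
  have [b eb] := Ext1_zero_lift aX a (YZ q) S.
  exists (simple_coh b); split=> [z|r f x]; last exact: simple_coh_rad.
  by rewrite -simple_coh_nat eb aE.
have [psi psiP] := dep_choice h.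
have psiN := @rad_killed_nat Z E psi.
have {}psiN : forall (p q : Q) (f : lhom p q) x,
    psi q (qm_map (Z : qmod Q R) f x) = qm_map (E : qmod Q R) f (psi p x).
  apply: psiN => p q f x fr; last exact: (psiP p).2.
  by rewrite Zr // linear0.
exists (@QMor k Q R Z E psi psiN); apply: qmor_eq => q z; exact: (psiP q).1.
Qed.

(* Filter V by its socle V' = {v | v rad = 0}: V / V' is killed by one power of *)
(* the radical less, and hmod V' M is killed by the radical. *)
Section Filtration.
Variable V : QRMod (lop Q) (kself k).
Local Notation Vk := (kob (V : qmod (lop Q) (kself k))).
Local Notation Vm := (kmap (V : qmod (lop Q) (kself k))).

Definition soc_pred (p : lop Q) : subpred ((V : qmod (lop Q) (kself k)) p).
Proof.
refine (@SubPred _ _ (fun v => forall (r : Q) (f : lhom r (p : Q)), lrad f -> Vm f v = 0) _ _).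
- by move=> r f _; rewrite linear0.
- by move=> a x y xs ys r f fr; rewrite linearP xs // ys // scaler0 addr0.
Defined.

Lemma soc_st (p q : lop Q) (f : lhom p q) v : soc_pred p v ->
  soc_pred q (qm_map (V : qmod (lop Q) (kself k)) f v).
Proof.
move=> vs r g gr; rewrite -[LHS](@qm_comp _ _ _ (V : qmod (lop Q) (kself k)) p q r g f v).
by apply: vs; exact: lrad_compl.
Qed.

Definition soc : QRMod (lop Q) (kself k) := qsub soc_st.
Definition soc_quot : QRMod (lop Q) (kself k) := qquot soc_st.

Lemma soc_ses :
  @short_exact (QRMod (lop Q) (kself k)) soc V soc_quot (qsub_inj soc_st) (qquot_proj soc_st).
Proof.
apply/qmod_sesP; split=> [p|p z|p y]; [exact: smod_injI | exact: qtmod_surj |].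
split=> [/(qtmod_eq0 (soc_pred p)) ys|[x <-]].
  by exists (smod_in ys).
by apply/(qtmod_eq0 (soc_pred p)); exact: (smod_prop x).
Qed.

End Filtration.

Lemma filtration n : forall V : QRMod (lop Q) (kself k), pwfd V ->
  (forall (p q : Q) (f : lhom p q) v, lrad_pow n f ->
     kmap (V : qmod (lop Q) (kself k)) f v = 0) ->
  forall M (T : QRMod Q R -> Prop),
  (forall Z, rad_killed Z -> (forall p, exists2 W : lmodType k, fdim W &
      (Z : qmod Q R) p = klin W M :> lmodType R) -> T Z) ->
  (forall X Y Z (i : hom X Y) (p : hom Y Z), short_exact i p -> T X -> T Z -> T Y) ->
  T (hmod V M).
Proof.
elim: n => [|n IHn] V Vfd Vr M T Tbase Text.
  apply: Tbase => [p q f x _|p]; last by exists (kob (V : qmod _ _) p); [exact: Vfd|].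
  by apply: klin_eq => v; rewrite hmod_mapE Vr ?linear0 //; exact: LRadPow0.
have S := soc_ses V; have [sfd qfd] := ses_pwfd S Vfd.
apply: (Text _ _ _ _ _ (hpre_ses M S)).
  apply: IHn => // p q f v fn; have [w <-] := qtmod_surj v.
  rewrite -[LHS](qmor_nat (qquot_proj (@soc_st V))); apply/(qtmod_eq0 (soc_pred V p)).
  move=> r g gr; rewrite -[LHS](@qm_comp _ _ _ (V : qmod (lop Q) (kself k)) q p r g f w).
  by apply: Vr; exact: lrad_pow_rcomp.
apply: Tbase => [p q f u fr|p]; last by exists (kob (soc V : qmod _ _) p); [exact: sfd|].
apply: klin_eq => v; rewrite hmod_mapE klin0E.
rewrite (_ : kmap _ _ _ = 0) ?linear0 //; apply: smod_injI.
rewrite linear0; transitivity (kmap (V : qmod (lop Q) (kself k)) f (smod_inj _ v)).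
  exact: (qsub_mapE (@soc_st V) (f : @lhom k (lop Q) q p) v).
exact: (smod_prop v p f fr).
Qed.

End SimpleMaps.

Section CotorsionDual.
Variables (C : zcat) (aC : abelian C).
Implicit Types X Y Z K L P T : C.

Lemma closed_ker_lperp_inj (D : obclass C) :
  (forall J : C, is_injective J -> D J) -> closed_coker_mono D ->
  closed_ker_epi (lperp D).
Proof.
move=> Dinj Dcok K X Y i p ep kp DX DY d Dd.
have [J [e [iJ me]]] := enough_inj aC d; have [L [q S]] := mono_ses aC me.
have S' := epi_kernel_ses aC ep kp.
apply: (Ext1_zeroI_lift aC S); first exact: inj_Ext1_zero.
have DL : D L by apply: Dcok me (proj2 S) Dd _; exact: Dinj.
move=> f; have [g gi] := Ext1_zero_extend aC f (DY _ DL) S'.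
have [h qh] := Ext1_zero_lift aC g (DX _ Dd) S.
by exists (h \oc i); rewrite compcA qh.
Qed.

Lemma closed_coker_rperp_class (S : obclass C) :
  (forall Z, S Z -> exists T G (i : hom T G) (p : hom G Z), [/\ short_exact i p,
     forall Y, rperp S Y -> Ext1_zero T Y
     & forall X Y L (j : hom X Y) (q : hom Y L), short_exact j q ->
         rperp S X -> rperp S Y -> Ext1_zero G L]) ->
  closed_coker_mono (rperp S).
Proof.
move=> H X Y L j q mj cq SX SY Z SZ; have S' := mono_cokernel_ses aC mj cq.
have [T [G [i [p [S0 TY GL]]]]] := H Z SZ.
apply: (Ext1_zeroI_extend aC S0); first exact: GL S' SX SY.
move=> f; have [g gj] := Ext1_zero_lift aC f (TY _ SX) S'.
have [h ph] := Ext1_zero_extend aC g (SY _ SZ) S0.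
by exists (q \oc h); rewrite -compcA ph.
Qed.

Lemma rperp_lperp_section (S : obclass C) X T (p : hom T X) :
  is_epi p -> rperp S T -> lperp (rperp S) X ->
  (forall Z (f : hom Z X), S Z -> exists g : hom Z T, p \oc g = f) ->
  exists s : hom X T, p \oc s = idc X.
Proof.
move=> ep ST SX lif; have [K [i S']] := epi_ses aC ep.
have SK : rperp S K.
  by move=> Z SZ; apply: (Ext1_zeroI_lift aC S' (ST _ SZ)) => f; exact: lif.
exact: (Ext1_zero_lift aC (idc X) (SX _ SK) S').
Qed.

Lemma lperp_rperp_lperp (S : obclass C) X : lperp (rperp (lperp S)) X -> lperp S X.
Proof. by move=> h Z SZ; apply: h => Y; exact. Qed.

Lemma rperp_lperp_rperp (S : obclass C) X : rperp (lperp (rperp S)) X -> rperp S X.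
Proof. by move=> h Z SZ; apply: h => Y; exact. Qed.

End CotorsionDual.

Section AdjunctionIso.
Variables (C D : zcat) (L : zfunctor C D) (G G' : zfunctor D C) (adj : adjunction L G).
Variables (a : forall Y : D, hom (G Y) (G' Y)) (b : forall Y : D, hom (G' Y) (G Y)).
Hypotheses (ab : forall Y, a Y \oc b Y = idc (G' Y)) (ba : forall Y, b Y \oc a Y = idc (G Y)).
Hypothesis anat : forall (Y Y' : D) (v : hom Y Y'), a Y' \oc zf_map G v = zf_map G' v \oc a Y.

Definition adj_iso_right : adjunction L G'.
Proof.
refine (@Adjunction C D L G' (fun X Y f => a Y \oc adjr adj f)
  (fun X Y f => adjl adj (b Y \oc f)) _ _ _ _).
- by move=> X Y f; rewrite compcA ba comp1c adjrK.
- by move=> X Y f; rewrite adjlK compcA ab comp1c.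
- by move=> X X' Y f u; rewrite adjr_natl compcA.
- by move=> X Y Y' f v; rewrite adjr_natr !compcA anat.
Defined.

End AdjunctionIso.

Section QIso.
Variables (k : fieldType) (Q : lincat k) (R : kalg k).

Lemma qiso_inv (X Y : QRMod Q R) (u : hom X Y) :
  (forall p, bijective ((u : qmor X Y) p)) ->
  exists v : hom Y X, v \oc u = idc X /\ u \oc v = idc Y.
Proof.
move=> ub.
have us p y : exists x, (u : qmor X Y) p x = y.
  by have [g gK Kg] := ub p; exists (g y).
have ui p : injective ((u : qmor X Y) p) := bij_inj (ub p).
have [|v vP] := @qdesc_surj _ _ _ _ _ _ (u : qmor X Y) (qmor_id X) us.
  by move=> p x ux; apply: ui; rewrite ux !linear0.
exists v; split; apply: qmor_eq => p x; first exact: vP.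
by have [z <-] := us p x; rewrite -[RHS]/((u : qmor X Y) p z) /= vP.
Qed.

Lemma hpre_comp (U V W : QRMod (lop Q) (kself k)) (g : hom V W) (f : hom U V) (M : lmodType R) :
  (hpre M (g \oc f) : @hom (QRMod Q R) (hmod W M) (hmod U M)) =
  (hpre M f : @hom (QRMod Q R) (hmod V M) (hmod U M)) \oc hpre M g.
Proof. by apply: qmor_eq => p u; exact: klin_eq. Qed.

Lemma hpre_id (V : QRMod (lop Q) (kself k)) (M : lmodType R) :
  (hpre M (idc V) : @hom (QRMod Q R) (hmod V M) (hmod V M)) = qmor_id _.
Proof. by apply: qmor_eq => p u; exact: klin_eq. Qed.

Lemma hpre_post (V W : QRMod (lop Q) (kself k)) (g : hom V W) (M N : RMod R) (f : hom M N) :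
  (hpre N g : @hom (QRMod Q R) (hmod W N) (hmod V N)) \oc zf_map (hfun R W) f =
  zf_map (hfun R V) f \oc (hpre M g : @hom (QRMod Q R) (hmod W M) (hmod V M)).
Proof. by apply: qmor_eq => p u; exact: klin_eq. Qed.

End QIso.

Section TopInclusion.
Variables (k : fieldType) (Q : lincat k) (q : Q).

(* The inclusion D S<q> -> D Q(q, -), dual to the projection onto the top. *)
Lemma rho_linear (p : Q) :
  linear (fun n : kdual (lquot q p) =>
    ((n : {linear lquot q p -> k^o}) \o mklin (@lquot_pi_linear k Q q p) : kdual (lhom q p))).
Proof. by move=> a x y; apply: linear_eq. Qed.

Lemma rho_nat (p r : lop Q) (f : lhom p r) (n : dsimple q p) :
  mklin (@rho_linear r) (qm_map (dsimple q) f n) =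
  qm_map (drep q) f (mklin (@rho_linear p) n).
Proof.
apply: linear_eq => g.
rewrite -[LHS]/((n : {linear lquot q p -> k^o}) (lquot_map (f : @lhom k Q r p) (lquot_pi g))).
by rewrite lquot_mapE.
Qed.

Definition rho : @hom (QRMod (lop Q) (kself k)) (dsimple q) (drep q) :=
  @QMor k (lop Q) (kself k) (dsimple q) (drep q) (fun p => mklin (@rho_linear p)) rho_nat.

Lemma rho_inj p : injective ((rho : qmor _ _) p).
Proof.
move=> n m nm; apply: linear_eq => s; rewrite -(lquot_reprK s).
exact: (congr1 (fun h : kdual (lhom q p) => (h : {linear _ -> k^o}) (repr s)) nm).
Qed.

End TopInclusion.

Section SerreIso.
Variables (k : fieldType) (Q : lincat k) (R : kalg k).
Hypothesis hFin : FinCond Q.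
Variable W : lfunctor Q Q.
Variable s : forall p q : Q, {linear lhom p q -> kdual (lhom q (W p))}.
Hypothesis s_bij : forall p q, bijective (s p q).
Hypothesis s_nat : forall (p q q' : Q) (h : lhom q q') (f : lhom p q) (g : lhom q' (W p)),
  (s p q' (h \ol f) : {linear _ -> k^o}) g = (s p q f : {linear _ -> k^o}) (g \ol h).
Local Notation dfun n := ((n : kdual _) : {linear _ -> k^o}).

Lemma tau1 (p q : Q) (g : lhom q (W p)) : linear (fun f : lhom p q => dfun (s p q f) g).
Proof. by move=> a x y; rewrite linearP. Qed.

Lemma tau2 (p q : Q) : linear (fun g : lhom q (W p) => (mklin (tau1 g) : kdual (lhom p q))).
Proof. by move=> a x y; apply: linear_eq => f; rewrite /= /lin_fun linearP. Qed.

Lemma tau_nat (p : Q) (q r : lop Q) (f : lhom q r) (g : corep (W p) q) :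
  mklin (@tau2 p r) (qm_map (corep (W p)) f g) = qm_map (drep p) f (mklin (@tau2 p q) g).
Proof.
apply: linear_eq => h; symmetry.
exact: (@s_nat p r q (f : @lhom k Q r q) h g).
Qed.

Definition tau (p : Q) : @hom (QRMod (lop Q) (kself k)) (corep (W p)) (drep p) :=
  @QMor k (lop Q) (kself k) (corep (W p)) (drep p) (fun q => mklin (@tau2 p q)) (@tau_nat p).

Lemma tau_bij p q : bijective ((tau p : qmor _ _) q).
Proof.
have [n [e [c dec]]] := fdim_lhom hFin q (W p).
have [t sK tK] := s_bij p q.
have tL : linear t by move=> a x y; apply: (can_inj sK); rewrite linearP !tK.
exists (fun m : kdual (lhom p q) => \sum_i dfun m (t (c i : kdual _)) *: e i) => [g|m].
  rewrite [RHS](dec g); apply: eq_bigr => i _; congr (_ *: _).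
  exact: (congr1 (fun h : kdual _ => dfun h g) (tK (c i : kdual _))).
apply: linear_eq => f.
rewrite -[LHS]/(dfun (s p q f) (\sum_i dfun m (t (c i : kdual _)) *: e i)) linear_sum.
rewrite -[f in RHS]sK [in RHS](kdual_dec dec (s p q f)).
rewrite -[t]/(mklin tL : _ -> _) !linear_sum; apply: eq_bigr => i _.
by rewrite !linearZ; exact: mulrC.
Qed.

Lemma tau_inv_ex p : exists v, v \oc tau p = idc _ /\ tau p \oc v = idc _.
Proof. apply: qiso_inv; exact: tau_bij. Qed.

Definition tau_inv p := projT1 (cid (tau_inv_ex p)).
Lemma tau_invl p : tau_inv p \oc tau p = idc _.
Proof. by rewrite /tau_inv; case: cid => v []. Qed.
Lemma tau_invr p : tau p \oc tau_inv p = idc _.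
Proof. by rewrite /tau_inv; case: cid => v []. Qed.

Definition serre_adj (p : Q) : adjunction (evq R (W p)) (hfun R (drep p)).
Proof.
refine (@adj_iso_right (QRMod Q R) (RMod R) (evq R (W p)) (hfun R (corep (W p)))
  (hfun R (drep p)) (yon_adjunction R (W p))
  (fun M => hpre M (tau_inv p)) (fun M => hpre M (tau p)) _ _ _).
- by move=> M; rewrite -[LHS](hpre_comp (tau p) (tau_inv p)) tau_invr; exact: hpre_id.
- by move=> M; rewrite -[LHS](hpre_comp (tau_inv p) (tau p)) tau_invl; exact: hpre_id.
- by move=> M N v; exact: hpre_post.
Defined.

Lemma serre_unit_inj (p r : Q) (X : QRMod Q R) (b : lhom (W p) r) (b' : lhom r (W p)) x y :
  b \ol b' = lid r ->
  (adjr (serre_adj p) (idc (evq R (W p) X)) : qmor _ _) r x =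
  (adjr (serre_adj p) (idc (evq R (W p) X)) : qmor _ _) r y -> x = y.
Proof.
move=> bb' xy.
pose N : RMod R := evq R (W p) X.
pose h1 : @hom (QRMod Q R) (hmod (corep (W p)) N) (hmod (drep p) N) := hpre N (tau_inv p).
pose h2 : @hom (QRMod Q R) (hmod (drep p) N) (hmod (corep (W p)) N) := hpre N (tau p).
have h21 : h2 \oc h1 = idc _.
  by rewrite -[LHS](hpre_comp (tau_inv p) (tau p)) tau_invl; exact: hpre_id.
have E : h2 \oc adjr (serre_adj p) (idc N) = adjr (yon_adjunction R (W p)) (idc N).
  by rewrite -[adjr (serre_adj p) _]/(h1 \oc adjr (yon_adjunction R (W p)) _) compcA h21 comp1c.
have : qm_map (X : qmod Q R) b' x = qm_map (X : qmod Q R) b' y.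
  have Ez z : qm_map (X : qmod Q R) b' z =
    (((adjr (yon_adjunction R (W p)) (idc (evq R (W p) X)) : qmor _ _) r z) :
      klin (kob (corep (W p)) r) ((X : qmod Q R) (W p))) b' by [].
  rewrite !Ez -E.
  by rewrite -[LHS]/((h2 : qmor _ _) r _ _) xy.
move=> /(congr1 (qm_map (X : qmod Q R) b)); rewrite -!qm_comp bb' !qm_id.
by [].
Qed.

(* Q(-, q) is isomorphic to D Q(p, -) as soon as q is isomorphic to W p. *)
Lemma corep_iso_drep (p q : Q) (b : lhom (W p) q) (b' : lhom q (W p)) (M : lmodType R) :
  b \ol b' = lid q ->
  exists (u : @hom (QRMod Q R) (hmod (corep q) M) (hmod (drep p) M))
    (v : @hom (QRMod Q R) (hmod (drep p) M) (hmod (corep q) M)), v \oc u = idc _.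
Proof.
move=> bb'.
have mulL (x y : Q) (c : lhom x y) r : linear (fun g : kob (corep x) r => (c \ol g : kob (corep y) r)).
  by move=> a g h; rewrite lcompDr lcompZr.
have mulN (x y : Q) (c : lhom x y) (r r' : lop Q) (f : lhom r r') (g : corep x r) :
    mklin (mulL x y c r') (qm_map (corep x) f g) = qm_map (corep y) f (mklin (mulL x y c r) g).
  exact: (@lcompA k Q r' r x y c g f).
pose mul (x y : Q) c : @hom (QRMod (lop Q) (kself k)) (corep x) (corep y) :=
  @QMor k (lop Q) (kself k) (corep x) (corep y) (fun r => mklin (mulL x y c r)) (mulN x y c).
exists (hpre M (mul _ _ b \oc tau_inv p)), (hpre M (tau p \oc mul _ _ b')).
rewrite -hpre_comp -!compcA (compcA (tau_inv p)) tau_invl comp1c.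
rewrite -[RHS](hpre_id (R := R) (corep q : QRMod _ _) M); congr hpre.
by apply: qmor_eq => r g; rewrite /= /lin_fun /= /lin_fun lcompA bb' lcomp1l.
Qed.

End SerreIso.

(** * The classes Phi(A) and Psi(B) *)

Section CotorsionClasses.
Variables (k : fieldType) (R : kalg k) (Q : lincat k).
Hypotheses (hFin : FinCond Q) (hRad : RadCond Q).
Variables (A B : obclass (RMod R)).
Hypotheses (hAB : cotorsion_pair A B) (hhAB : hereditary A B).
Local Notation aX := (qmod_abelian R hFin).
Local Notation aM := (rmod_abelian R).
Local Notation ev X q := ((X : qmod Q R) q : RMod R).
Implicit Types X Y Z : QRMod Q R.

Definition simples (D : obclass (RMod R)) : obclass (QRMod Q R) :=
  fun Z => exists q M, D M /\ Z = simple_mod q M.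

Lemma lperp_simples D X :
  lperp (simples D) X <-> forall q M, D M -> Ext1_zero X (simple_mod q M).
Proof.
split=> [h q M DM|h _ [q [M [DM ->]]]]; last exact: h.
by apply: h; exists q, M.
Qed.

Lemma rperp_simples D X :
  rperp (simples D) X <-> forall q M, D M -> Ext1_zero (simple_mod q M) X.
Proof.
split=> [h q M DM|h _ [q [M [DM ->]]]]; last exact: h.
by apply: h; exists q, M.
Qed.

Lemma PhiE X : Phi Q A X <-> lperp (simples B) X.
Proof.
rewrite lperp_simples; have [AB BA] := hAB.
have h q := left_adjoint_perp aX aM (tensor_adjunction R (dsimple q))
  (hfun_exact (dsimple_pwfd hFin q)) X AB.
have Binj (J : RMod R) : is_injective J -> B J.
  by move=> iJ; apply/BA => M _; exact: (inj_Ext1_zero aM).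
split=> [PX q M BM|PX q]; first exact: (h q Binj).1 (PX q) M BM.
exact: (h q Binj).2 (PX q).
Qed.

Lemma PsiE X : Psi Q B X <-> rperp (simples A) X.
Proof.
rewrite rperp_simples; have [AB BA] := hAB.
have h q := right_adjoint_perp aX aM (simple_adj R hFin q)
  (hfun_exact (dsimple_pwfd hFin q)) X BA.
have Aproj (P : RMod R) : is_projective P -> A P.
  by move=> iJ; apply/AB => M _; exact: (proj_Ext1_zero aM).
split=> [PX q M AM|PX q]; first exact: (h q Aproj).1 (PX q) M AM.
exact: (h q Aproj).2 (PX q).
Qed.

Lemma klin_B (V : lmodType k) (M : RMod R) : fdim V -> B M -> B (klin V M : lmodType R).
Proof.
move=> Vfd /(hAB.2 M).2 BM; apply/(hAB.2 _) => X AX.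
by apply: klin_rperp => //; exact: BM.
Qed.

Lemma klin_A (V : lmodType k) (M : RMod R) : fdim V -> A M -> A (klin V M : lmodType R).
Proof.
move=> Vfd /(hAB.1 M).1 AM; apply/(hAB.1 _) => X BX.
by apply: klin_lperp => //; exact: AM.
Qed.

Lemma AB_Ext1_zero M N : A M -> B N -> Ext1_zero M N.
Proof. by move=> /(hAB.1 M).1; exact. Qed.

Lemma rad_nilpotent (V : QRMod (lop Q) (kself k)) : exists n, forall (p q : Q) (f : lhom p q) v,
  lrad_pow n f -> kmap (V : qmod (lop Q) (kself k)) f v = 0.
Proof.
have [_ _ [N hN]] := hFin; exists N => p q f v /hN ->.
have := @qm_scale _ _ _ (V : qmod (lop Q) (kself k)) q p 0 (0 : lhom p q) v.
by rewrite scale0r => E; rewrite /kmap E; exact: scale0r.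
Qed.

Lemma lperp_simples_hmod X (V : QRMod (lop Q) (kself k)) (M : RMod R) :
  lperp (simples B) X -> pwfd V -> B M -> @Ext1_zero (QRMod Q R) X (hmod V M).
Proof.
move=> /lperp_simples XB Vfd BM; have [n hn] := rad_nilpotent V.
apply: (filtration Vfd hn (T := fun Z => Ext1_zero X Z)) => [Z Zr ZV|Z1 Z2 Z3 i p S].
  apply: (rad_killed_rperp hFin hRad _ Zr) => q; apply: XB.
  by have [W Wfd ->] := ZV q; exact: klin_B.
exact: (Ext1_zero_ext_r aX S).
Qed.

Lemma rperp_simples_hmod X (V : QRMod (lop Q) (kself k)) (M : RMod R) :
  rperp (simples A) X -> pwfd V -> A M -> @Ext1_zero (QRMod Q R) (hmod V M) X.
Proof.
move=> /rperp_simples XA Vfd AM; have [n hn] := rad_nilpotent V.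
apply: (filtration Vfd hn (T := fun Z => Ext1_zero Z X)) => [Z Zr ZV|Z1 Z2 Z3 i p S].
  apply: (rad_killed_lperp hFin hRad _ Zr) => q; apply: XA.
  by have [W Wfd ->] := ZV q; exact: klin_A.
exact: (Ext1_zero_ext_l aX S).
Qed.

Lemma lperp_simples_ev X q : lperp (simples B) X -> A (ev X q).
Proof.
move=> XB; apply/(hAB.1 _) => b Bb.
apply: (adj_Ext1_zero_left aX aM (yon_adjunction R q) (hfun_exact (corep_pwfd hFin q))).
exact: (lperp_simples_hmod XB (corep_pwfd hFin q) Bb).
Qed.

Lemma rperp_simples_ev X q : rperp (simples A) X -> B (ev X q).
Proof.
move=> XA; apply/(hAB.2 _) => a Aa.
apply: (adj_Ext1_zero_right aM aX (yonl R hFin q) (hfun_exact (drep_pwfd (fdim_lhom hFin q)))).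
exact: (rperp_simples_hmod XA (drep_pwfd (fdim_lhom hFin q)) Aa).
Qed.

Lemma lperp_simples_ker : closed_ker_epi (lperp (simples B)).
Proof.
apply: (closed_ker_lperp aX) => _ [q [b [Bb ->]]].
exists (hmod (corep q) b), (hmod (rad_mod hRad q) b), (hpre b (sigma hRad q)),
  (hpre b (rad_inj hRad q)); split; first exact: simple_ses.
  move=> Y YB; apply: lperp_simples_hmod => //.
  by have [] := ses_pwfd (sigma_ses hRad q) (corep_pwfd hFin q).
move=> K X Y j p S XB YB.
apply: (adj_Ext1_zero_right aX aM (yon_adjunction R q) (@evq_exact _ _ R q)).
apply: AB_Ext1_zero => //; have S' := evq_exact q S.
by apply: (hhAB.1 _ _ _ _ _ (ses_epi S') (proj1 S')); exact: lperp_simples_ev.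
Qed.

Lemma rperp_simples_coker : closed_coker_mono (rperp (simples A)).
Proof.
apply: (closed_coker_rperp_class aX) => _ [q [a [Aa ->]]].
have S := qmod_cokernel_ses (@rho_inj k Q q).
set L := qquot _ in S; set e := qquot_proj _ in S.
exists (hmod L a), (hmod (drep q) a), (hpre a e), (hpre a (rho q)).
have dfd := drep_pwfd (fdim_lhom hFin q).
split; first exact (hpre_ses a S).
  move=> Y YB; apply: rperp_simples_hmod => //.
  by have [] := ses_pwfd S dfd.
move=> X Y Z j p S' XB YB.
apply: (adj_Ext1_zero_left aM aX (yonl R hFin q) (@evq_exact _ _ R q)).
apply: AB_Ext1_zero => //; have S'' := evq_exact q S'.
by apply: (hhAB.2 _ _ _ _ _ (ses_mono S'') (proj2 S'')); exact: rperp_simples_ev.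
Qed.

Section RadicalFiltration.
Variable X : QRMod Q R.

(* rad_span n at q is the submodule (rad^n X)(q) of X(q). *)
Inductive rad_span (n : nat) (q : Q) : (X : qmod Q R) q -> Prop :=
| RadSpan0 : rad_span n (0 : (X : qmod Q R) q)
| RadSpanD (p : Q) (f : lhom p q) x y :
    lrad_pow n f -> rad_span n y -> rad_span n (qm_map (X : qmod Q R) f x + y).

Lemma rad_span_linear n q a (x y : (X : qmod Q R) q) :
  rad_span n x -> rad_span n y -> rad_span n (a *: x + y).
Proof.
move=> xr yr; elim: xr => [|p f u v fn _ IH]; first by rewrite scaler0 add0r.
by rewrite scalerDr -addrA -linearZ; exact: RadSpanD.
Qed.

Definition rad_pred n q : subpred ((X : qmod Q R) q) :=
  SubPred (RadSpan0 n q) (rad_span_linear (n := n) (q := q)).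

Lemma rad_pred_st n (p q : Q) (g : lhom p q) x :
  rad_pred n p x -> rad_pred n q (qm_map (X : qmod Q R) g x).
Proof.
elim=> [|r f u v fn _ IH]; first by rewrite linear0; exact: RadSpan0.
rewrite linearD -qm_comp; apply: RadSpanD => //; exact: lrad_pow_compl.
Qed.

Lemma rad_pred_gen n (p q : Q) (f : lhom p q) x :
  lrad_pow n f -> rad_pred n q (qm_map (X : qmod Q R) f x).
Proof. by move=> fn; rewrite -[qm_map _ _ _]addr0; apply: RadSpanD => //; exact: RadSpan0. Qed.

Lemma lrad_powW n (p q : Q) (f : lhom p q) : lrad_pow n.+1 f -> lrad_pow n f.
Proof.
move E: n.+1 => m fm; elim: fm n E => {m p q f} //.
- by move=> n p q m _; exact: LRadPowZero.
- by move=> n p q f g _ IHf _ IHg m E; apply: LRadPowAdd; [exact: IHf|exact: IHg].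
- by move=> n p q r g f gr fn _ m [->]; exact: lrad_pow_compl.
Qed.

Lemma rad_predS n q x : rad_pred n.+1 q x -> rad_pred n q x.
Proof.
elim=> [|r f u v fn _ IH]; first exact: RadSpan0.
by apply: RadSpanD => //; exact: lrad_powW.
Qed.

Lemma rad_pred_rad n (p q : Q) (g : lhom p q) x :
  lrad g -> rad_pred n p x -> rad_pred n.+1 q (qm_map (X : qmod Q R) g x).
Proof.
move=> gr; elim=> [|r f u v fn _ IH]; first by rewrite linear0; exact: RadSpan0.
rewrite linearD -qm_comp; apply: RadSpanD => //; exact: LRadPowComp.
Qed.

Definition rad_quot n : QRMod Q R := qquot (@rad_pred_st n).
Definition rad_quot_proj n : hom X (rad_quot n) := qquot_proj (@rad_pred_st n).

Lemma rad_quot_eq0 n q x : (rad_quot_proj n : qmor _ _) q x = 0 <-> rad_pred n q x.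
Proof. exact: qtmod_eq0. Qed.

Lemma rad_quot_surj n q y : exists x, (rad_quot_proj n : qmor _ _) q x = y.
Proof. exact: qtmod_surj. Qed.

(* X(q) / rad^n X(q) represents the functor Hom(X, hmod (Q(-, q) / rad^n) _). *)
Lemma rad_quot_A n q : lperp (simples B) X -> A (ev (rad_quot n) q).
Proof.
move=> XB; apply/(hAB.1 _) => b Bb; apply/(Ext1_zero_sectP aM) => E j e S.
pose P : QRMod (lop Q) (kself k) := corep q.
pose I (p : lop Q) : subpred ((P : qmod _ _) p) :=
  @SubPred _ _ (fun f : lhom (p : Q) q => lrad_pow n f) (LRadPowZero _ _ _)
    (fun a f g fn gn => LRadPowAdd (lrad_pow_scale a fn) gn).
have Ist (p r : lop Q) (f : lhom p r) g : I p g -> I r (qm_map (P : qmod _ _) f g).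
  exact: lrad_pow_compr.
pose U : QRMod (lop Q) (kself k) := qsub Ist.
pose V : QRMod (lop Q) (kself k) := qquot Ist.
pose iU : hom U P := qsub_inj Ist; pose pV : hom P V := qquot_proj Ist.
have SV : short_exact iU pV.
  apply/qmod_sesP; split=> [p|p z|p y]; [exact: smod_injI | exact: qtmod_surj |].
  split=> [/(qtmod_eq0 (I p)) ys|[x <-]]; first by exists (smod_in ys).
  by apply/(qtmod_eq0 (I p)); exact: (smod_prop x).
have [_ Vfd] := ses_pwfd SV (corep_pwfd hFin q).
pose N : RMod R := ev (rad_quot n) q.
pose gam : {linear ev X q -> N} := (rad_quot_proj n : qmor _ _) q.
pose a0 : hom X (hmod P N) := yon_adjr gam.
have [|a aE] := ker_lift (t := a0) (proj1 (hpre_ses N SV)).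
  apply: qmor_eq => p x; apply: klin_eq => f.
  rewrite -[LHS]/(gam (qm_map (X : qmod Q R) (iU p f : lhom p q) x)).
  apply/rad_quot_eq0; apply: rad_pred_gen; exact: (smod_prop f).
have [h hE] := Ext1_zero_lift aX a (lperp_simples_hmod XB Vfd Bb) (hfun_exact Vfd S).
pose psi : {linear ev X q -> E} :=
  klin_ev E ((pV : qmor _ _) q (lid q : lhom q q)) \o (h : qmor _ _) q.
have psiE x : psi x = ((h : qmor _ _) q x : klin (kob (V : qmod _ _) q) E)
  ((pV : qmor _ _) q (lid q : lhom q q)) by [].
have psi0 x : gam x = 0 -> psi x = 0.
  move=> /rad_quot_eq0; elim=> [|p f u v fn _ IH]; first exact: linear0.
  rewrite linearD IH addr0 psiE qmor_nat hmod_mapE.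
  rewrite -[kmap _ _ _](qmor_nat pV (f : @lhom k (lop Q) q p) (lid q : lhom q q)).
  rewrite (_ : (pV : qmor _ _) p _ = 0) ?linear0 //.
  by apply/(qtmod_eq0 (I p)); rewrite /= /lin_fun lcomp1l.
have [s sE] := @desc_surj _ _ _ _ _ gam psi (rad_quot_surj (n := n) (q := q)) psi0.
exists s; apply: linear_eq => y; have [x <-] := rad_quot_surj y.
rewrite -[LHS]/((e : {linear _ -> _}) (s (gam x))) sE psiE.
transitivity ((((a : qmor _ _) q x) : klin (kob (V : qmod _ _) q) N)
  ((pV : qmor _ _) q (lid q : lhom q q))).
  exact: (congr1 (fun w : klin (kob (V : qmod _ _) q) N => w ((pV : qmor _ _) q (lid q : lhom q q)))
    (homE_Q x hE)).
transitivity ((((a0 : qmor _ _) q x) : klin (kob (P : qmod _ _) q) N) (lid q : lhom q q)).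
  exact: (congr1 (fun w : klin (kob (P : qmod _ _) q) N => w (lid q : lhom q q))
    (homE_Q x aE)).
by rewrite -[LHS]/(gam (qm_map (X : qmod Q R) (lid q) x)) qm_id.
Qed.

Lemma rad_quot_step n : exists (L : QRMod Q R) (i : hom L (rad_quot n.+1))
  (p : hom (rad_quot n.+1) (rad_quot n)), short_exact i p /\ rad_killed L.
Proof.
have [|p pE] := @qdesc_surj _ _ _ _ _ _ (rad_quot_proj n.+1 : qmor _ _)
  (rad_quot_proj n : qmor _ _) (rad_quot_surj (n := n.+1)).
  by move=> q x /rad_quot_eq0/rad_predS/rad_quot_eq0.
have ps q y : exists x, (p : qmor _ _) q x = y.
  have [x <-] := rad_quot_surj y; exists ((rad_quot_proj n.+1 : qmor _ _) q x).
  exact: pE.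
exists (qsub (@qker_st _ _ _ (rad_quot n.+1) (rad_quot n) p)),
  (qsub_inj (@qker_st _ _ _ (rad_quot n.+1) (rad_quot n) p)), p.
split; first exact: qmod_kernel_ses.
move=> q r g z gr; apply: smod_injI; rewrite linear0.
transitivity (qm_map (rad_quot n.+1 : qmod Q R) g (smod_inj _ z)).
  exact: (qsub_mapE (@qker_st _ _ _ (rad_quot n.+1) (rad_quot n) p) g z).
have := smod_prop z; rewrite -[\val z]/(smod_inj _ z).
have [x <-] := rad_quot_surj (smod_inj _ z).
rewrite [X in X -> _]/= pE => /rad_quot_eq0 xn.
rewrite -(qmor_nat (rad_quot_proj n.+1)); apply/rad_quot_eq0.
exact: rad_pred_rad.
Qed.

End RadicalFiltration.

Lemma lperp_rperp_simples X Y :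
  lperp (simples B) X -> rperp (simples A) Y -> Ext1_zero X Y.
Proof.
move=> XB YA.
have XnY n : Ext1_zero (rad_quot X n) Y.
  elim: n => [|n IHn].
    apply/(Ext1_zero_sectP aX) => E i p S; exists (zeroc _ _); apply: qmor_eq => q z.
    have [x <-] := rad_quot_surj z.
    have -> : (rad_quot_proj X 0 : qmor _ _) q x = 0.
      apply/rad_quot_eq0; rewrite -[x]qm_id; apply: rad_pred_gen; exact: LRadPow0.
    by rewrite !linear0.
  have [L [i [p [S Lr]]]] := rad_quot_step X n.
  apply: (Ext1_zero_ext_l aX S) => //; apply: (rad_killed_lperp hFin hRad) => // q.
  apply: (proj1 (rperp_simples A Y) YA); have S' := evq_exact q S.
  by apply: (hhAB.1 _ _ _ _ _ (ses_epi S') (proj1 S')); exact: rad_quot_A.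
have [_ _ [N hN]] := hFin.
have X0 q x : rad_pred X N q x -> x = 0.
  elim=> [//|p f u v fN _ ->]; rewrite addr0 (hN _ _ _ fN).
  have := @qm_scale _ _ _ (X : qmod Q R) p q 0 (0 : lhom p q) u.
  by rewrite scale0r rmorph0 scale0r.
have [|r rE] := @qdesc_surj _ _ _ _ _ _ (rad_quot_proj X N : qmor _ _)
  (qmor_id X) (rad_quot_surj (X := X) (n := N)).
  by move=> q x /rad_quot_eq0/X0.
apply: (retract_Ext1_zero_l aX (i := rad_quot_proj X N) (r := r) _ (XnY N)).
by apply: qmor_eq => q x; exact: rE.
Qed.

Section Compatibility.
Variable W : lfunctor Q Q.
Variable s : forall p q : Q, {linear lhom p q -> kdual (lhom q (W p))}.
Hypothesis s_bij : forall p q, bijective (s p q).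
Hypothesis s_nat : forall (p q q' : Q) (h : lhom q q') (f : lhom p q) (g : lhom q' (W p)),
  (s p q' (h \ol f) : {linear _ -> k^o}) g = (s p q f : {linear _ -> k^o}) (g \ol h).
Hypothesis W_surj : forall q, exists p (b : lhom (W p) q) (b' : lhom q (W p)), b \ol b' = lid q.
Local Notation Sadj := (serre_adj R hFin s_bij s_nat).

Definition ind_prod (M : Q -> RMod R) : QRMod Q R :=
  qprod (fun p => hfun R (drep p) (M p)).

Lemma lperp_simples_drep p (M : RMod R) : A M -> lperp (simples B) (hfun R (drep p) M).
Proof.
move=> AM; apply/lperp_simples => q b Bb.
apply: (adj_Ext1_zero_left aM aX (yonl R hFin p) (@evq_exact _ _ R p)).
by apply: AB_Ext1_zero => //; apply: klin_B => //; exact: dsimple_pwfd.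
Qed.

Lemma rperp_simples_drep p (M : RMod R) : B M -> rperp (simples A) (hfun R (drep p) M).
Proof.
move=> BM; apply/rperp_simples => q a Aa.
apply: (adj_Ext1_zero_right aX aM (Sadj p) (@evq_exact _ _ R (W p))).
by apply: AB_Ext1_zero => //; apply: klin_A => //; exact: dsimple_pwfd.
Qed.

Lemma lperp_simples_prod (M : Q -> RMod R) :
  (forall p, A (M p)) -> lperp (simples B) (ind_prod M).
Proof.
move=> AM Z SZ; apply: (coproduct_Ext1_zero aX (qprod_coproduct (drep_lfin hFin M))) => p.
exact: lperp_simples_drep.
Qed.

Lemma rperp_simples_prod (M : Q -> RMod R) :
  (forall p, B (M p)) -> rperp (simples A) (ind_prod M).
Proof.
move=> BM Z SZ.
apply: (product_Ext1_zero aX (@qprod_product k Q R Q (fun p => hfun R (drep p) (M p)))) => p.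
exact: rperp_simples_drep.
Qed.

Lemma core_rperp X :
  lperp (simples B) X -> rperp (lperp (simples B)) X -> rperp (simples A) X.
Proof.
move=> XB XP.
have AX q : A (ev X q) by exact: lperp_simples_ev.
have BX q : B (ev X q).
  apply/(hAB.2 _) => a Aa.
  apply: (adj_Ext1_zero_right aM aX (yonl R hFin q) (hfun_exact (drep_pwfd (fdim_lhom hFin q)))).
  exact: (XP _ (lperp_simples_drep (p := q) Aa)).
pose M p := ev X (W p).
have [i iE] := (proj1 (@qprod_product k Q R Q (fun p => hfun R (drep p) (M p)))) X
  (fun p => adjr (Sadj p) (idc (evq R (W p) X))).
have im : is_mono i.
  apply/qmod_monoP => r x y xy; have [p [b [b' bb']]] := W_surj r.
  apply: (serre_unit_inj (hFin := hFin) (s_bij := s_bij) (s_nat := s_nat) bb').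
  by rewrite -iE -[LHS]/((qprod_pr _ p : qmor _ _) r _) xy.
have TA := @rperp_simples_prod M (fun p => BX (W p)).
have [|r ri] := lperp_rperp_retract aX im (lperp_simples_prod (fun p => AX (W p))) XP.
  move=> Z f [q [b [Bb EZ]]]; subst Z.
  have S := qmod_cokernel_ses (@rho_inj k Q q).
  have [_ Lfd] := ses_pwfd S (drep_pwfd (fdim_lhom hFin q)).
  have [g gE] := Ext1_zero_lift aX f (lperp_simples_hmod XB Lfd Bb) (hpre_ses b S).
  exists ((hpre b (rho q) : @hom (QRMod Q R) (hmod (drep q) b) (hmod (dsimple q) b)) \oc
    (zf_map (hfun R (drep q)) (adjl (Sadj q) (g : hom X (hfun R (drep q) b))) \oc qprod_pr _ q)).
  by rewrite -!compcA iE -(adj_factor (Sadj q)).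
by move=> Z SZ; exact: (retract_Ext1_zero_r aX ri (TA Z SZ)).
Qed.

Lemma core_lperp X :
  rperp (simples A) X -> lperp (rperp (simples A)) X -> lperp (simples B) X.
Proof.
move=> XA XP.
have BX q : B (ev X q) by exact: rperp_simples_ev.
have AX q : A (ev X q).
  apply/(hAB.1 _) => b Bb.
  apply: (adj_Ext1_zero_left aX aM (yon_adjunction R q) (hfun_exact (corep_pwfd hFin q))).
  apply: XP; apply/rperp_simples => p a Aa.
  apply: (adj_Ext1_zero_right aX aM (yon_adjunction R q) (@evq_exact _ _ R q)).
  by apply: AB_Ext1_zero => //; apply: klin_A => //; exact: dsimple_pwfd.
pose M p := ev X p.
have [e eE] := (proj1 (qprod_coproduct (drep_lfin hFin M))) X
  (fun p => adjl (yonl R hFin p) (idc (M p))).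
have ee : is_epi e.
  apply/qmod_epiP => p x.
  pose c := (adjr (yonl R hFin p) (idc (hfun R (drep p) (M p))) : {linear _ -> _}) x.
  exists ((qprod_delta (fun p => hfun R (drep p) (M p)) p : qmor _ _) p c).
  rewrite [LHS](homE_Q c (eE p)).
  have := adjlK (yonl R hFin p) (idc (M p)); rewrite -{1}[adjl _ _]compc1 adjr_natr => E.
  exact: (homE_R x E).
have TA := @lperp_simples_prod M AX.
have [|r ri] := rperp_lperp_section aX ee (@rperp_simples_prod M BX) XP.
  move=> Z f [q [a [Aa EZ]]]; subst Z.
  have [Kfd _] := ses_pwfd (sigma_ses hRad q) (corep_pwfd hFin q).
  have [g gE] := Ext1_zero_extend aX f (rperp_simples_hmod XA Kfd Aa) (simple_ses hRad q a).
  have [p [b [b' bb']]] := W_surj q.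
  have [u [v vu]] := corep_iso_drep hFin s_bij s_nat a bb'.
  pose h : hom (hfun R (drep p) a) X := g \oc v.
  exists (qprod_delta (fun p => hfun R (drep p) (M p)) p \oc
    (zf_map (hfun R (drep p)) (adjr (yonl R hFin p) h) \oc
     (u \oc hpre a (sigma hRad q)))).
  rewrite compcA eE compcA -adjl_natl comp1c adjrK /h compcA -(compcA g) vu compc1.
  exact: gE.
by move=> Z SZ; exact: (retract_Ext1_zero_l aX ri (TA Z SZ)).
Qed.

End Compatibility.

End CotorsionClasses.

Lemma class_ext (C : zcat) (F G : obclass C) : (forall X, F X <-> G X) -> F = G.
Proof. by move=> FG; apply/funext => X; apply/propext. Qed.

Theorem theorem3p2 (k : fieldType) (R : kalg k) (Q : lincat k)
    (hFin : FinCond Q) (hRad : RadCond Q) (hSelfInj : SelfInjCond Q)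
    (A B : obclass (RMod R))
    (hAB : cotorsion_pair A B) (hhAB : hereditary A B) :
  [/\ cotorsion_pair (Phi Q A) (rperp (Phi Q A)),
      hereditary (Phi Q A) (rperp (Phi Q A)),
      cotorsion_pair (lperp (Psi Q B)) (Psi Q B),
      hereditary (lperp (Psi Q B)) (Psi Q B)
    & compatible (Phi Q A) (rperp (Phi Q A)) (lperp (Psi Q B)) (Psi Q B)].
Proof.
have -> : Phi Q A = lperp (simples B) by apply: class_ext => X; exact: (PhiE hFin hAB).
have -> : Psi Q B = rperp (simples A) by apply: class_ext => X; exact: (PsiE hFin hAB).
have [W [[V [_ [b bi _]]] [s [s_bij s_nat _]]]] := hSelfInj.
have W_surj q : exists p (c : lhom (W p) q) (c' : lhom q (W p)), c \ol c' = lid q.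
  by have [c' [_ cc']] := bi q; exists (V q), (b q), c'.
have aX := qmod_abelian R hFin.
have PP := lperp_rperp_simples hFin hRad hAB hhAB.
split.
- by split=> X //; split=> [XP Y|]; [exact | exact: lperp_rperp_lperp].
- split; first exact: (lperp_simples_ker hFin hRad hAB hhAB).
  apply: (closed_coker_rperp aX); last exact: (lperp_simples_ker hFin hRad hAB hhAB).
  by move=> P pP Y _; exact: (proj_Ext1_zero aX).
- by split=> X //; split=> [|XP Y]; [exact: rperp_lperp_rperp | exact].
- split; last exact: (rperp_simples_coker hFin hRad hAB hhAB).
  apply: (closed_ker_lperp_inj aX); last exact: (rperp_simples_coker hFin hRad hAB hhAB).
  by move=> J iJ Y _; exact: (inj_Ext1_zero aX).
split=> [X Y|X]; first exact: PP.
split=> [[XB XP]|[XP XA]].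
  have XA := core_rperp hFin hRad hAB s_bij s_nat W_surj XB XP.
  by split=> // Y; exact: PP.
have XB := core_lperp hFin hRad hAB s_bij s_nat W_surj XA XP.
by split=> // Y YB; exact: PP.
Qed.
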